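(* Let $(X,Y)\sim P_{X,Y}$ with marginals $P_X,P_Y$, and suppose the triplet $(P_X,P_{Y|X},P_Y)$ satisfies the extended bounding condition with constant $\omega\geq 1$, i.e. $\max_{x,y}P_{Y|X}(y|x)/P_Y(y)\le\omega$. Let $K$ be the index selected by Ensemble Rejection Sampling with batch size $N$, target $P_{Y|X}(\cdot|x)$ given $X=x$, and proposal $P_Y$, and let $R$ be the expected number of bits used to communicate $K$ by the three-message coding scheme (all defined in the context). Then for any batch size $N\ge 1$, $$R\le I(X;Y)+2\log\big(I(X;Y)+8\big)+12 .$$
   Context: All logarithms are base 2; $I(X;Y)$ is mutual information in bits. Distributions are identified with densities (or mass functions) with respect to a common reference measure. Channel simulation: the encoder observes $X=x\sim P_X$; encoder and decoder share common randomness $W$ independent of $X$; the encoder sends a binary string to the decoder, which must output $Y\sim P_{Y|X}(\cdot|x)$. The coding cost $R$ is the expected length of the string. Common randomness: $W=\{(B_1,U_1),(B_2,U_2),\dots\}$, where $U_i\sim\mathcal U(0,1)$ and each batch is $B_i=\{(Y_{i1},S_{i1}),\dots,(Y_{iN},S_{iN})\}$ with $Y_{ij}\sim P_Y$, $S_{ij}\sim\mathrm{Exp}(1)$, all independent. Notation: write $P_x=P_{Y|X}(\cdot|x)$, $\omega_x=\max_y P_x(y)/P_Y(y)$, and for $y_{1:N}=(y_1,\dots,y_N)$ and $1\le k\le N$, $$\hat Z_x(y_{1:N})=\sum_{j=1}^N\frac{P_x(y_j)}{P_Y(y_j)},\qquad \bar Z_x(y_{1:N},k)=\hat Z_x(y_{1:N})-\frac{P_x(y_k)}{P_Y(y_k)}+\omega_x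 .$$ Set $\Delta_x=\mathbb{E}_{Y_{1:N}\sim P_Y\text{ i.i.d.}}\big[N/\bar Z_x(Y_{1:N},1)\big]$ and $\Delta=\frac{N}{N-1+\omega}$ (one has $\Delta\le\Delta_x$). Ensemble Rejection Sampling (ERS): given $X=x$, process batches $i=1,2,\dots$ in order. In batch $i$ choose the candidate $K_i^{\mathrm{cand}}=\arg\min_{1\le k\le N}S_{ik}/\lambda_{ik}$ with $\lambda_{ik}=P_x(Y_{ik})/P_Y(Y_{ik})$; accept if $$U_i\le\frac{\hat Z_x(Y_{i,1:N})}{\bar Z_x(Y_{i,1:N},K_i^{\mathrm{cand}})}\cdot\frac{\Delta}{\Delta_x},$$ and otherwise go to batch $i+1$. If batch $i$ is the first accepted one, set $K_1=i$ (batch index), $K_2=K_i^{\mathrm{cand}}$ (local index); $K$ denotes the corresponding global index $(K_1-1)N+K_2$, and the selected sample is $Y_K=Y_{K_1,K_2}\sim P_x$. Under this scaling each batch is accepted with probability $\Delta$ for every $x$. Coding scheme: $K$ is represented by three messages. (1) $L=\lceil K_1/\lfloor\Delta^{-1}\rfloor\rceil$, the index of the group of $\lfloor\Delta^{-1}\rfloor$ consecutive batches containing batch $K_1$. (2) $\hat K_1$, the rank (increasing order) of $U_{K_1}$ among the $U_i$ with $(L-1)\lfloor\Delta^{-1}\rfloor+1\le i\le L\lfloor\Delta^{-1}\rfloor$. (3) $\hat K_2$, the rank (increasing order) of $S_{K_1,K_2}$ among $S_{K_1,1},\dots,S_{K_1,N}$. The decoder, knowing $W$, recovers $K$ from $(L,\hat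 K_1,\hat K_2)$. Entropy coding: the three messages are encoded separately, each positive-integer message $M'$ with a prefix-free code built from a Zipf distribution $q(m)\propto m^{-\lambda}$ with $\lambda=1+1/\mathbb{E}[\log M']$ (codeword lengths $\lceil-\log q(m)\rceil$; no bits are needed if $M'=1$ almost surely), the expectation being over $X$ and $W$. $R$ is the total expected length. *)

(* Defs.v *)
From HB Require Import structures.
From mathcomp Require Import all_boot all_order all_algebra.
From mathcomp Require Import all_classical all_reals all_analysis.
Set Implicit Arguments.
Unset Strict Implicit.
Unset Printing Implicit Defensive.
Import Order.TTheory GRing.Theory Num.Theory.
Local Open Scope classical_set_scope.
Local Open Scope ring_scope.

Section log2.
Context {R : realType}.

Definition log2 (x : R) : R := ln x / ln 2.

Definition log2e (x : \bar R) : \bar R := (lne x * ((ln 2)^-1)%:E)%E.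

End log2.

(* The law of (X, Y) with its two marginals. P_{Y|X} and P_Y are given by
   densities pYX x and pY with respect to a common sigma-finite measure ref
   (for instance a counting measure or a Lebesgue measure). *)
Record channel d d' (TX : measurableType d) (TY : measurableType d')
    (R : realType) := Channel {
  joint : probability (TX * TY)%type R;
  PX : probability TX R;
  PY : probability TY R;
  ref : {sigma_finite_measure set TY -> \bar R};
  pYX : TX -> TY -> R;
  pY : TY -> R;
  PX_marginal : forall A, measurable A -> PX A = joint (A `*` setT);
  PY_marginal : forall B, measurable B -> PY B = joint (setT `*` B);
  pYX_ge0 : forall x y, 0 <= pYX x y;
  pYX_measurable : measurable_fun setT (fun z : TX * TY => pYX z.1 z.2);
  pYX_prob : forall x, (\int[ref]_y (pYX x y)%:E = 1)%E;
  pYX_conditional : forall A B, measurable A -> measurable B ->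
    joint (A `*` B) = (\int[PX]_(x in A) \int[ref]_(y in B) (pYX x y)%:E)%E;
  pY_ge0 : forall y, 0 <= pY y;
  pY_measurable : measurable_fun setT pY;
  pY_density : forall B, measurable B ->
    PY B = (\int[ref]_(y in B) (pY y)%:E)%E }.

Section channel_theory.
Context d d' (TX : measurableType d) (TY : measurableType d') (R : realType).
Variable C : channel TX TY R.

(* In \bar R, 0^-1 = +oo and 0 * +oo = 0. Hence the ratio is +oo where
   P_Y vanishes and P_{Y|X} does not, and 0 where both vanish. *)
Definition eratio (x : TX) (y : TY) : \bar R := ((pYX C x y)%:E / (pY C y)%:E)%E.

Definition ratio (x : TX) (y : TY) : R := fine (eratio x y).

Definition extended_bounding (omega : R) : Prop :=
  (ereal_sup (range (fun z : TX * TY => eratio z.1 z.2)) <= omega%:E)%E.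

Definition omega_of (x : TX) : R := fine (ereal_sup (range (eratio x))).

(* ratio is the density of the joint law with respect to P_X \x P_Y. *)
Definition mutual_information : \bar R :=
  (\int[joint C]_z (log2 (ratio z.1 z.2))%:E)%E.

End channel_theory.

Definition mutually_independent d (T : measurableType d) (R : realType)
    (P : probability T R) (I : eqType) (F : I -> set_system T) : Prop :=
  forall (J : seq I) (A : I -> set T), uniq J ->
    (forall i, i \in J -> F i (A i)) ->
    P (\bigcap_(i in [set` J]) A i) = (\prod_(i <- J) P (A i))%E.

Section common_randomness.
Context d d' (T : measurableType d) (TY : measurableType d') (R : realType).
Variables (P : probability T R) (Q : probability TY R) (N : nat).

Definition rv_systems (Y : nat -> 'I_N -> {RV P >-> TY})
    (S : nat -> 'I_N -> {RV P >-> R}) (U : nat -> {RV P >-> R})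
    (i : (nat * 'I_N) + (nat * 'I_N) + nat) : set_system T :=
  match i with
  | inl (inl ij) => preimage_set_system setT (Y ij.1 ij.2) measurable
  | inl (inr ij) => preimage_set_system setT (S ij.1 ij.2) measurable
  | inr i => preimage_set_system setT (U i) measurable
  end.

(* Batches and candidates are numbered from 0. *)
Record common_randomness := CommonRandomness {
  cY : nat -> 'I_N -> {RV P >-> TY};
  cS : nat -> 'I_N -> {RV P >-> R};
  cU : nat -> {RV P >-> R};
  cY_law : forall i j B, measurable B -> distribution P (cY i j) B = Q B;
  cS_law : forall i j B, measurable B ->
    distribution P (cS i j) B = exponential_prob 1 B;
  cU_law : forall i B, measurable B ->
    distribution P (cU i) B = uniform_prob (@ltr01 R) B;
  c_indep : mutually_independent P (rv_systems cY cS cU) }.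

End common_randomness.

Section ensemble_rejection_sampling.
Context d d' d'' (TX : measurableType d) (TY : measurableType d')
  (T : measurableType d'') (R : realType).
Variables (C : channel TX TY R) (omega : R) (P : probability T R).
Variables (N : nat) (N_gt0 : (0 < N)%N) (W : common_randomness P (PY C) N).

Definition Zhat (x : TX) (y : 'I_N -> TY) : R := \sum_j ratio C x (y j).

Definition Zbar (x : TX) (y : 'I_N -> TY) (k : 'I_N) : R :=
  Zhat x y - ratio C x (y k) + omega_of C x.

Definition batch (w : T) (i : nat) : 'I_N -> TY := fun j => cY W i j w.

(* The expectation is over N i.i.d. samples of P_Y; batch 0 is one. *)
Definition Delta_of (x : TX) : R :=
  fine 'E_P[fun w => (N%:R / Zbar x (batch w 0) (Ordinal N_gt0))%R].

Definition Delta : R := N%:R / (N%:R - 1 + omega).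

(* The quotient is taken in \bar R, so that it is +oo when the ratio is 0
   (and S > 0, which holds almost surely). *)
Definition candidate (x : TX) (w : T) (i : nat) : 'I_N :=
  [arg min_(k < Ordinal N_gt0)
     ((cS W i k w)%:E / eratio C x (batch w i k))%E]%O.

Definition accepted (x : TX) (w : T) (i : nat) : bool :=
  cU W i w <= Zhat x (batch w i) / Zbar x (batch w i) (candidate x w i)
              * (Delta / Delta_of x).

(* K_1 - 1, as batches are numbered from 0; the value 0 when no batch is
   accepted is arbitrary. *)
Definition K1 (x : TX) (w : T) : nat :=
  if pselect (exists i, accepted x w i) is left h then ex_minn h else 0%N.

Definition K2 (x : TX) (w : T) : 'I_N := candidate x w (K1 x w).

Definition group_size : nat := Num.truncn Delta^-1.

(* ceil ((K1 + 1) / group_size) *)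
Definition msgL (x : TX) (w : T) : nat := (K1 x w %/ group_size).+1.

Definition msgK1 (x : TX) (w : T) : nat :=
  (\sum_((msgL x w).-1 * group_size <= i < msgL x w * group_size)
    (cU W i w <= cU W (K1 x w) w)%R)%N.

Definition msgK2 (x : TX) (w : T) : nat :=
  (\sum_(j < N) (cS W (K1 x w) j w <= cS W (K1 x w) (K2 x w) w)%R)%N.

End ensemble_rejection_sampling.

Section entropy_coding.
Context {R : realType}.

Definition zipf (lambda : R) (m : nat) : R :=
  m%:R `^ (- lambda) /
  fine (\sum_(1 <= n <oo) (n%:R `^ (- lambda))%:E)%E.

Definition codeword_length (lambda : R) (m : nat) : int :=
  Num.ceil (- log2 (zipf lambda m)).

Context d d' (TX : measurableType d) (T : measurableType d').
Variables (Q : probability TX R) (P : probability T R).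

(* X has law Q and is independent of W, which lives on the space of P. The
   inner integral is for fixed x, so that the definition does not depend on a
   version of the densities for which omega_of is measurable in x. *)
Definition expectation_XW (g : TX -> T -> \bar R) : \bar R :=
  (\int[Q]_x \int[P]_w g x w)%E.

Definition zipf_exponent (M : TX -> T -> nat) : R :=
  1 + (fine (expectation_XW (fun x w => (log2 (M x w)%:R)%:E)))^-1.

Definition expected_length (M : TX -> T -> nat) : \bar R :=
  if `[< {ae Q, forall x, {ae P, forall w, M x w = 1%N}} >] then 0%E
  else expectation_XW
         (fun x w => (codeword_length (zipf_exponent M) (M x w))%:~R%:E).

End entropy_coding.

Section rate.
Context d d' d'' (TX : measurableType d) (TY : measurableType d')
  (T : measurableType d'') (R : realType).
Variables (C : channel TX TY R) (omega : R) (P : probability T R).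
Variables (N : nat) (N_gt0 : (0 < N)%N) (W : common_randomness P (PY C) N).

Definition rate : \bar R :=
  (expected_length (PX C) P (msgL omega N_gt0 W)
   + expected_length (PX C) P (msgK1 omega N_gt0 W)
   + expected_length (PX C) P (msgK2 omega N_gt0 W))%E.

End rate.

(* Main.v *)
(* Conditionally on X = x write r = P_x / P_Y. Since log2 t <= 3 + t / 8, the sum of the
   logarithms of the two ranks is at most log2 (1 + r) + 3 + t / 8, where r is the ratio of the
   selected sample and t is the product of the ranks divided by 1 + r. The selected sample has
   law P_x and E t <= 15: candidate k wins the exponential race with probability r_k / Zhat,
   it wins it and is beaten by a given other S with probability at most 2 (r_k / Zhat)^2, and
   what remains are moments of 1 / Zbar over one batch, all comparable with Delta_x / N.
   Averaging over X costs I(X;Y) + 1 for log2 (1 + r). A group of 1 / Delta batches is rejected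
   with probability at most 1/2, so the logarithm of L has mean at most 1. A Zipf code for a
   message M of mean logarithm e has length at most e + log2 (1 + e) + 2, because the zeta
   function at 1 + 1/e is at most 1 + e; concavity of log2 combines the two rank messages. *)
Require Import Defs.
From HB Require Import structures.
From mathcomp Require Import all_boot all_order all_algebra.
From mathcomp Require Import all_classical all_reals all_analysis.
From mathcomp Require Import measurable_realfun ring lra.
Set Implicit Arguments.
Unset Strict Implicit.
Unset Printing Implicit Defensive.
Import Order.TTheory GRing.Theory Num.Theory.
Import numFieldNormedType.Exports.
Local Open Scope classical_set_scope.
Local Open Scope ring_scope.
Local Notation ratio := Defs.ratio.

(** * Lower integrals *)

(** The messages depend on x through the supremum [omega_of], which need not be measurable, so the
    integrals in the rate are only lower integrals. Every bound therefore dominates a message by a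
    measurable function, and the two rank messages are joined by superadditivity, the direction that
    lower integrals keep.

    In the same spirit the law of the selected index is never computed. Ties, vanishing ratios and
    non-termination are absorbed by nonnegative functions ([rejected], [accept_sum], [accept_rank])
    that dominate what is needed on the almost sure event [regular], and whose means can be taken
    batch by batch.

    The constants add up as follows. The logarithms of the ranks have total mean at most I + 1 + 3 +
    15/8 <= I + 6. Each Zipf code adds 2 + log2 (1 + e). AM-GM gives log2 (1 + e2) + log2 (1 + e3)
    <= 2 log2 (I + 8) - 2 when e2 + e3 <= I + 6, and the message L costs at most 1 + 1 + 2. Beside
    the logarithm this is I + 6 + 4 - 2 + 4 = I + 12. *)

Section lower_integral.
Import HBNNSimple.
Local Open Scope ereal_scope.
Context d (T : measurableType d) (R : realType).
Variable mu : {measure set T -> \bar R}.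

(* For nonnegative functions, measurable or not, the integral is a lower integral:
   monotone and superadditive, but not additive. *)
Lemma le_lower_integral (f g : T -> \bar R) :
  (forall x, 0 <= g x) -> (forall x, f x <= g x) ->
  \int[mu]_x f x <= \int[mu]_x g x.
Proof.
move=> g0 fg; rewrite integralE -[leRHS]sube0.
apply: leeB; last by apply: integral_ge0 => x _; exact: funeneg_ge0.
rewrite ge0_integralTE; last by move=> x; exact: funepos_ge0.
rewrite ge0_integralTE//; apply: le_ereal_sup => _ [h /= hf <-].
exists h => // x; apply: (le_trans (hf x)).
by rewrite funeposE ge_max fg g0.
Qed.

(** Sums of simple minorants of f and g are simple minorants of f + g. The two suprema are then
    taken one at a time, by subtraction, which is why the case [M = +oo] is set apart. *)
Lemma ge0_lower_integralD (f g : T -> \bar R) :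
  (forall x, 0 <= f x) -> (forall x, 0 <= g x) ->
  \int[mu]_x f x + \int[mu]_x g x <= \int[mu]_x (f x + g x).
Proof.
move=> f0 g0; have fg0 x : 0 <= f x + g x by exact: adde_ge0.
set M := leRHS; have [->|Moo] := eqVneq M +oo; first by rewrite leey.
have Mfin : M \is a fin_num.
  by rewrite ge0_fin_numE ?lt_neqAle ?Moo ?leey//; exact: integral_ge0.
have le_nn (u v : {nnsfun T >-> R}) : (forall x, (u x)%:E <= f x) ->
    (forall x, (v x)%:E <= g x) -> sintegral mu u + sintegral mu v <= M.
  move=> uf vg; rewrite -!integralT_nnsfun -ge0_integralD//.
  - by apply: le_lower_integral => // x; exact: leeD.
  - by move=> x _; rewrite lee_fin fun_ge0.
  - exact/measurable_EFinP.
  - by move=> x _; rewrite lee_fin fun_ge0.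
  - exact/measurable_EFinP.
have s0 (u : {nnsfun T >-> R}) : 0 <= sintegral mu u by exact: sintegral_ge0.
have sfin (u v : \bar R) : 0 <= u -> 0 <= v -> u + v <= M -> v \is a fin_num.
  move=> u0 v0 uvM; rewrite ge0_fin_numE//.
  by rewrite (le_lt_trans (leeDr v u0))// (le_lt_trans uvM)// -ge0_fin_numE//;
    exact: integral_ge0.
have If0 : 0 <= \int[mu]_x f x by exact: integral_ge0.
have le_f (v : {nnsfun T >-> R}) : (forall x, (v x)%:E <= g x) ->
    \int[mu]_x f x + sintegral mu v <= M.
  move=> vg.
  have vfin : sintegral mu v \is a fin_num.
    apply: (sfin (sintegral mu (@nnsfun0 _ T R))) => //.
    by apply: le_nn => // x; rewrite /= f0.
  rewrite -leeBrDr// ge0_integralTE//; apply: ge_ereal_sup => _ [u /= uf <-].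
  by rewrite leeBrDr//; exact: le_nn.
have ffin : \int[mu]_x f x \is a fin_num.
  apply: (sfin (sintegral mu (@nnsfun0 _ T R))) => //.
  by rewrite addeC; apply: le_f => x; rewrite /= g0.
rewrite addeC -leeBrDr// [X in X <= _]ge0_integralTE//.
apply: ge_ereal_sup => _ [v /= vg <-].
by rewrite leeBrDr// addeC; exact: le_f.
Qed.

(** For affine maps the missing subadditivity does hold: a simple h below a f + c yields the
    measurable minorant max (h - c, 0) / a of f. *)
Lemma lower_integral_affine (f : T -> \bar R) (a c : R) :
  (0 <= a)%R -> (0 <= c)%R -> (forall x, 0 <= f x) ->
  \int[mu]_x (a%:E * f x + c%:E) <= a%:E * \int[mu]_x f x + c%:E * mu setT.
Proof.
move=> a0 c0 f0.
have If0 : 0 <= \int[mu]_x f x by exact: integral_ge0.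
rewrite ge0_integralTE; last first.
  by move=> x; apply: adde_ge0 => //; exact: mule_ge0.
apply: ge_ereal_sup => _ [h /= hf <-].
have [a00|a00] := eqVneq a 0%R.
  rewrite a00 mul0e add0e -integralT_nnsfun.
  rewrite -(integral_cst mu measurableT).
  apply: le_lower_integral => // x.
  by apply: (le_trans (hf x)); rewrite a00 mul0e add0e.
have {}a0 : (0 < a)%R by rewrite lt_neqAle eq_sym a00.
pose k x := (a^-1 * Num.max (h x - c) 0)%R.
have k0 x : (0 <= k x)%R by rewrite mulr_ge0 ?invr_ge0 ?(ltW a0)// le_max lexx orbT.
have mk : measurable_fun setT k.
  apply: measurable_funM => //; apply: measurable_maxr => //.
  exact: measurable_funB.
have kf x : (k x)%:E <= f x.
  have := hf x; have := f0 x; case: (f x) => [r| |]//=; last first.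
    by move=> _ _; rewrite leey.
  rewrite !lee_fin => r0 har; rewrite /k mulrC ler_pdivrMr// ge_max.
  by rewrite lerBlDr mulrC har mulr_ge0// ltW.
have hk x : (h x)%:E <= (a * k x)%:E + c%:E.
  by rewrite -EFinD lee_fin mulVKf ?gt_eqF// -lerBlDr le_max lexx.
rewrite -integralT_nnsfun.
apply: (@le_trans _ _ (\int[mu]_x (a%:E * (k x)%:E + c%:E))).
  apply: le_lower_integral => x; last by rewrite -EFinM.
  by rewrite adde_ge0 ?lee_fin// mulr_ge0// ltW.
have mak : measurable_fun setT (fun x => a%:E * (k x)%:E).
  by apply: measurable_funeM; exact/measurable_EFinP.
rewrite ge0_integralD//; last first.
  by move=> x _; rewrite lee_fin mulr_ge0// ltW.
rewrite (integral_cst mu measurableT c%:E) leeD2r//.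
rewrite ge0_integralZl_EFin ?(ltW a0)//; last 2 first.
- by move=> x _; rewrite lee_fin.
- exact/measurable_EFinP.
by apply: lee_wpmul2l; rewrite ?lee_fin ?(ltW a0)//; exact: le_lower_integral.
Qed.

Lemma ae_le_lower_integral (f g : T -> \bar R) :
  (forall x, 0 <= g x) -> measurable_fun setT g ->
  {ae mu, forall x, f x <= g x} -> \int[mu]_x f x <= \int[mu]_x g x.
Proof.
move=> g0 mg [N [mN N0 fgN]].
(* Since f may fail to be measurable, the exceptional null set is absorbed by raising g to +oo on
   it. *)
pose g' x := if x \in N then +oo else g x.
have g'0 x : 0 <= g' x by rewrite /g'; case: ifP.
have mg' : measurable_fun setT g'.
  apply: measurable_fun_ifT => //; apply: (measurable_fun_bool true) => //=.
  rewrite setTI [X in measurable X](_ : _ = N)//.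
  by apply/seteqP; split => x; [exact: set_mem|exact: mem_set].
apply: (@le_trans _ _ (\int[mu]_x g' x)).
  apply: le_lower_integral => // x; rewrite /g'; case: ifPn => [_|xN].
    by rewrite leey.
  by apply: contrapT => fgx; move/negP: xN; apply; rewrite inE; apply: fgN.
apply: ae_ge0_le_integral => //; exists N; split => // x /= xN.
apply: contrapT => Nx; apply: xN => _.
by rewrite /g' memNset.
Qed.

End lower_integral.

(** * Independence *)

Section independence.
Context d (T : measurableType d) (R : realType) (P : probability T R).

(** Independence makes the law of (X, Z) the product of the two laws; the rest is Tonelli. *)
Lemma ge0_integral_independent d1 d2 (E1 : measurableType d1)
    (E2 : measurableType d2) (X : T -> E1) (Z : T -> E2)
    (f : E1 -> E2 -> \bar R) :
  measurable_fun setT X -> measurable_fun setT Z ->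
  (forall A B, measurable A -> measurable B ->
     P (X @^-1` A `&` Z @^-1` B) = (P (X @^-1` A) * P (Z @^-1` B))%E) ->
  (forall x z, (0 <= f x z)%E) ->
  measurable_fun setT (fun u : E1 * E2 => f u.1 u.2) ->
  (\int[P]_w f (X w) (Z w) = \int[P]_w \int[P]_v f (X w) (Z v))%E.
Proof.
move=> mX mZ PXZ f0 mf.
pose X' : {mfun T >-> E1} := HB.pack X (isMeasurableFun.Build _ _ _ _ _ mX).
pose Z' : {mfun T >-> E2} := HB.pack Z (isMeasurableFun.Build _ _ _ _ _ mZ).
have mXZ : measurable_fun setT (fun w => (X w, Z w)).
  exact: measurable_fun_pair.
pose XZ : {mfun T >-> (E1 * E2)%type} :=
  HB.pack (fun w => (X w, Z w)) (isMeasurableFun.Build _ _ _ _ _ mXZ).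
transitivity (\int[distribution P XZ]_u f u.1 u.2)%E.
  by rewrite ge0_integral_pushforward// => u _.
transitivity (\int[distribution P X' \x distribution P Z']_u f u.1 u.2)%E.
  apply: eq_measure_integral => A mA _; apply/esym.
  exact: product_measure_unique.
rewrite (fubini_tonelli1 (fun u => f u.1 u.2))//= /fubini_F/=.
rewrite ge0_integral_pushforward//=; last 2 first.
- exact: (measurable_fun_fubini_tonelli_F (fun u => f u.1 u.2)).
- by move=> x _; exact: integral_ge0.
apply: eq_integral => w _; rewrite ge0_integral_pushforward//.
exact: (measurableT_comp mf (measurable_fun_pair (measurable_cst (X w))
  (@measurable_id _ _ setT))).
Qed.

Variables (I : choiceType) (F : I -> set_system T).
Hypothesis F_measurable : forall i A, F i A -> measurable A.
Hypothesis FI : forall i, setI_closed (F i).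
Hypothesis FT : forall i, F i setT.
Hypothesis F_indep : mutually_independent P F.

Definition sigma_of (J : set I) : set_system T :=
  <<s \bigcup_(i in J) F i >>.

(** A pi-system that generates [sigma_of J] and on which [mutually_independent] can be applied
    directly. *)
Definition cylinders (J : set I) : set_system T :=
  [set A | exists (s : seq I) (E : I -> set T),
    [/\ uniq s, forall i, i \in s -> J i, forall i, i \in s -> F i (E i)
      & A = \bigcap_(i in [set` s]) E i]].

Lemma cylinders_measurable J A : cylinders J A -> measurable A.
Proof.
move=> [s [E [_ _ FE ->]]]; apply: fin_bigcap_measurable => // i /= /FE.
exact: F_measurable.
Qed.

Lemma cylindersT J : cylinders J setT.
Proof.
exists [::], (fun=> setT); split => //.
by apply/seteqP; split => // x _ i.
Qed.

Lemma cylinders_setI J : setI_closed (cylinders J).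
Proof.
move=> _ _ [s1 [E1 [u1 J1 F1 ->]]] [s2 [E2 [u2 J2 F2 ->]]].
(* Outside its own list each family is replaced by [setT], so that one family serves the merged
   list. *)
pose E i := (if i \in s1 then E1 i else setT) `&` (if i \in s2 then E2 i else setT).
exists (undup (s1 ++ s2)), E; split.
- exact: undup_uniq.
- by move=> i; rewrite mem_undup mem_cat => /orP[/J1|/J2].
- move=> i _; apply: FI; first by case: ifP => [/F1//|_]; exact: FT.
  by case: ifP => [/F2//|_]; exact: FT.
- apply/seteqP; split => x /=.
    move=> [xE1 xE2] i /= _; split.
      by case: ifP => // ?; exact: xE1.
    by case: ifP => // ?; exact: xE2.
  move=> xE; split => i /= is_.
    have := xE i; rewrite /= mem_undup mem_cat is_ /= => /(_ isT) [].
    by rewrite is_.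
  have := xE i; rewrite /= mem_undup mem_cat is_ orbT => /(_ isT) [].
  by rewrite is_.
Qed.

Lemma sigma_of_cylinders J : sigma_of J `<=` <<s cylinders J >>.
Proof.
apply: smallest_sub => [|A [i Ji FA]]; first exact: smallest_sigma_algebra.
apply: sub_sigma_algebra; exists [:: i], (fun=> A); split => //.
- by move=> j; rewrite inE => /eqP ->.
- by move=> j; rewrite inE => /eqP ->.
- apply/seteqP; split => x /=; first by move=> xA j.
  by apply; rewrite /= inE.
Qed.

Lemma sigma_of_measurable J A : sigma_of J A -> measurable A.
Proof.
apply: smallest_sub; first exact: sigma_algebra_measurable.
by move=> B [i _ /F_measurable].
Qed.

Lemma cylinders_indep J1 J2 A B : J1 `&` J2 = set0 ->
  cylinders J1 A -> cylinders J2 B -> P (A `&` B) = (P A * P B)%E.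
Proof.
move=> J12 [s1 [E1 [u1 H1 F1 ->]]] [s2 [E2 [u2 H2 F2 ->]]].
pose E i := if i \in s1 then E1 i else E2 i.
have s21 i : i \in s2 -> (i \in s1) = false.
  move=> is2; apply/negP => is1.
  by have /seteqP[/(_ i) + _] := J12; apply; split; [exact: H1|exact: H2].
have -> : \bigcap_(i in [set` s1]) E1 i = \bigcap_(i in [set` s1]) E i.
  by apply: eq_bigcapr => i /= is1; rewrite /E is1.
have -> : \bigcap_(i in [set` s2]) E2 i = \bigcap_(i in [set` s2]) E i.
  by apply: eq_bigcapr => i /= is2; rewrite /E s21.
have -> : \bigcap_(i in [set` s1]) E i `&` \bigcap_(i in [set` s2]) E i =
    \bigcap_(i in [set` (s1 ++ s2)]) E i.
  apply/seteqP; split => x /=.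
    move=> [x1 x2] i /=; rewrite mem_cat => /orP[?|?]; [exact: x1|exact: x2].
  by move=> xE; split => i /= is_; apply: xE; rewrite /= mem_cat is_ ?orbT.
have FE1 i : i \in s1 -> F i (E i) by move=> is1; rewrite /E is1; exact: F1.
have FE2 i : i \in s2 -> F i (E i) by move=> is2; rewrite /E s21//; exact: F2.
rewrite !F_indep ?big_cat//.
  rewrite cat_uniq u1 u2 andbT/=; apply/hasPn => i is2; apply/negP.
  by rewrite /= s21.
by move=> i; rewrite mem_cat => /orP[]; [exact: FE1|exact: FE2].
Qed.

(** Two passes of uniqueness of measures on a pi-system: with B fixed, both sides are finite
    measures in A that agree on cylinders, hence on what these generate; then A and B exchange
    roles. *)
Lemma sigma_of_indep J1 J2 A B : J1 `&` J2 = set0 ->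
  sigma_of J1 A -> sigma_of J2 B -> P (A `&` B) = (P A * P B)%E.
Proof.
move=> J12 /sigma_of_cylinders sA /sigma_of_cylinders sB.
have ext J (B0 : set T) (mB0 : measurable B0) :
    (forall A0, cylinders J A0 -> P (A0 `&` B0) = (P A0 * P B0)%E) ->
    forall A0, <<s cylinders J >> A0 -> P (A0 `&` B0) = (P A0 * P B0)%E.
  move=> H A0 sA0.
  have PB0 : 0 <= fine (P B0) by exact: fine_ge0.
  suff : mrestr P mB0 A0 = mscale (NngNum PB0) P A0.
    by rewrite /mrestr /mscale/= => ->; rewrite fineK ?fin_num_measure// muleC.
  apply: (@g_sigma_algebra_measure_unique _ _ _ (cylinders J)
    (@cylinders_measurable J) (fun=> setT) (fun=> cylindersT J) _
    (mrestr P mB0) (mscale (NngNum PB0) P) (@cylinders_setI J)) => //.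
  - exact: bigcup_const.
  - move=> A1 /H HA1; rewrite /= /mscale/= fineK ?fin_num_measure// muleC.
    exact: HA1.
  - by move=> _; rewrite /= /mrestr setTI ltey_eq fin_num_measure.
have mB : measurable B.
  apply: smallest_sub sB; first exact: sigma_algebra_measurable.
  exact: cylinders_measurable.
apply: (ext J1) => // A0 cA0; rewrite setIC muleC.
apply: (ext J2) => //; first exact: cylinders_measurable cA0.
by move=> B0 cB0; rewrite setIC muleC; exact: cylinders_indep cA0 cB0.
Qed.

(** Measurability on [sub_space J] expresses that a function depends only on the variables indexed
    by J. *)
Definition sub_space (J : set I) := g_sigma_algebraType (\bigcup_(i in J) F i).

(** The identity, seen as a map into [sub_space J1] and as a map into [sub_space J2], gives two
    independent random elements. *)
Lemma ge0_integral_freeze (J1 J2 : set I) (f : T -> T -> \bar R) :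
  J1 `&` J2 = set0 -> (forall w v, (0 <= f w v)%E) ->
  measurable_fun setT (fun z : sub_space J1 * sub_space J2 => f z.1 z.2) ->
  (\int[P]_w f w w = \int[P]_w \int[P]_v f w v)%E.
Proof.
move=> J12 f0 mf.
have mid J : measurable_fun setT (id : T -> sub_space J).
  by move=> _ B /= mB; rewrite setTI preimage_id; exact: sigma_of_measurable mB.
apply: (@ge0_integral_independent _ _ (sub_space J1) (sub_space J2) id id f) => //.
by move=> A B mA mB; rewrite !preimage_id; exact: sigma_of_indep mA mB.
Qed.

End independence.

(** * Integration against a measure given by a density *)

Section density.
Local Open Scope ereal_scope.
Import HBNNSimple.
Context d (T : measurableType d) (R : realType).
Variables (mu nu : {measure set T -> \bar R}) (g : T -> R).
Hypotheses (g0 : forall x, (0 <= g x)%R) (mg : measurable_fun setT g).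
Hypothesis nuE : forall A, measurable A -> nu A = \int[mu]_(x in A) (g x)%:E.

Let emg : measurable_fun setT (fun x => (g x)%:E).
Proof. exact/measurable_EFinP. Qed.

Let eg0 x : 0 <= (g x)%:E. Proof. by rewrite lee_fin. Qed.

Lemma integral_density_nnsfun (h : {nnsfun T >-> R}) :
  \int[nu]_x (h x)%:E = \int[mu]_x ((h x)%:E * (g x)%:E).
Proof.
transitivity (\sum_(k \in range h) \int[nu]_x (k * \1_(h @^-1` [set k]) x)%:E).
  under eq_integral do rewrite fimfunE -fsumEFin//.
  rewrite ge0_integral_fsum//.
  - by move=> y; exact/measurable_EFinP/measurable_funM.
  - by move=> y x _; rewrite nnfun_muleindic_ge0.
transitivity (\sum_(k \in range h)
    \int[mu]_x ((k * \1_(h @^-1` [set k]) x)%:E * (g x)%:E)); last first.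
  rewrite -ge0_integral_fsum//; last 2 first.
  - by move=> y; apply: emeasurable_funM => //; exact/measurable_EFinP/measurable_funM.
  - by move=> y x _; rewrite mule_ge0// nnfun_muleindic_ge0.
  apply: eq_integral => x _; rewrite [in RHS]fimfunE -fsumEFin//.
  rewrite !fsbig_finite//= ge0_sume_distrl// => k _.
  by rewrite nnfun_muleindic_ge0.
apply: eq_fsbigr => k; rewrite inE => -[x0 _ hk].
have k0 : (0 <= k)%R by rewrite -hk fun_ge0.
have mk : measurable (h @^-1` [set k]) by exact: measurable_sfunP.
under eq_integral do rewrite EFinM.
rewrite ge0_integralZl_EFin//; last exact/measurable_EFinP/measurable_indic.
rewrite integral_indic// setIT nuE//.
under [in RHS]eq_integral do rewrite EFinM -muleA.
rewrite ge0_integralZl_EFin//; last 2 first.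
- by move=> x _; rewrite mule_ge0// lee_fin.
- by apply: emeasurable_funM => //; exact/measurable_EFinP/measurable_indic.
congr (_ * _); rewrite integral_mkcond; apply: eq_integral => x _.
rewrite patchE indicE; case: ifPn => _; first by rewrite mul1e.
by rewrite mul0e.
Qed.

Lemma ge0_integral_density (f : T -> \bar R) :
  (forall x, 0 <= f x) -> measurable_fun setT f ->
  \int[nu]_x f x = \int[mu]_x (f x * (g x)%:E).
Proof.
move=> f0 mf; pose h := nnsfun_approx measurableT mf.
have hf x : (h n x)%:E @[n --> \oo] --> f x by exact: cvg_nnsfun_approx.
have ndh x : {homo (fun n => (h n x)%:E) : m n / (m <= n)%N >-> m <= n}.
  by move=> m n mn; rewrite lee_fin; exact/lefP/nd_nnsfun_approx.
have mh n : measurable_fun setT (fun x => (h n x)%:E) by exact/measurable_EFinP.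
have -> : \int[nu]_x f x = limn (fun n => \int[nu]_x (h n x)%:E).
  rewrite -monotone_convergence//.
  - by apply: eq_integral => x _; apply/esym/cvg_lim => //; exact: hf.
  - by move=> n x _; rewrite lee_fin fun_ge0.
have -> : (fun n => \int[nu]_x (h n x)%:E) =
    (fun n => \int[mu]_x ((h n x)%:E * (g x)%:E)).
  by apply/funext => n; exact: integral_density_nnsfun.
rewrite -monotone_convergence//.
- by apply: eq_integral => x _; apply/cvg_lim => //; exact: cvgeZr.
- by move=> n; exact: emeasurable_funM.
- by move=> n x _; rewrite mule_ge0// lee_fin fun_ge0.
- by move=> x _ m n mn; rewrite lee_wpmul2r// ndh.
Qed.

End density.

(** * Exponential and uniform laws *)

Section exponential_uniform.
Context {R : realType}.
Local Open Scope ereal_scope.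

Lemma exponential_prob_tail (E : probability R R) (c : R) :
  (forall A, measurable A -> E A = exponential_prob 1 A) -> (0 <= c)%R ->
  E `[c, +oo[%classic <= (expR (- c))%:E.
Proof.
move=> EE; rewrite le_eqVlt => /orP[/eqP <-|c0].
  by rewrite oppr0 expR0; exact: probability_le1.
have -> : `[c, +oo[%classic = ~` `]-oo, c[%classic :> set R by rewrite setCitvl.
rewrite probability_setC//.
have : E `[0%R, c[%classic <= E `]-oo, c[%classic.
  by apply: le_measure; rewrite ?inE//; exact: subset_itvr.
have -> : E `[0%R, c[%classic = 1 - (expR (- c))%:E.
  rewrite EE//; transitivity (exponential_prob 1 `[0%R, c]); last first.
    by rewrite exponential_prob_itv0c// mulN1r.
  apply: integral_itv_bndo_bndc.
  by apply/measurable_funTS/measurable_EFinP; exact: measurable_exponential_pdf.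
have := fin_num_measure E _ (@measurable_itv R `]-oo, c[).
case: (E _) => [r _|//|//]; last by move=> _; rewrite addeNy leNye.
rewrite -!EFinB !lee_fin; lra.
Qed.

Lemma exponential_prob_itvcc (a b : R) : (0 <= a)%R -> (a <= b)%R ->
  exponential_prob 1 `[a, b] <= ((b - a) * expR (- a))%:E.
Proof.
move=> a0 ab; rewrite /exponential_prob.
apply: (@le_trans _ _ (\int[lebesgue_measure]_(x in `[a, b]) (expR (- a))%:E)).
  apply: ge0_le_integral => //.
  - by move=> x _; rewrite lee_fin exponential_pdf_ge0.
  - by apply/measurable_funTS/measurable_EFinP; exact: measurable_exponential_pdf.
  - move=> x /=; rewrite in_itv/= => /andP[ax _]; rewrite lee_fin.
    by rewrite exponential_pdfE ?(le_trans a0)// mul1r mulN1r ler_expR lerN2.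
rewrite integral_cst//= lebesgue_measure_itv/= lte_fin.
case: ifPn => [_|]; first by rewrite -EFinB -EFinM mulrC.
by rewrite mule0 lee_fin mulr_ge0 ?expR_ge0// subr_ge0.
Qed.

(** The hypothesis compares f times the Exp(1) density with c / r times the Exp(r) density, whose
    total mass is 1. *)
Lemma exponential_integral (nu : {measure set (measurableTypeR R) -> \bar R})
    (f : R -> R) (c r : R) :
  (forall A, measurable A -> nu A = exponential_prob 1 A) ->
  (0 < r)%R -> (0 <= c)%R -> (forall s, 0 <= f s)%R -> measurable_fun setT f ->
  (forall s, 0 <= s -> f s * expR (- s) <= c * expR (- r * s))%R ->
  \int[nu]_s (f s)%:E <= (c / r)%:E.
Proof.
move=> nuE r0 c0 f0 mf fle.
have mpdf (q : R) := measurable_exponential_pdf q.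
have pdf0 (q : R) x : (0 <= q)%R -> (0 <= exponential_pdf q x)%R.
  by move=> q0; exact: exponential_pdf_ge0.
rewrite (@ge0_integral_density _ _ _ lebesgue_measure nu
  (exponential_pdf 1) (pdf0 1%R ^~ ler01) (mpdf 1%R) nuE
  (fun s => (f s)%:E)) //; last exact/measurable_EFinP.
apply: (@le_trans _ _ (\int[lebesgue_measure]_x
    ((c / r)%:E * (exponential_pdf r x)%:E))).
  apply: le_lower_integral => x; rewrite -EFinM lee_fin.
    by rewrite mulr_ge0 ?divr_ge0 ?(ltW r0)// pdf0 ?(ltW r0).
  have [x0|x0] := ltP x 0%R; first by rewrite !lt0_exponential_pdf// !mulr0.
  rewrite !exponential_pdfE// mul1r mulN1r mulrA divfK ?gt_eqF//.
  exact: fle.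
have cr0 : (0 <= c / r)%R by rewrite divr_ge0// ltW.
rewrite ge0_integralZl_EFin//; last 2 first.
- by move=> x _; rewrite lee_fin pdf0 ?(ltW r0).
- by apply/measurable_EFinP; exact: measurable_exponential_pdf.
by rewrite integral_exponential_pdf// mule1.
Qed.

Lemma uniform_probE (B : set R) : measurable B ->
  uniform_prob (@ltr01 R) B = lebesgue_measure (B `&` `[0%R, 1%R]).
Proof.
move=> mB; rewrite /uniform_prob integral_uniform_pdf.
rewrite (eq_integral (cst 1)); last first.
  move=> x; rewrite inE/= => -[_]; rewrite in_itv/= => x01.
  by rewrite /uniform_pdf x01 subr0 invr1.
by rewrite integral_cst ?mul1e//; exact: measurableI.
Qed.

Lemma uniform_prob_le (t : R) : (0 <= t <= 1)%R ->
  uniform_prob (@ltr01 R) `]-oo, t] <= t%:E.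
Proof.
move=> /andP[t0 t1]; rewrite uniform_probE//.
apply: (@le_trans _ _ (lebesgue_measure `[0%R, t])).
  apply: le_measure; rewrite ?inE//; first exact: measurableI.
  by move=> x /=; rewrite !in_itv/= => -[-> /andP[-> _]].
rewrite lebesgue_measure_itv/= lte_fin; case: ifPn => //.
by rewrite sube0.
Qed.

(** The product form says that knowing U > t cannot make U <= u more likely. A rejected batch, whose
    U exceeds its threshold, therefore adds at most u to the mean rank of an accepted batch with U =
    u. *)
Lemma uniform_prob_oc (t u : R) : (0 <= t <= 1)%R ->
  uniform_prob (@ltr01 R) `]t, u] <= ((1 - t) * Num.max u 0)%:E.
Proof.
move=> /andP[t0 t1]; rewrite uniform_probE//.
apply: (@le_trans _ _ (lebesgue_measure `]t, Num.min u 1%R])).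
  apply: le_measure; rewrite ?inE//; first exact: measurableI.
  by move=> x /=; rewrite !in_itv/= le_min => -[/andP[-> ->] /andP[_ ->]].
rewrite lebesgue_measure_itv/= lte_fin.
case: ifPn => [tu|_]; last first.
  by rewrite lee_fin mulr_ge0 ?subr_ge0// le_max lexx orbT.
rewrite -EFinB lee_fin; move: tu; rewrite lt_min => /andP[tu t1'].
have u0 : (0 <= u)%R by rewrite (le_trans t0)// ltW.
rewrite (max_idPl u0); case: (leP u 1%R) => u1; nra.
Qed.

Lemma uniform_prob_gt (t : R) : (0 <= t <= 1)%R ->
  uniform_prob (@ltr01 R) `]t, +oo[ <= (1 - t)%:E.
Proof.
move=> t01; rewrite uniform_probE//.
have /andP[t0 t1] := t01.
apply: (@le_trans _ _ (lebesgue_measure `]t, 1%R])).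
  apply: le_measure; rewrite ?inE//; first exact: measurableI.
  by move=> x /=; rewrite !in_itv/= => -[/andP[-> _] /andP[_ ->]].
rewrite lebesgue_measure_itv/= lte_fin; case: ifPn => //.
by rewrite lee_fin subr_ge0.
Qed.

End exponential_uniform.

(** * Measurability and integrals of real functions *)

Section measurability.
Context d (T : measurableType d) (R : realType).

Lemma measurable_bool_natr (b : T -> bool) : measurable_fun setT b ->
  measurable_fun setT (fun x => (b x)%:R : R).
Proof.
move=> mb.
rewrite (_ : (fun x => (b x)%:R) = (fun x => if b x then 1 else 0 : R)).
  exact: measurable_fun_ifT.
by apply/funext => x; case: (b x).
Qed.

Lemma measurable_fun_forall (I : finType) (b : I -> T -> bool) :
  (forall i, measurable_fun setT (b i)) ->
  measurable_fun setT (fun x => [forall i, b i x]).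
Proof.
move=> mb; apply: (measurable_fun_bool true); rewrite setTI.
rewrite (_ : _ @^-1` _ = \bigcap_(i in [set: I]) (b i @^-1` [set true])).
  apply: fin_bigcap_measurable => [|i _]; first exact: finite_finset.
  by rewrite -[_ @^-1` _]setTI; exact: mb.
apply/seteqP; split => x /=; first by move=> /forallP bx i _; exact: bx.
by move=> bx; apply/forallP => i; exact: bx.
Qed.

Lemma measurable_fun_inv (f : T -> R) : measurable_fun setT f ->
  measurable_fun setT (fun x => (f x)^-1).
Proof.
move=> mf.
(* The power -1 is the inverse on nonnegative reals only, hence the square; both sides are 0 where f
   vanishes. *)
rewrite (_ : (fun x => _) = (fun x => f x * ((f x ^+ 2) `^ (-1)))).
  apply: measurable_funM => //.
  exact: (measurableT_comp (measurable_powR (-1)) (measurable_funX 2 mf)).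
apply/funext => x; rewrite powR_inv1 ?sqr_ge0//.
have [->|fx] := eqVneq (f x) 0; first by rewrite invr0 mul0r.
by rewrite expr2 invfM mulrA mulfV// mul1r.
Qed.

Lemma measurable_fun_div (f g : T -> R) : measurable_fun setT f ->
  measurable_fun setT g -> measurable_fun setT (fun x => f x / g x).
Proof. by move=> mf /measurable_fun_inv mg; exact: measurable_funM. Qed.

Lemma measurable_sum_cond (I : eqType) (s : seq I) (p : pred I) (f : I -> T -> R) :
  (forall i, measurable_fun setT (f i)) ->
  measurable_fun setT (fun x => \sum_(i <- s | p i) f i x).
Proof.
move=> mf; under eq_fun do rewrite big_mkcond/=.
by apply: measurable_sum => i; case: (p i).
Qed.

Lemma integral_bool (mu : {measure set T -> \bar R}) (b : T -> bool) :
  measurable_fun setT b ->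
  (\int[mu]_x (b x)%:R%:E = mu [set x | b x])%E.
Proof.
move=> mb.
have mB : measurable [set x | b x].
  by rewrite -[X in measurable X]setTI; exact: (mb measurableT [set true]).
transitivity (\int[mu]_x (\1_[set x | b x] x)%:E)%E; last first.
  by rewrite integral_indic// setIT.
apply: eq_integral => x _.
rewrite indicE; congr ((nat_of_bool _)%:R%:E).
by apply/idP/idP => [bx|/set_mem//]; exact: mem_set.
Qed.

End measurability.

Section real_integrals.
Local Open Scope ereal_scope.
Context d (T : measurableType d) (R : realType) (mu : {measure set T -> \bar R}).

Lemma ge0_integralD_EFin (f g : T -> R) :
  (forall x, 0 <= f x)%R -> measurable_fun setT f ->
  (forall x, 0 <= g x)%R -> measurable_fun setT g ->
  \int[mu]_x (f x + g x)%:E = \int[mu]_x (f x)%:E + \int[mu]_x (g x)%:E.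
Proof.
move=> f0 mf g0 mg; under eq_integral do rewrite EFinD.
rewrite ge0_integralD//; first by move=> x _; rewrite lee_fin.
- exact/measurable_EFinP.
- by move=> x _; rewrite lee_fin.
- exact/measurable_EFinP.
Qed.

Lemma ge0_integralM_EFin (c : R) (f : T -> R) : (0 <= c)%R ->
  (forall x, 0 <= f x)%R -> measurable_fun setT f ->
  \int[mu]_x (c * f x)%:E = c%:E * \int[mu]_x (f x)%:E.
Proof.
move=> c0 f0 mf; under eq_integral do rewrite EFinM.
rewrite ge0_integralZl_EFin//; first by move=> x _; rewrite lee_fin.
exact/measurable_EFinP.
Qed.

Lemma ge0_integral_sum_EFin (I : eqType) (s : seq I) (p : pred I) (f : I -> T -> R) :
  (forall i x, 0 <= f i x)%R -> (forall i, measurable_fun setT (f i)) ->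
  \int[mu]_x (\sum_(i <- s | p i) f i x)%:E =
  \sum_(i <- s | p i) \int[mu]_x (f i x)%:E.
Proof.
move=> f0 mf; under eq_integral do rewrite -sumEFin.
rewrite -big_filter; under eq_integral do rewrite -big_filter.
rewrite ge0_integral_sum//.
- by move=> i; exact/measurable_EFinP.
- by move=> i x _; rewrite lee_fin.
Qed.

End real_integrals.

Lemma lee_prod_nneg (R : realType) (I : Type) (s : seq I) (p : pred I)
    (f g : I -> \bar R) :
  (forall i, p i -> 0 <= f i)%E -> (forall i, p i -> f i <= g i)%E ->
  (\prod_(i <- s | p i) f i <= \prod_(i <- s | p i) g i)%E.
Proof.
move=> f0 fg; suff [] : (0 <= \prod_(i <- s | p i) f i)%E /\
  (\prod_(i <- s | p i) f i <= \prod_(i <- s | p i) g i)%E by [].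
elim/big_ind2 : _ => [|a b c e [a0 ab] [c0 ce]|i pi]; first by rewrite lexx lee01.
- by rewrite mule_ge0// lee_pmul.
- by rewrite f0// fg.
Qed.

(** * The independent variables of the common randomness *)

Section randomness.
Context d d' (T : measurableType d) (TY : measurableType d') (R : realType).
Variables (P : probability T R) (Q : probability TY R) (N : nat).
Variable W : common_randomness P Q N.

Let idx : choiceType := ((nat * 'I_N) + (nat * 'I_N) + nat)%type.
Definition Fsys : idx -> set_system T := rv_systems (cY W) (cS W) (cU W).
Definition iY i j : idx := inl (inl (i, j)).
Definition iS i j : idx := inl (inr (i, j)).
Definition iU i : idx := inr i.

Lemma Fsys_measurable k A : Fsys k A -> measurable A.
Proof.
by case: k => [[[i j]|[i j]]|i] [B mB <-]; rewrite setTI;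
  exact: measurable_funPTI.
Qed.

Lemma FsysI k : setI_closed (Fsys k).
Proof.
case: k => [[[i j]|[i j]]|i] _ _ [A mA <-] [B mB <-];
  by exists (A `&` B); [exact: measurableI|rewrite !setTI preimage_setI].
Qed.

Lemma FsysT k : Fsys k setT.
Proof.
by case: k => [[[i j]|[i j]]|i]; exists setT; rewrite ?setTI ?preimage_setT.
Qed.

Notation space J := (sub_space Fsys J).

Lemma space_measurable_fun (J : set idx) d1 (E : measurableType d1) (f : T -> E) :
  measurable_fun setT (f : space J -> E) -> measurable_fun setT f.
Proof.
move=> mf _ B mB; have := mf measurableT B mB.
exact: (sigma_of_measurable Fsys_measurable).
Qed.

Lemma measurable_Y (J : set idx) i j : J (iY i j) ->
  measurable_fun setT (cY W i j : space J -> TY).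
Proof.
move=> Jij _ B mB; apply: sub_sigma_algebra; exists (iY i j) => //.
by exists B.
Qed.

Lemma measurable_S (J : set idx) i j : J (iS i j) ->
  measurable_fun setT (cS W i j : space J -> R).
Proof.
move=> Jij _ B mB; apply: sub_sigma_algebra; exists (iS i j) => //.
by exists B.
Qed.

Lemma measurable_U (J : set idx) i : J (iU i) ->
  measurable_fun setT (cU W i : space J -> R).
Proof.
move=> Ji _ B mB; apply: sub_sigma_algebra; exists (iU i) => //.
by exists B.
Qed.

(** Whole batches are elements of a product space, so that one can be frozen at once. *)
Definition Yt i (w : T) : N.-tuple TY := [tuple cY W i j w | j < N].
Definition St i (w : T) : N.-tuple R := [tuple cS W i j w | j < N].

Lemma measurable_Yt (J : set idx) i : (forall j, J (iY i j)) ->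
  measurable_fun setT (Yt i : space J -> N.-tuple TY).
Proof.
move=> Ji; apply/measurable_fun_tnthP => j.
rewrite (_ : _ \o _ = cY W i j); first exact: measurable_Y.
by apply/funext => w /=; rewrite tnth_mktuple.
Qed.

Lemma measurable_St (J : set idx) i : (forall j, J (iS i j)) ->
  measurable_fun setT (St i : space J -> N.-tuple R).
Proof.
move=> Ji; apply/measurable_fun_tnthP => j.
rewrite (_ : _ \o _ = cS W i j); first exact: measurable_S.
by apply/funext => w /=; rewrite tnth_mktuple.
Qed.

(* Independence of disjoint groups of variables: the occurrences of the first group can be
   frozen while the second group is integrated out. *)
Lemma freeze (J1 J2 : set idx) (f : T -> T -> \bar R) :
  J1 `&` J2 = set0 -> (forall w v, (0 <= f w v)%E) ->
  measurable_fun setT (fun z : space J1 * space J2 => f z.1 z.2) ->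
  (\int[P]_w f w w = \int[P]_w \int[P]_v f w v)%E.
Proof.
exact: (ge0_integral_freeze Fsys_measurable FsysI FsysT (@c_indep _ _ _ _ _ _ _ _ W)).
Qed.

Lemma prob_S_family i (k : 'I_N) (A : 'I_N -> set R) :
  (forall j, measurable (A j)) ->
  P [set v | forall j, j != k -> A j (cS W i j v)] =
  (\prod_(j < N | j != k) P (cS W i j @^-1` A j))%E.
Proof.
move=> mA.
pose s := [seq iS i j | j <- enum (predC1 k)].
pose B (x : idx) : set T :=
  if x is inl (inr ij) then cS W i ij.2 @^-1` A ij.2 else setT.
have us : uniq s by rewrite map_inj_uniq ?enum_uniq// => a b [].
have := @c_indep _ _ _ _ _ _ _ _ W s B us.
rewrite -/Fsys => /(_ _)/wrap[].
  move=> _ /mapP[j _ ->]; exists (A j) => //; exact: setTI.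
rewrite big_map big_enum/= => <-; congr (P _).
apply/seteqP; split => v /=.
  by move=> H _ /mapP[j jk ->]/=; apply: H; rewrite mem_enum in jk.
move=> H j jk; apply: (H (iS i j)) => /=.
by rewrite mem_map ?mem_enum// => a b [].
Qed.

End randomness.

(** * Exponential races *)

Section races.
Context d d' (T : measurableType d) (TY : measurableType d') (R : realType).
Variables (P : probability T R) (Q : probability TY R) (N : nat).
Variable W : common_randomness P Q N.

Notation space J := (sub_space (Fsys W) J).

Lemma prob_S_le1 i j (c : R -> R -> bool) (s : R) :
  measurable_fun setT (fun z : R * R => c z.1 z.2) ->
  (P [set v | c s (cS W i j v)] <= 1)%E.
Proof.
move=> mc; apply: probability_le1.
have mS : measurable_fun setT (cS W i j).
  by move=> _ B mB; rewrite setTI; exact: (@measurable_funPTI _ _ _ _ (cS W i j)).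
have mt : measurable_fun setT (fun t : R => c s t).
  exact: (measurableT_comp mc (measurable_pair1 s)).
rewrite -[X in measurable X]setTI.
have mtS := measurableT_comp mt mS; exact: (mtS measurableT [set true]).
Qed.

(** Once S_k = s is frozen, the conditions on the other S_j are independent, and the probability
    becomes the mean of a product of one-variable probabilities. *)
Lemma prob_S_frozen i (k : 'I_N) (c : 'I_N -> R -> R -> bool) (h : R -> R) :
  (forall j, measurable_fun setT (fun z : R * R => c j z.1 z.2)) ->
  (forall s, (\prod_(j < N | j != k) P [set v | c j s (cS W i j v)] <= (h s)%:E)%E) ->
  (P [set v | [forall j, (j != k) ==> c j (cS W i k v) (cS W i j v)]] <=
   \int[P]_w (h (cS W i k w))%:E)%E.
Proof.
move=> mc ch.
have h0 s : 0 <= h s.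
  by rewrite -lee_fin (le_trans _ (ch s))// prode_ge0.
pose b w v := [forall j, (j != k) ==> c j (cS W i k w) (cS W i j v)].
pose J1 := [set iS i k] : set ((nat * 'I_N) + (nat * 'I_N) + nat)%type.
pose J2 := [set iS i j | j in [set j | j != k]] : set ((nat * 'I_N) + (nat * 'I_N) + nat)%type.
have mb J J' : J (iS i k) -> (forall j, j != k -> J' (iS i j)) ->
    measurable_fun setT (fun z : space J * space J' => b z.1 z.2).
  move=> Jk J'j; apply: measurable_fun_forall => j.
  have [->|jk] := eqVneq j k; first exact: measurable_cst.
  have mk : measurable_fun setT (fun z : space J * space J' => cS W i k z.1).
    exact: (measurableT_comp (measurable_S (W:=W) Jk) measurable_fst).
  have mj : measurable_fun setT (fun z : space J * space J' => cS W i j z.2).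
    exact: (measurableT_comp (measurable_S (W:=W) (J'j _ jk)) measurable_snd).
  exact: (measurableT_comp (mc j) (measurable_fun_pair mk mj)).
have mSk w : measurable_fun setT (b w).
  apply: (@space_measurable_fun _ _ _ _ _ _ _ _ W setT).
  have mw : measurable_fun setT (fun v : space setT => (w : space setT, v)).
    exact: measurable_pair1.
  exact: (measurableT_comp (mb setT setT I (fun _ _ => I)) mw).
have mdiag : measurable_fun setT (fun v => b v v).
  apply: (@space_measurable_fun _ _ _ _ _ _ _ _ W setT).
  have mw : measurable_fun setT (fun v : space setT => (v : space setT, v)).
    exact: measurable_fun_pair.
  exact: (measurableT_comp (mb setT setT I (fun _ _ => I)) mw).
rewrite -[X in (X <= _)%E](integral_bool P mdiag).
rewrite (@freeze _ _ _ _ _ _ _ _ W J1 J2 (fun w v => (b w v)%:R%:E)); last 3 first.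
- apply/seteqP; split => // x [] /= -> [j jk []]; exact/eqP.
- by move=> w v; rewrite lee_fin ler0n.
- apply/measurable_EFinP/measurable_bool_natr; apply: (mb J1 J2) => // j jk.
  by exists j.
apply: le_lower_integral => w; first by rewrite lee_fin.
rewrite integral_bool//; apply: le_trans (ch (cS W i k w)).
have -> : [set v | b w v] = [set v | forall j, j != k ->
    c j (cS W i k w) (cS W i j v)].
  apply/seteqP; split => v /=.
    by move=> /forallP bv j jk; have := bv j; rewrite jk.
  by move=> H; apply/forallP => j; apply/implyP => jk; exact: H.
suff mA j : measurable [set t | c j (cS W i k w) t].
  by have /= -> := prob_S_family W i k mA.
have mj : measurable_fun setT (fun t : R => c j (cS W i k w) t).
  exact: (measurableT_comp (mc j) (measurable_pair1 (cS W i k w))).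
by rewrite -[X in measurable X]setTI; exact: (mj measurableT [set true]).
Qed.

Lemma cS_tail i j (c : R) : 0 <= c ->
  (P [set v | (c <= cS W i j v)%R] <= (expR (- c))%:E)%E.
Proof.
move=> c0.
rewrite (_ : [set _ | _] = cS W i j @^-1` `[c, +oo[%classic); last first.
  by apply/seteqP; split => v; rewrite /= in_itv/= andbT.
apply: (@exponential_prob_tail R (distribution P (cS W i j)) c) => // B mB.
exact: cS_law.
Qed.

Lemma cS_itv i j (a b : R) : 0 <= a ->
  (P [set v | a <= cS W i j v <= b]%R <= (Num.max 0 (b - a) * expR (- a))%:E)%E.
Proof.
move=> a0; have [ab|ba] := leP a b.
  rewrite (max_idPr _) ?subr_ge0//.
  rewrite (_ : [set _ | _] = cS W i j @^-1` `[a, b]%classic); last first.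
    by apply/seteqP; split => v; rewrite /= in_itv.
  rewrite -[P _]/(distribution P (cS W i j) `[a, b]%classic) cS_law//.
  exact: exponential_prob_itvcc.
rewrite (_ : [set _ | _] = set0) ?measure0 ?lee_fin ?mulr_ge0 ?expR_ge0 ?le_max ?lexx//.
apply/seteqP; split => // v /= /andP[av vb].
by have := le_trans av vb; rewrite leNgt ba.
Qed.

Lemma integral_cS i j (f : R -> R) (c r : R) :
  0 < r -> 0 <= c -> (forall s, 0 <= f s) -> measurable_fun setT f ->
  (forall s, 0 <= s -> f s * expR (- s) <= c * expR (- r * s)) ->
  (\int[P]_w (f (cS W i j w))%:E <= (c / r)%:E)%E.
Proof.
move=> r0 c0 f0 mf fle.
have mS : measurable_fun setT (cS W i j : T -> measurableTypeR R).
  by move=> _ B mB; rewrite setTI; exact: (@measurable_funPTI _ _ _ _ (cS W i j)).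
pose S : {mfun T >-> measurableTypeR R} :=
  HB.pack (cS W i j : T -> measurableTypeR R) (isMeasurableFun.Build _ _ _ _ _ mS).
have -> : (\int[P]_w (f (cS W i j w))%:E = \int[distribution P S]_s (f s)%:E)%E.
  by rewrite ge0_integral_distribution//; exact/measurable_EFinP.
apply: exponential_integral => // B mB.
exact: (@cS_law _ _ _ _ _ _ _ _ W i j).
Qed.

(** The comparison s_k / l_k <= s_j / l_j cleared of denominators, so that a vanishing l_j needs no
    separate case. *)
Definition race (k : 'I_N) (l s : 'I_N -> R) :=
  [forall j, s k * l j <= s j * l k].

Lemma race_denominator (k : 'I_N) (l : 'I_N -> R) : 0 < l k ->
  l k / \sum_j l j = (1 + \sum_(j < N | j != k) l j / l k)^-1.
Proof.
move=> lk0; have -> : \sum_j l j = l k * (1 + \sum_(j < N | j != k) l j / l k).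
  rewrite mulrDr mulr1 mulr_sumr (bigD1 k)//=; congr +%R.
  by apply: eq_bigr => j _; rewrite mulrC divfK ?gt_eqF.
by rewrite invfM mulrA mulfV ?gt_eqF// mul1r.
Qed.

(** Given S_k = s, the other candidates lose independently, j with probability at most exp (- s l_j
    / l_k). The product is exp (- A s), whose mean under Exp(1) is 1 / (1 + A). *)
Lemma race_prob i (k : 'I_N) (l : 'I_N -> R) : (forall j, 0 <= l j) -> 0 < l k ->
  (P [set v | race k l (fun j => cS W i j v)] <= (l k / \sum_j l j)%:E)%E.
Proof.
move=> l0 lk0.
pose A := \sum_(j < N | j != k) l j / l k.
have A0 : 0 <= A by apply: sumr_ge0 => j _; rewrite divr_ge0// ltW.
have lA : l k / \sum_j l j = 1 / (1 + A) by rewrite race_denominator// div1r.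
pose c (j : 'I_N) (s t : R) := s * l j <= t * l k.
have mc j : measurable_fun setT (fun z : R * R => c j z.1 z.2).
  by apply: measurable_fun_ler; apply: measurable_funM.
(* Negative s has probability 0 but is not excluded: the trivial bound 1 serves there. *)
pose h s := if 0 <= s then expR (- A * s) else 1.
have := @prob_S_frozen i k c h mc; rewrite lA.
have -> : [set v | [forall j, (j != k) ==> c j (cS W i k v) (cS W i j v)]] =
    [set v | race k l (fun j => cS W i j v)].
  apply/seteqP; split => v /= /forallP H; apply/forallP => j.
    by have := H j; have [->|jk] := eqVneq j k.
  by apply/implyP => _; exact: H.
move=> H; apply: le_trans (H _) _.
  move=> s; rewrite /h; case: ifPn => [s0|_]; last first.
    apply: (@le_trans _ _ (\prod_(j < N | j != k) 1)%E); last by rewrite big1.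
    by apply: lee_prod_nneg => // j _; exact: prob_S_le1.
  have -> : expR (- A * s) = \prod_(j < N | j != k) expR (- (s * (l j / l k))).
    by rewrite -expR_sum /A mulNr mulr_suml sumrN; congr (expR (- _));
      apply: eq_bigr => j _; rewrite mulrC.
  rewrite -prodEFin//; apply: lee_prod_nneg => // j jk.
  rewrite (_ : [set v | _] = [set v | s * (l j / l k) <= cS W i j v]).
    by apply: cS_tail; rewrite mulr_ge0// divr_ge0// ltW.
  by apply/seteqP; split => v /=; rewrite /c mulrA ler_pdivrMr.
apply: integral_cS => //.
- by rewrite ltr_pwDl.
- by move=> s; rewrite /h; case: ifP => // _; rewrite expR_ge0.
- apply: measurable_fun_ifT => //.
    exact: measurable_fun_ler.
  apply: (measurableT_comp (@measurable_expR R)); exact: measurable_funM.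
- move=> s s0; rewrite /h s0 -expRD mul1r ler_expR.
  by rewrite le_eqVlt; apply/orP; left; apply/eqP; ring.
Qed.

(** Given S_k = s, the extra condition confines S_j0 between s l_j0 / l_k and s, which costs a
    further factor s. The exact integral of s exp (- (1 + A) s) is 1 / (1 + A)^2; the 2 is the price
    of replacing s by an exponential. *)
Lemma race2_prob i (k j0 : 'I_N) (l : 'I_N -> R) : (forall j, 0 <= l j) ->
  0 < l k -> j0 != k ->
  (P [set v | race k l (fun j => cS W i j v) && (cS W i j0 v <= cS W i k v)%R]
   <= (2 * (l k / \sum_j l j) ^+ 2)%:E)%E.
Proof.
move=> l0 lk0 j0k.
pose A := \sum_(j < N | j != k) l j / l k.
have A0 : 0 <= A by apply: sumr_ge0 => j _; rewrite divr_ge0// ltW.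
have A1 : 0 < 1 + A by rewrite ltr_pwDl.
have -> : 2 * (l k / \sum_j l j) ^+ 2 = (1 + A)^-1 / ((1 + A) / 2).
  by rewrite race_denominator// -/A; field; rewrite gt_eqF.
pose c (j : 'I_N) (s t : R) := (s * l j <= t * l k) && ((j == j0) ==> (t <= s)).
have mc j : measurable_fun setT (fun z : R * R => c j z.1 z.2).
  apply: measurable_and.
    by apply: measurable_fun_ler; apply: measurable_funM.
  rewrite /=; case: (j == j0) => //=.
  exact: measurable_fun_ler.
pose h s := if 0 <= s then s * expR (- A * s) else 1.
have := @prob_S_frozen i k c h mc.
have -> : [set v | [forall j, (j != k) ==> c j (cS W i k v) (cS W i j v)]] =
    [set v | race k l (fun j => cS W i j v) && (cS W i j0 v <= cS W i k v)].
  apply/seteqP; split => v /=.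
    move=> /forallP H; apply/andP; split.
      apply/forallP => j; have := H j.
      by have [->//|jk] := eqVneq j k; move=> /andP[].
    by have := H j0; rewrite j0k /c eqxx => /andP[].
  move=> /andP[/forallP H H0]; apply/forallP => j; apply/implyP => _.
  by rewrite /c H/=; apply/implyP => /eqP ->.
move=> H; apply: le_trans (H _) _.
  move=> s; rewrite /h; case: ifPn => [s0|_]; last first.
    apply: (@le_trans _ _ (\prod_(j < N | j != k) 1)%E); last by rewrite big1.
    by apply: lee_prod_nneg => // j _; exact: prob_S_le1.
  have a0 j : 0 <= s * (l j / l k) by rewrite mulr_ge0// divr_ge0// ltW.
  have -> : s * expR (- A * s) = \prod_(j < N | j != k)
      ((if j == j0 then s else 1) * expR (- (s * (l j / l k)))).
    rewrite big_split/= -expR_sum; congr (_ * expR _).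
      rewrite (bigD1 j0)//= eqxx big1 ?mulr1// => j /andP[_ /negbTE ->//].
    rewrite /A mulNr mulr_suml -sumrN; apply: eq_bigr => j _.
    by rewrite mulrC.
  rewrite -prodEFin//; apply: lee_prod_nneg => // j jk.
  have cE t : (s * l j <= t * l k) = (s * (l j / l k) <= t).
    by rewrite mulrA ler_pdivrMr.
  have [jj0|jj0] := eqVneq j j0; last first.
    rewrite (_ : [set v | _] = [set v | s * (l j / l k) <= cS W i j v]).
      by rewrite mul1r; exact: cS_tail.
    by apply/seteqP; split => v /=; rewrite /c (negbTE jj0) andbT cE.
  rewrite (_ : [set v | _] = [set v | s * (l j / l k) <= cS W i j v <= s]).
    apply: le_trans (cS_itv _ _ _ (a0 j)) _.
    rewrite lee_fin ler_wpM2r ?expR_ge0// ge_max s0/=.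
    by rewrite lerBlDr lerDl.
  by apply/seteqP; split => v /=; rewrite /c jj0 eqxx/= -jj0 cE.
apply: integral_cS => //.
- by rewrite divr_gt0.
- by rewrite invr_ge0 ltW.
- by move=> s; rewrite /h; case: ifP => // s0; rewrite mulr_ge0// expR_ge0.
- apply: measurable_fun_ifT => //; first exact: measurable_fun_ler.
  apply: measurable_funM => //.
  apply: (measurableT_comp (@measurable_expR R)); exact: measurable_funM.
- move=> s s0; rewrite /h s0 -mulrA -expRD.
  pose y := (1 + A) / 2 * s.
  have y0 : 0 <= y by rewrite mulr_ge0// divr_ge0// ltW.
  (* Half of the exponential decay pays for the factor s: 2 y <= (1 + y / 2)^2 <= exp y. *)
  have key : (1 + A) * s <= expR y.
    have -> : (1 + A) * s = 2 * y by rewrite /y; field.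
    have -> : expR y = expR (y / 2) * expR (y / 2).
      by rewrite -expRD; congr expR; field.
    have e1 := expR_ge1Dx (y / 2).
    have : (1 + y / 2) * (1 + y / 2) <= expR (y / 2) * expR (y / 2).
      by apply: ler_pM => //; rewrite addr_ge0// divr_ge0.
    apply: le_trans; have := sqr_ge0 (1 - y / 2); rewrite expr2; lra.
  have -> : - A * s - s = (- y) + (- y) by rewrite /y; field.
  have -> : - ((1 + A) / 2) * s = y + (- y + - y) by rewrite /y; field.
  by rewrite [expR (y + _)]expRD mulrA ler_wpM2r ?expR_ge0// ler_pdivlMl.
Qed.

End races.

(** * Integrating out the S or the U of a batch with the rest frozen *)

Section batch_integrals.
Context d d' (T : measurableType d) (TY : measurableType d') (R : realType).
Variables (P : probability T R) (Q : probability TY R) (N : nat).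
Variable W : common_randomness P Q N.

Notation space J := (sub_space (Fsys W) J).
Notation index := ((nat * 'I_N) + (nat * 'I_N) + nat)%type.

Lemma freeze_rv (J1 J2 : set index) d1 d2 (E1 : measurableType d1)
    (E2 : measurableType d2) (A : T -> E1) (B : T -> E2) (g : E1 -> E2 -> \bar R) :
  J1 `&` J2 = set0 ->
  measurable_fun setT (A : space J1 -> E1) ->
  measurable_fun setT (B : space J2 -> E2) ->
  (forall a b, (0 <= g a b)%E) ->
  measurable_fun setT (fun z : E1 * E2 => g z.1 z.2) ->
  (\int[P]_w g (A w) (B w) = \int[P]_w \int[P]_v g (A w) (B v))%E.
Proof.
move=> J12 mA mB g0 mg.
apply: (@freeze _ _ _ _ _ _ _ _ W J1 J2 (fun w v => g (A w) (B v))) => //.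
have m1 : measurable_fun setT (fun z : space J1 * space J2 => A z.1).
  exact: (measurableT_comp mA measurable_fst).
have m2 : measurable_fun setT (fun z : space J1 * space J2 => B z.2).
  exact: (measurableT_comp mB measurable_snd).
exact: (measurableT_comp mg (measurable_fun_pair m1 m2)).
Qed.

Lemma freeze_rv_le (J1 J2 : set index) d1 d2 (E1 : measurableType d1)
    (E2 : measurableType d2) (A : T -> E1) (B : T -> E2) (g : E1 -> E2 -> R)
    (p : E1 -> R) :
  J1 `&` J2 = set0 ->
  measurable_fun setT (A : space J1 -> E1) ->
  measurable_fun setT (B : space J2 -> E2) ->
  (forall a b, 0 <= g a b) ->
  measurable_fun setT (fun z : E1 * E2 => g z.1 z.2) ->
  (forall a, \int[P]_v (g a (B v))%:E <= (p a)%:E)%E ->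
  (\int[P]_w (g (A w) (B w))%:E <= \int[P]_w (p (A w))%:E)%E.
Proof.
move=> J12 mA mB g0 mg gp.
rewrite (@freeze_rv J1 J2 _ _ _ _ A B (fun a b => (g a b)%:E))//; last exact/measurable_EFinP.
apply: le_lower_integral => w; last exact: gp.
by rewrite (le_trans _ (gp _))// integral_ge0// => v _; rewrite lee_fin.
Qed.

Definition idxY i : set index := [set iY i j | j in setT].
Definition idxS i : set index := [set iS i j | j in setT].
Definition idxYU i : set index := idxY i `|` [set iU N i].

Lemma measurable_YtT i : measurable_fun setT (Yt W i).
Proof.
by apply: (@space_measurable_fun _ _ _ _ _ _ _ _ W setT); exact: measurable_Yt.
Qed.

Lemma measurable_StT i : measurable_fun setT (St W i).
Proof.
by apply: (@space_measurable_fun _ _ _ _ _ _ _ _ W setT); exact: measurable_St.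
Qed.

Lemma measurable_UT i : measurable_fun setT (cU W i).
Proof.
by apply: (@space_measurable_fun _ _ _ _ _ _ _ _ W setT); exact: measurable_U.
Qed.

Lemma integral_U i (a : N.-tuple TY -> R) (b : N.-tuple TY -> R -> bool)
    (p : N.-tuple TY -> R) :
  (forall y, 0 <= a y) -> measurable_fun setT a ->
  measurable_fun setT (fun z : N.-tuple TY * R => b z.1 z.2) ->
  (forall y, P [set v | b y (cU W i v)] <= (p y)%:E)%E ->
  (\int[P]_w (a (Yt W i w) * (b (Yt W i w) (cU W i w))%:R)%:E <=
   \int[P]_w (a (Yt W i w) * p (Yt W i w))%:E)%E.
Proof.
move=> a0 ma mb bp.
apply: (@freeze_rv_le (idxY i) [set iU N i] _ _ _ _ (Yt W i) (cU W i)
  (fun y u => a y * (b y u)%:R) (fun y => a y * p y)).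
- by apply/seteqP; split => // x [] [j _ <-].
- by apply: measurable_Yt => j; exists j.
- exact: measurable_U.
- by move=> y u; rewrite mulr_ge0.
- apply: measurable_funM; first exact: (measurableT_comp ma measurable_fst).
  exact: measurable_bool_natr.
- move=> y; have mby : measurable_fun setT (fun v => b y (cU W i v)).
    exact: (measurableT_comp mb (measurableT_comp (measurable_pair1 y) (measurable_UT i))).
  under eq_integral do rewrite EFinM.
  rewrite ge0_integralZl_EFin//; last 1 first.
    exact/measurable_EFinP/measurable_bool_natr.
  rewrite integral_bool// EFinM; apply: lee_wpmul2l; last exact: bp.
  by rewrite lee_fin.
Qed.

Section race.
Variables (r : TY -> R) (mr : measurable_fun setT r) (r0 : forall y, 0 <= r y).

Definition lam (y : N.-tuple TY) (j : 'I_N) := r (tnth y j).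
Definition Zsum (y : N.-tuple TY) := \sum_j lam y j.
(** For positive S, a candidate of ratio 0 can be the minimum only if all ratios vanish. That case
    is left out here and counted apart in [rejected]. *)
Definition wins (k : 'I_N) (y : N.-tuple TY) (s : N.-tuple R) :=
  (0 < lam y k) && race k (lam y) (tnth s).

Lemma lam_ge0 y j : 0 <= lam y j. Proof. exact: r0. Qed.

Lemma measurable_lam j : measurable_fun setT (lam ^~ j).
Proof. exact: (measurableT_comp mr (measurable_tnth j)). Qed.

Lemma measurable_Zsum : measurable_fun setT Zsum.
Proof. by apply: measurable_sum => j; exact: measurable_lam. Qed.

Lemma measurable_wins k :
  measurable_fun setT (fun z : N.-tuple TY * N.-tuple R => wins k z.1 z.2).
Proof.
have ml j : measurable_fun setT (fun z : N.-tuple TY * N.-tuple R => lam z.1 j).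
  exact: (measurableT_comp (measurable_lam j) measurable_fst).
have ms j : measurable_fun setT (fun z : N.-tuple TY * N.-tuple R => tnth z.2 j).
  exact: (measurableT_comp (measurable_tnth j) measurable_snd).
apply: measurable_and; first exact: measurable_fun_ltr.
apply: measurable_fun_forall => j.
by apply: measurable_fun_ler; exact: measurable_funM.
Qed.

(** S is integrated out while Y and U are frozen. The function c bounds the conditional probability
    in terms of the share t of candidate k: t by [race_prob], 2 t^2 by [race2_prob]. *)
Lemma integral_race i k (b : N.-tuple R -> bool) (c : R -> R)
    (phi : N.-tuple TY -> R -> R) :
  measurable_fun setT b ->
  (forall y, 0 < lam y k ->
    (P [set v | race k (lam y) (tnth (St W i v)) && b (St W i v)] <=
    (c (lam y k / Zsum y))%:E)%E) ->
  (forall t, 0 <= c t) ->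
  (forall y u, 0 <= phi y u) ->
  measurable_fun setT (fun z : N.-tuple TY * R => phi z.1 z.2) ->
  (\int[P]_w ((wins k (Yt W i w) (St W i w) && b (St W i w))%:R
              * phi (Yt W i w) (cU W i w))%:E <=
   \int[P]_w (c (lam (Yt W i w) k / Zsum (Yt W i w))
              * phi (Yt W i w) (cU W i w))%:E)%E.
Proof.
move=> mb bc c0 phi0 mphi.
apply: (@freeze_rv_le (idxYU i) (idxS i) _ _ _ _
  (fun w => (Yt W i w, cU W i w)) (St W i)
  (fun yu s => (wins k yu.1 s && b s)%:R * phi yu.1 yu.2)
  (fun yu => c (lam yu.1 k / Zsum yu.1) * phi yu.1 yu.2)).
- by apply/seteqP; split => // x [[[j _ <-]|->] [j' _ []]].
- apply: measurable_fun_pair.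
    by apply: measurable_Yt => j; left; exists j.
  by apply: measurable_U; right.
- by apply: measurable_St => j; exists j.
- by move=> yu s; rewrite mulr_ge0.
- apply: measurable_funM.
    apply: measurable_bool_natr; apply: measurable_and.
      exact: (measurableT_comp (measurable_wins k) (measurable_fun_pair
        (measurableT_comp measurable_fst measurable_fst) measurable_snd)).
    exact: (measurableT_comp mb measurable_snd).
  exact: (measurableT_comp mphi measurable_fst).
- move=> [y u]/=.
  have mwy : measurable_fun setT (fun v => wins k y (St W i v) && b (St W i v)).
    apply: measurable_and.
      exact: (measurableT_comp (measurable_wins k)
        (measurableT_comp (measurable_pair1 y) (measurable_StT i))).
    exact: (measurableT_comp mb (measurable_StT i)).
  under eq_integral do rewrite EFinM muleC.
  rewrite ge0_integralZl_EFin//; last 1 first.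
    exact/measurable_EFinP/measurable_bool_natr.
  rewrite integral_bool// mulrC EFinM; apply: lee_wpmul2l.
    by rewrite lee_fin.
  have [lk|lk] := boolP (0 < lam y k).
    rewrite (_ : [set _ | _] =
      [set v | race k (lam y) (tnth (St W i v)) && b (St W i v)]) ?bc//.
    by apply/seteqP; split => v /=; rewrite /wins lk.
  rewrite (_ : [set _ | _] = set0) ?measure0 ?lee_fin//.
  by apply/seteqP; split => // v /=; rewrite /wins (negbTE lk).
Qed.

End race.
End batch_integrals.

(** * Means over independent candidates *)

Section iid_sums.
Context d d' (T : measurableType d) (TY : measurableType d') (R : realType).
Variables (P : probability T R) (Q : probability TY R) (N : nat).
Variable W : common_randomness P Q N.
Variables (r : TY -> R) (mr : measurable_fun setT r) (r0 : forall y, 0 <= r y).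

Notation space J := (sub_space (Fsys W) J).
Notation index := ((nat * 'I_N) + (nat * 'I_N) + nat)%type.

Lemma integral_cY i j (f : TY -> \bar R) : (forall y, 0 <= f y)%E ->
  measurable_fun setT f -> (\int[P]_w f (cY W i j w) = \int[Q]_y f y)%E.
Proof.
move=> f0 mf; rewrite -(ge0_integral_distribution (cY W i j))//.
by apply: eq_measure_integral => A mA _; exact: cY_law.
Qed.

(* The mean of h (t + r y_1 + ... + r y_n) for y_1, ..., y_n i.i.d. of law Q. *)
Fixpoint iid_sum (n : nat) (h : R -> \bar R) (t : R) : \bar R :=
  if n is m.+1 then (\int[Q]_y iid_sum m h (t + r y))%E else h t.

Lemma iid_sum_ge0 n h t : (forall x, 0 <= h x)%E -> (0 <= iid_sum n h t)%E.
Proof. by move=> h0; elim: n t => //= n IH t; exact: integral_ge0. Qed.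

Lemma measurable_iid_sum n h : (forall x, 0 <= h x)%E ->
  measurable_fun setT h -> measurable_fun setT (iid_sum n h).
Proof.
move=> h0 mh; elim: n => //= n IH.
have mG : measurable_fun setT (fun z : R * TY => iid_sum n h (z.1 + r z.2)).
  apply: (measurableT_comp IH); apply: measurable_funD => //.
  exact: (measurableT_comp mr measurable_snd).
apply: (measurable_fun_fubini_tonelli_F
  (fun z : R * TY => iid_sum n h (z.1 + r z.2)) mG).
by move=> z; exact: iid_sum_ge0.
Qed.

Lemma measurable_sum_rY (J : set index) (s : seq (nat * 'I_N)) :
  (forall p, p \in s -> J (iY p.1 p.2)) ->
  measurable_fun setT ((fun w => \sum_(p <- s) r (cY W p.1 p.2 w)) : space J -> R).
Proof.
elim: s => [|p s IH] Js.
  rewrite (_ : (fun w => _) = cst 0); first exact: measurable_cst.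
  by apply/funext => w; rewrite big_nil.
rewrite (_ : (fun w => _) = (fun w => r (cY W p.1 p.2 w) +
  \sum_(q <- s) r (cY W q.1 q.2 w))); last first.
  by apply/funext => w; rewrite big_cons.
apply: measurable_funD.
  by apply: (measurableT_comp mr); apply: measurable_Y; apply: Js; rewrite mem_head.
by apply: IH => q qs; apply: Js; rewrite in_cons qs orbT.
Qed.

(** Such a mean depends only on how many distinct candidates enter. This makes all batches and all k
    interchangeable, and lets batch 0 in [Delta_of] stand for every batch. *)
Lemma integral_iid_sum (s : seq (nat * 'I_N)) (h : R -> \bar R) t :
  uniq s -> (forall x, 0 <= h x)%E -> measurable_fun setT h ->
  (\int[P]_w h (t + \sum_(p <- s) r (cY W p.1 p.2 w))%R = iid_sum (size s) h t)%E.
Proof.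
move=> us h0 mh; elim: s us t => [_ t|p s IH /= /andP[ps us] t].
  under eq_integral do rewrite big_nil addr0.
  by rewrite integral_cst//= probability_setT mule1.
pose J1 : set index := [set iY p.1 p.2].
pose J2 : set index := [set iY q.1 q.2 | q in [set` s]].
under eq_integral do rewrite big_cons.
rewrite (@freeze_rv _ _ _ _ _ _ _ _ W J1 J2 _ _ _ _ (cY W p.1 p.2)
  (fun w => \sum_(q <- s) r (cY W q.1 q.2 w))
  (fun y z => h (t + (r y + z)))); last 5 first.
- apply/seteqP; split => // x [-> [q /= qs]] [q1 q2].
  by move/negP: ps; apply; rewrite [p]surjective_pairing -q1 -q2 -surjective_pairing.
- exact: measurable_Y.
- by apply: measurable_sum_rY => q qs; exists q.
- by [].
- apply: (measurableT_comp mh); apply: measurable_funD => //.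
  apply: measurable_funD => //; exact: (measurableT_comp mr measurable_fst).
under eq_integral do under eq_integral do rewrite addrA.
under eq_integral do rewrite IH//.
rewrite (integral_cY p.1 p.2 (f := fun y => iid_sum (size s) h (t + r y)))//.
  by move=> y; exact: iid_sum_ge0.
apply: (measurableT_comp (measurable_iid_sum _ h0 mh)).
by apply: measurable_funD => //; exact: (measurableT_comp mr measurable_snd).
Qed.

(** The part of [Zbar] that varies: [Zbar] at k is [others k] plus the constant o, hence independent
    of candidate k. *)
Definition others (k : 'I_N) (y : N.-tuple TY) := \sum_(j < N | j != k) lam r y j.

Lemma others_ge0 k y : 0 <= others k y.
Proof. by apply: sumr_ge0 => j _; exact: lam_ge0. Qed.

Lemma measurable_others k : measurable_fun setT (others k).
Proof. by apply: measurable_sum_cond => j; exact: measurable_lam. Qed.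

Lemma Zsum_others k y : Zsum r y = lam r y k + others k y.
Proof. by rewrite /Zsum (bigD1 k). Qed.

Definition others_seq (i : nat) (k : 'I_N) : seq (nat * 'I_N) :=
  [seq (i, j) | j <- enum (predC1 k)].

Lemma othersE i k w :
  others k (Yt W i w) = \sum_(p <- others_seq i k) r (cY W p.1 p.2 w).
Proof.
rewrite /others big_map big_enum/=; apply: eq_bigr => j _.
by rewrite /lam tnth_mktuple.
Qed.

Lemma integral_others i k (h : R -> \bar R) :
  (forall x, 0 <= h x)%E -> measurable_fun setT h ->
  (\int[P]_w h (others k (Yt W i w)) = iid_sum N.-1 h 0)%E.
Proof.
move=> h0 mh; under eq_integral do rewrite othersE -[X in h X]add0r.
rewrite integral_iid_sum//; last first.
  by rewrite map_inj_uniq ?enum_uniq// => a b [].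
by rewrite size_map -cardE cardC1 card_ord.
Qed.

Lemma integral_one_others i k (f : TY -> R) (h : R -> \bar R) :
  (forall y, 0 <= f y) -> measurable_fun setT f ->
  (forall x, 0 <= h x)%E -> measurable_fun setT h ->
  (\int[P]_w ((f (tnth (Yt W i w) k))%:E * h (others k (Yt W i w))) =
   \int[Q]_y (f y)%:E * iid_sum N.-1 h 0)%E.
Proof.
move=> f0 mf h0 mh; rewrite -(integral_others i k h0 mh).
pose J1 : set index := [set iY q.1 q.2 | q in [set` others_seq i k]].
pose J2 : set index := [set iY i k].
transitivity (\int[P]_w ((f (cY W i k w))%:E * h (others k (Yt W i w))))%E.
  by apply: eq_integral => w _; rewrite tnth_mktuple.
rewrite (@freeze_rv _ _ _ _ _ _ _ _ W J1 J2 _ _ _ _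
  (fun w => others k (Yt W i w)) (cY W i k) (fun z y => (f y)%:E * h z)%E).
- rewrite -ge0_integralZl; last 4 first.
  + exact: measurableT.
  + exact: (measurableT_comp mh (measurableT_comp (measurable_others k)
      (measurable_YtT W i))).
  + by [].
  + by apply: integral_ge0 => y _; rewrite lee_fin.
  apply: eq_integral => w _.
  rewrite (integral_cY i k (f := fun y => ((f y)%:E * h (others k (Yt W i w)))%E)).
  + rewrite (ge0_integralZr Q measurableT (f := fun y => (f y)%:E))//.
    * exact/measurable_EFinP.
    * by move=> y _; rewrite lee_fin.
  + by move=> y; rewrite mule_ge0// lee_fin.
  + by apply: emeasurable_funM => //; exact/measurable_EFinP.
- apply/seteqP; split => // x [[q /= /mapP[j]]]; rewrite mem_enum inE => jk -> <-.
  by move=> [jk']; rewrite jk' eqxx in jk.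
- rewrite (_ : (fun w => _) = fun w => \sum_(p <- others_seq i k) r (cY W p.1 p.2 w)).
    by apply: measurable_sum_rY => q qs; exists q.
  by apply/funext => w; rewrite othersE.
- exact: measurable_Y.
- by move=> a b; rewrite mule_ge0// lee_fin.
- apply: emeasurable_funM; last exact: (measurableT_comp mh measurable_fst).
  by apply/measurable_EFinP; exact: (measurableT_comp mf measurable_snd).
Qed.

End iid_sums.

(** * Moments of one batch *)

Section moments.
Context d d' (T : measurableType d) (TY : measurableType d') (R : realType).
Variables (P : probability T R) (Q : probability TY R) (N : nat).
Variable W : common_randomness P Q N.
Hypothesis N_gt0 : (0 < N)%N.
Variables (r : TY -> R) (mr : measurable_fun setT r) (r0 : forall y, 0 <= r y).
Hypothesis Er : (\int[Q]_y (r y)%:E = 1)%E.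
Variables (o : R) (o1 : 1 <= o) (ro : forall y, r y <= o).

Local Notation lam := (@lam _ TY R N r).
Local Notation Zsum := (@Zsum _ TY R N r).
Local Notation others := (@others _ TY R N r).
Local Notation E f := (\int[P]_w (f w)%:E)%E.

Let o0 : 0 < o. Proof. exact: lt_le_trans ltr01 o1. Qed.

Let oth0 k y : 0 <= others k y. Proof. exact: others_ge0. Qed.
Let lam0 y k : 0 <= lam y k. Proof. exact: r0. Qed.
Let Zs0 y : 0 <= Zsum y. Proof. exact: sumr_ge0. Qed.
Let mY i : measurable_fun setT (Yt W i). Proof. exact: measurable_YtT. Qed.

Definition mean_others (h : R -> R) : R :=
  fine (iid_sum Q r N.-1 (fun v => (h v)%:E) 0).

(** Boundedness keeps the means finite, so that they can be handled as reals. *)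
Definition unit_valued (h : R -> R) :=
  [/\ forall v, 0 <= h v, forall v, h v <= 1 & measurable_fun setT h].

Lemma mean_othersE i k h : unit_valued h ->
  E (fun w => h (others k (Yt W i w))) = (mean_others h)%:E.
Proof.
move=> [h0 hle1 mh].
have I0 : (\int[P]_w (h (others k (Yt W i w)))%:E = iid_sum Q r N.-1 (fun v => (h v)%:E) 0)%E.
  rewrite (@integral_others _ _ _ _ _ _ _ _ W r mr i k (fun v => (h v)%:E))//.
  exact/measurable_EFinP.
rewrite I0 /mean_others fineK// -I0 ge0_fin_numE; last first.
  by apply: integral_ge0 => w _; rewrite lee_fin.
apply: (@le_lt_trans _ _ (\int[P]_w 1)%E).
  by apply: le_lower_integral => w //; rewrite lee_fin.
by rewrite integral_cst//= probability_setT mule1 ltry.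
Qed.

Lemma mean_others_ge0 h : unit_valued h -> 0 <= mean_others h.
Proof.
move=> gh; rewrite -lee_fin -(mean_othersE 0 (Ordinal N_gt0) gh).
by apply: integral_ge0 => w _; rewrite lee_fin; case: gh.
Qed.

Lemma integral_f_others i k (f : TY -> R) h : unit_valued h ->
  (forall y, 0 <= f y) -> measurable_fun setT f ->
  E (fun w => f (tnth (Yt W i w) k) * h (others k (Yt W i w))) =
  (\int[Q]_y (f y)%:E * (mean_others h)%:E)%E.
Proof.
move=> gh f0 mf; rewrite -(mean_othersE i k gh); case: gh => h0 hle1 mh.
under eq_integral do rewrite EFinM.
rewrite (@integral_one_others _ _ _ _ _ _ _ _ W r mr i k f (fun v => (h v)%:E))//.
- rewrite (@integral_others _ _ _ _ _ _ _ _ W r mr i k (fun v => (h v)%:E))//.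
  exact/measurable_EFinP.
- exact/measurable_EFinP.
Qed.

(** Weighting by [lam y k] turns the law of candidate k into P_x and leaves the other candidates
    alone. *)
Lemma integral_lam_others i k h : unit_valued h ->
  E (fun w => lam (Yt W i w) k * h (others k (Yt W i w))) = (mean_others h)%:E.
Proof. by move=> gh; rewrite integral_f_others// Er mul1e. Qed.

(* Used at v = \sum_(j != k) r (y_j) >= 0 only: the absolute value makes them bounded on R. *)
Definition recip (v : R) := (`|v| + o)^-1.
Definition recip_sq (v : R) := ((`|v| + o) ^+ 2)^-1.
Definition ratio_sq (v : R) := `|v| / (`|v| + o) ^+ 2.

Let vo (v : R) : 1 <= `|v| + o. Proof. by rewrite -[1]add0r lerD. Qed.
Let vo0 (v : R) : 0 < `|v| + o. Proof. exact: lt_le_trans ltr01 (vo v). Qed.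

Let mvo : measurable_fun setT (fun v : R => `|v| + o).
Proof. by apply: measurable_funD => //; exact: measurableT_comp. Qed.

Lemma unit_valued_recip : unit_valued recip.
Proof.
split=> [v|v|]; first by rewrite invr_ge0 ltW.
  by rewrite invf_le1.
exact: measurable_fun_inv.
Qed.

Lemma unit_valued_recip_sq : unit_valued recip_sq.
Proof.
split=> [v|v|]; first by rewrite invr_ge0 sqr_ge0.
  by rewrite invf_le1 ?exprn_gt0// exprn_ege1.
by apply: measurable_fun_inv; exact: measurable_funX.
Qed.

Lemma ratio_sq_le v : ratio_sq v <= recip v.
Proof.
rewrite /ratio_sq /recip ler_pdivrMr ?exprn_gt0// expr2 mulrA mulVf ?gt_eqF// mul1r.
by rewrite lerDl ltW.
Qed.

Lemma unit_valued_ratio_sq : unit_valued ratio_sq.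
Proof.
have [h10 h11 mh1] := unit_valued_recip.
split=> [v|v|]; first by rewrite divr_ge0 ?sqr_ge0.
  exact: le_trans (ratio_sq_le v) (h11 v).
by apply: measurable_fun_div; [exact: normr_measurable|exact: measurable_funX].
Qed.

(* The mean of 1 / Zbar_x, that is Delta_x / N (see Delta_ofE). *)
Definition delta := mean_others recip.
Definition mean_recip_sq := mean_others recip_sq.
Definition mean_ratio_sq := mean_others ratio_sq.

Let k0 := Ordinal N_gt0.

Lemma E_lam i k : E (fun w => lam (Yt W i w) k) = 1%E.
Proof.
have g1 : unit_valued (fun=> 1) by split => //; exact: measurable_cst.
have := integral_lam_others i k g1; under eq_integral do rewrite mulr1.
move=> ->; rewrite -(mean_othersE i k g1).
by rewrite integral_cst//= probability_setT mule1.
Qed.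

Lemma E_others i k : E (fun w => others k (Yt W i w)) = (N%:R - 1 : R)%:E.
Proof.
rewrite (ge0_integral_sum_EFin P _ _ (f := fun j w => lam (Yt W i w) j))//; last first.
  by move=> j; exact: (measurableT_comp (measurable_lam mr j)).
under eq_bigr do rewrite E_lam.
rewrite sumEFin (eq_bigl [in predC1 k])// sumr_const cardC1 card_ord.
by rewrite -subn1 natrB.
Qed.

(** The winning share of k divided by Z + o, a substitute for [Zbar] that does not depend on k. It
    is within a factor 2 of [Zbar], and the sum over k collapses to 1 / (Z + o). *)
Definition race_share k y := lam y k / (Zsum y * (Zsum y + o)).

Lemma race_share_ge0 k y : 0 <= race_share k y.
Proof. by rewrite divr_ge0// mulr_ge0// addr_ge0// ltW. Qed.

Lemma measurable_race_share k : measurable_fun setT (race_share k).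
Proof.
apply: measurable_fun_div; first exact: measurable_lam.
apply: measurable_funM; first exact: measurable_Zsum.
by apply: measurable_funD => //; exact: measurable_Zsum.
Qed.

Lemma Zsum_eq0 k y : Zsum y = 0 -> lam y k = 0.
Proof.
by move=> /eqP; rewrite psumr_eq0// => /allP/(_ k); rewrite mem_index_enum => /(_ isT)/eqP.
Qed.

Lemma sum_race_share y : \sum_k race_share k y <= recip (others k0 y).
Proof.
rewrite -mulr_suml -/(Zsum y) /recip ger0_norm//.
have [Z0|Z0] := eqVneq (Zsum y) 0.
  by rewrite Z0 mul0r invr_ge0 addr_ge0// ltW.
rewrite invfM mulrA mulfV// mul1r lef_pV2 ?posrE; last 2 first.
- by rewrite ltr_wpDl.
- by rewrite ltr_wpDl.
by rewrite lerD2r (Zsum_others r k0) lerDr.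
Qed.

Lemma E_sum_race_share i : (\sum_k E (fun w => race_share k (Yt W i w)) <= delta%:E)%E.
Proof.
rewrite -(mean_othersE i k0 unit_valued_recip).
rewrite -(ge0_integral_sum_EFin P _ _ (f := fun k w => race_share k (Yt W i w)))//.
- apply: le_lower_integral => w; rewrite lee_fin; last exact: sum_race_share.
  by have [+ _ _] := unit_valued_recip; apply.
- by move=> k w; exact: race_share_ge0.
- by move=> k; exact: (measurableT_comp (measurable_race_share k)).
Qed.

(** With V = [others k y], the bound r <= o gives Z <= V + o, and then Z + o <= 2 (V + o). *)
Lemma race_share_lb k y : lam y k * recip_sq (others k y) <= 2 * race_share k y.
Proof.
rewrite /recip_sq ger0_norm// /race_share.
have [Z0|Z0] := eqVneq (Zsum y) 0; first by rewrite (Zsum_eq0 k Z0) !mul0r mulr0.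
have Zp : 0 < Zsum y by rewrite lt_neqAle eq_sym Z0 Zs0.
rewrite mulrCA ler_wpM2l//.
have -> : 2 / (Zsum y * (Zsum y + o)) = ((Zsum y * (Zsum y + o)) / 2)^-1.
  by rewrite invf_div.
have Zle : Zsum y <= others k y + o by rewrite (Zsum_others r k) addrC lerD2l ro.
have V0 := oth0 k y.
have Vo : 0 < others k y + o by rewrite ltr_wpDl.
have Zo : 0 < Zsum y + o by rewrite ltr_wpDl// ltW.
rewrite lef_pV2 ?posrE ?divr_gt0 ?mulr_gt0 ?exprn_gt0//.
rewrite ler_pdivrMr// expr2 -mulrA; apply: ler_pM => //; first exact: ltW.
by move: V0; lra.
Qed.

Lemma race_share_ub k y : lam y k / (Zsum y * (others k y + o)) <= 2 * race_share k y.
Proof.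
rewrite /race_share.
have [Z0|Z0] := eqVneq (Zsum y) 0; first by rewrite (Zsum_eq0 k Z0) !mul0r mulr0.
have Zp : 0 < Zsum y by rewrite lt_neqAle eq_sym Z0 Zs0.
have V0 := oth0 k y.
have Zle : Zsum y <= others k y + o by rewrite (Zsum_others r k) addrC lerD2l ro.
have Vo : 0 < others k y + o by rewrite ltr_wpDl.
have Zo : 0 < Zsum y + o by rewrite ltr_wpDl// ltW.
rewrite mulrCA ler_wpM2l// !invfM mulrCA ler_wpM2l ?invr_ge0//.
by rewrite ler_pdivlMr// mulrC ler_pdivrMr//; lra.
Qed.

(** Each of the N copies of the mean is rewritten with the weight [lam y k] for its own k; the
    weighted terms are at most twice the race shares, whose total is at most 1 / [Zbar]. *)
Lemma N_mean_recip_sq_le : N%:R * mean_recip_sq <= 2 * delta.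
Proof.
suff : ((N%:R * mean_recip_sq)%:E <= 2%:E * delta%:E)%E by rewrite -EFinM lee_fin.
apply: le_trans; last by apply: lee_wpmul2l; [rewrite lee_fin|exact: (E_sum_race_share 0)].
rewrite ge0_sume_distrr; last first.
  by move=> k _; apply: integral_ge0 => w _; rewrite lee_fin race_share_ge0.
have -> : (N%:R * mean_recip_sq)%:E = (\sum_(k < N) mean_recip_sq%:E)%E.
  by rewrite sumEFin sumr_const card_ord mulr_natl.
apply: lee_sum => k _; rewrite -(integral_lam_others 0 k unit_valued_recip_sq).
rewrite -ge0_integralM_EFin//; last 2 first.
- by move=> w; exact: race_share_ge0.
- exact: (measurableT_comp (measurable_race_share k)).
apply: le_lower_integral => w; rewrite lee_fin; last exact: race_share_lb.
by rewrite mulr_ge0// race_share_ge0.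
Qed.

Lemma o_mean_recip_sq_le : o * mean_recip_sq <= delta.
Proof.
rewrite -lee_fin EFinM -(mean_othersE 0 k0 unit_valued_recip)
  -(mean_othersE 0 k0 unit_valued_recip_sq).
have [h20 _ mh2] := unit_valued_recip_sq; have [h10 _ mh1] := unit_valued_recip.
rewrite -ge0_integralM_EFin//; last 2 first.
- exact: ltW.
- exact: (measurableT_comp mh2 (measurableT_comp (measurable_others mr k0) (mY 0))).
apply: le_lower_integral => w; rewrite lee_fin//.
rewrite /recip /recip_sq; set v := others _ _; have := vo0 v => vo1.
rewrite expr2 invfM mulrA ler_piMl ?invr_ge0 ?(ltW vo1)//.
by rewrite ler_pdivrMr// mul1r lerDr.
Qed.

(* Jensen for 1 / v, through its tangent at the mean N - 1 + o. *)
Lemma delta_ge : (N%:R - 1 + o)^-1 <= delta.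
Proof.
set a := N%:R - 1 + o.
have N1 : (1 : R) <= N%:R by rewrite ler1n.
have a0 : 0 < a by move: o1 N1; rewrite /a; lra.
have [h10 _ mh1] := unit_valued_recip.
have mO : measurable_fun setT (fun w => others k0 (Yt W 0 w)).
  exact: (measurableT_comp (measurable_others mr k0) (mY 0)).
have : (2 / a <= delta + (a ^+ 2)^-1 * (N%:R - 1 + o)).
  rewrite -lee_fin EFinD [X in (_ + X)%E]EFinM -(mean_othersE 0 k0 unit_valued_recip).
  have -> : (N%:R - 1 + o)%:E = (\int[P]_w (others k0 (Yt W 0 w) + o)%:E)%E.
    rewrite ge0_integralD_EFin ?E_others ?integral_cst//=.
      by rewrite probability_setT mule1 -EFinD.
    by move=> _; exact: ltW.
  have mOo : measurable_fun setT (fun w => others k0 (Yt W 0 w) + o).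
    exact: measurable_funD.
  have Oo0 w : 0 <= others k0 (Yt W 0 w) + o by rewrite addr_ge0// ltW.
  have a20 : 0 <= (a ^+ 2)^-1 by rewrite invr_ge0 sqr_ge0.
  rewrite -ge0_integralM_EFin// -ge0_integralD_EFin//; last 3 first.
  - exact: (measurableT_comp mh1 mO).
  - by move=> w; rewrite mulr_ge0.
  - exact: measurable_funM.
  rewrite -[X in (X <= _)%E]mule1 -[X in (_ * X)%E](@probability_setT _ _ _ P).
  rewrite -integral_cst//; apply: le_lower_integral => w.
    by rewrite lee_fin addr_ge0// mulr_ge0.
  rewrite lee_fin /recip ger0_norm//; set v := _ + o.
  have v0 : 0 < v by rewrite /v ltr_wpDl.
  have -> : v^-1 + (a ^+ 2)^-1 * v = 2 / a + (a - v) ^+ 2 / (v * a ^+ 2).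
    by field; rewrite !gt_eqF.
  by rewrite lerDl divr_ge0 ?sqr_ge0// mulr_ge0 ?sqr_ge0// ltW.
have -> : (a ^+ 2)^-1 * (N%:R - 1 + o) = a^-1.
  by rewrite -/a; field; rewrite gt_eqF.
by lra.
Qed.

Lemma mean_ratio_sq_le : mean_ratio_sq <= delta.
Proof.
rewrite -lee_fin -(mean_othersE 0 k0 unit_valued_recip) -(mean_othersE 0 k0 unit_valued_ratio_sq).
have [h10 _ mh1] := unit_valued_recip.
by apply: le_lower_integral => w; rewrite lee_fin//; exact: ratio_sq_le.
Qed.

Lemma o2_mean_ratio_sq_le : o ^+ 2 * mean_ratio_sq <= N%:R - 1.
Proof.
rewrite -lee_fin EFinM -(E_others 0 k0) -(mean_othersE 0 k0 unit_valued_ratio_sq).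
have [h30 _ mh3] := unit_valued_ratio_sq.
rewrite -ge0_integralM_EFin ?sqr_ge0//; last first.
  exact: (measurableT_comp mh3 (measurableT_comp (measurable_others mr k0) (mY 0))).
apply: le_lower_integral => w; rewrite lee_fin// /ratio_sq ger0_norm//.
set v := others _ _; have v0 : 0 <= v by exact: oth0.
rewrite mulrCA ler_piMr// ler_pdivrMr ?exprn_gt0 ?ltr_wpDl// mul1r.
by rewrite ler_sqr ?nnegrE ?addr_ge0 ?(ltW o0)// lerDr.
Qed.

Lemma delta_gt0 : 0 < delta.
Proof.
apply: lt_le_trans delta_ge; rewrite invr_gt0.
have : (1 : R) <= N%:R by rewrite ler1n.
by move: o0; lra.
Qed.

Lemma mean_recip_sq_ge0 : 0 <= mean_recip_sq.
Proof. exact: mean_others_ge0 unit_valued_recip_sq. Qed.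

(** A reverse Jensen inequality for 1 / [Zbar]. The factors N and o cost 2 delta and delta, so (N -
    1 + o) times the left-hand side is at most 3 delta, and 1 / (N - 1 + o) <= delta. *)
Lemma mean_recip_sq_le : mean_recip_sq <= 3 * delta ^+ 2.
Proof.
have := delta_ge; set a := _ + o => ad.
have N1 : (1 : R) <= N%:R by rewrite ler1n.
have a0 : 0 < a by move: o1 N1; rewrite /a; lra.
have aq : a * mean_recip_sq <= 3 * delta.
  have := N_mean_recip_sq_le; have := o_mean_recip_sq_le;
    have := mean_recip_sq_ge0; rewrite /a; nra.
have : mean_recip_sq <= 3 * delta / a by rewrite ler_pdivlMr// mulrC.
move/le_trans; apply; rewrite expr2 mulrA ler_wpM2l// mulr_ge0//.
exact: ltW delta_gt0.
Qed.

(** Two regimes for a = N - 1 + o, with 1 <= a delta in both. If o < N - 1 then a <= 2 N and the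
    bound by delta suffices; otherwise a <= 2 o and the bound by (N - 1) / o^2 does. *)
Lemma mean_ratio_sq_le4 : mean_ratio_sq <= 4 * N%:R * delta ^+ 2.
Proof.
have := delta_ge; set a := _ + o => ad.
have N1 : (1 : R) <= N%:R by rewrite ler1n.
have a0 : 0 < a by move: o1 N1; rewrite /a; lra.
have dp := delta_gt0.
have ad1 : 1 <= a * delta by rewrite -ler_pdivrMl// mulr1.
have [oN|No] := leP (N%:R - 1) o; last first.
  apply: le_trans mean_ratio_sq_le _.
  have a2N : a <= 2 * N%:R by rewrite /a; lra.
  have : 1 <= 2 * N%:R * delta by apply: le_trans ad1 _; rewrite ler_wpM2r// ltW.
  nra.
have a2o : a <= 2 * o by rewrite /a; lra.
have od : 1 <= 2 * o * delta by apply: le_trans ad1 _; rewrite ler_wpM2r// ltW.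
have od2 : 1 <= 4 * (o * delta) ^+ 2.
  have -> : 4 * (o * delta) ^+ 2 = (2 * o * delta) ^+ 2 by ring.
  exact: exprn_ege1.
have h := o2_mean_ratio_sq_le.
have p_le : mean_ratio_sq <= (N%:R - 1) / o ^+ 2 by rewrite ler_pdivlMr ?exprn_gt0// mulrC.
apply: (le_trans p_le); rewrite ler_pdivrMr ?exprn_gt0//.
have -> : 4 * N%:R * delta ^+ 2 * o ^+ 2 = N%:R * (4 * (o * delta) ^+ 2) by ring.
by nra.
Qed.

End moments.

(** * Acceptance and rejection of one batch *)

(* x is the ratio of the accepted candidate, x + v = Zhat, v + o = Zbar, Dx = Delta_x and
   M = N - 1. The last two factors of the left-hand side bound the conditional means of the
   rank of U, divided by 1 + x, and of the rank of S. *)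
Lemma expand_batch_weight (R : realType) (x v o Dx M : R) :
  0 <= x -> 0 <= v -> 1 <= o -> 0 < Dx -> 0 <= M ->
  x / (v + o) * ((1 + (x + v) / ((v + o) * Dx)) / (1 + x)) *
    (1 + 2 * M * (x / (x + v))) <=
  x / (v + o) + (x * (v / (v + o) ^+ 2) + (1 + 2 * M) * (x / (v + o) ^+ 2)) / Dx
    + 2 * M * (x / ((x + v) * (v + o))).
Proof.
move=> x0 v0 o1 D0 M0.
have [->|xn0] := eqVneq x 0; first by rewrite !(mul0r, mulr0, addr0).
have xp : 0 < x by rewrite lt_neqAle eq_sym xn0.
have z0 : 0 < v + o by lra.
have i0 : 0 < (1 + x)^-1 by rewrite invr_gt0; lra.
have i1 : (1 + x)^-1 <= 1 by rewrite invf_le1; lra.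
have xi1 : x * (1 + x)^-1 <= 1 by rewrite ler_pdivrMr; lra.
rewrite -subr_ge0; set z := v + o in z0 *.
(* The difference regroups into nonnegative multiples of 1 - 1 / (1 + x) and of 1 - x / (1 + x). *)
have -> : x / z + (x * (v / z ^+ 2) + (1 + 2 * M) * (x / z ^+ 2)) / Dx +
    2 * M * (x / ((x + v) * z)) -
    x / z * ((1 + (x + v) / (z * Dx)) / (1 + x)) * (1 + 2 * M * (x / (x + v))) =
  (x / z + x * v / (z ^+ 2 * Dx)) * (1 - (1 + x)^-1) +
  ((1 + 2 * M) * x / (z ^+ 2 * Dx) + 2 * M * x / ((x + v) * z)) * (1 - x * (1 + x)^-1).
  by field; rewrite !gt_eqF//; lra.
have xv0 : 0 < x + v by lra.
apply: addr_ge0; apply: mulr_ge0; rewrite ?subr_ge0//; apply: addr_ge0;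
  rewrite divr_ge0 ?mulr_ge0 ?sqr_ge0 ?(ltW z0) ?(ltW D0) ?(ltW xv0)//; lra.
Qed.

Section batch_bounds.
Context d d' (T : measurableType d) (TY : measurableType d') (R : realType).
Variables (P : probability T R) (Q : probability TY R) (N : nat).
Variable W : common_randomness P Q N.
Hypothesis N_gt0 : (0 < N)%N.
Variables (r : TY -> R) (mr : measurable_fun setT r) (r0 : forall y, 0 <= r y).
Hypothesis Er : (\int[Q]_y (r y)%:E = 1)%E.
Variables (o om : R) (o1 : 1 <= o) (ro : forall y, r y <= o) (oom : o <= om).

Local Notation lam := (@lam _ TY R N r).
Local Notation Zsum := (@Zsum _ TY R N r).
Local Notation others := (@others _ TY R N r).
Local Notation wins := (@wins _ TY R N r).
Local Notation delta := (delta Q N r o).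
Local Notation E f := (\int[P]_w (f w)%:E)%E.
Local Notation Y i w := (Yt W i w).
Local Notation S i w := (St W i w).
Local Notation U i w := (cU W i w).

Let o0 : 0 < o. Proof. exact: lt_le_trans ltr01 o1. Qed.
Let oth0 k y : 0 <= others k y. Proof. exact: others_ge0. Qed.
Let lam0 y k : 0 <= lam y k. Proof. exact: r0. Qed.
Let Zs0 y : 0 <= Zsum y. Proof. exact: sumr_ge0. Qed.
Let mY i : measurable_fun setT (Yt W i). Proof. exact: measurable_YtT. Qed.
Let d0 : 0 < delta. Proof. exact: (delta_gt0 W N_gt0 mr r0 Er o1). Qed.
Let NR : (1 : R) <= N%:R. Proof. by rewrite ler1n. Qed.

(** The same expression as [Delta], available here before any channel is given. *)
Definition accept_rate : R := N%:R / (N%:R - 1 + om).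
Local Notation D := accept_rate.
(* Delta / Delta_x *)
Definition rho : R := D / (N%:R * delta).
Definition threshold k y : R := Zsum y / (others k y + o) * rho.

Lemma D_gt0 : 0 < D.
Proof. by rewrite divr_gt0//; move: NR o1 oom; lra. Qed.

Lemma rho_gt0 : 0 < rho.
Proof. by rewrite divr_gt0 ?D_gt0// mulr_gt0//; move: NR; lra. Qed.

Lemma rho_le1 : rho <= 1.
Proof.
have Nd : 0 < N%:R * delta by rewrite mulr_gt0//; move: NR; lra.
rewrite ler_pdivrMr// mul1r ler_wpM2l//.
apply: le_trans (delta_ge W N_gt0 mr r0 Er o1).
by rewrite lef_pV2 ?posrE; move: NR o1 oom; lra.
Qed.

Lemma Zsum_le k y : Zsum y <= others k y + o.
Proof. by rewrite (Zsum_others r k) addrC lerD2l ro. Qed.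

Let Vo k y : 0 < others k y + o. Proof. by rewrite ltr_wpDl. Qed.

Lemma threshold_01 k y : 0 <= threshold k y <= 1.
Proof.
apply/andP; split.
  by rewrite mulr_ge0 ?(ltW rho_gt0)// divr_ge0// ltW.
rewrite /threshold -[leRHS]mulr1 ler_pM ?(ltW rho_gt0) ?rho_le1// ?divr_ge0// ?(ltW (Vo k y))//.
by rewrite ler_pdivrMr// mul1r Zsum_le.
Qed.

Lemma measurable_threshold k : measurable_fun setT (threshold k).
Proof.
apply: measurable_funM => //; apply: measurable_fun_div; first exact: measurable_Zsum.
by apply: measurable_funD => //; exact: measurable_others.
Qed.

(** The Zhat of the acceptance test cancels the normalisation of the race. What is left is [lam y k]
    times a function of the other candidates, to which [integral_lam_others] applies. *)
Lemma win_threshold k y : lam y k / Zsum y * threshold k y = lam y k * recip o (others k y) * rho.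
Proof.
rewrite /threshold /recip ger0_norm//.
have [Z0|Z0] := eqVneq (Zsum y) 0; first by rewrite (Zsum_eq0 r0 k Z0) !mul0r.
rewrite !mulrA; congr (_ * _ * _); first by rewrite divfK.
Qed.

(* Ties make several candidates win, and Zsum = 0 makes the candidate junk: this only
   dominates the indicator of rejection. *)
Definition rejected y s u : R :=
  (Zsum y == 0)%:R + \sum_k (wins k y s && (threshold k y < u))%:R.

Lemma rejected_ge0 y s u : 0 <= rejected y s u.
Proof. by rewrite addr_ge0// sumr_ge0. Qed.

Let mYS i : measurable_fun setT (fun w => (Y i w, S i w)).
Proof. by apply: measurable_fun_pair => //; exact: measurable_StT. Qed.

Lemma integral_win i k (phi : N.-tuple TY -> R -> R) :
  (forall y u, 0 <= phi y u) ->
  measurable_fun setT (fun z : N.-tuple TY * R => phi z.1 z.2) ->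
  (E (fun w => (wins k (Y i w) (S i w))%:R * phi (Y i w) (U i w)) <=
   E (fun w => lam (Y i w) k / Zsum (Y i w) * phi (Y i w) (U i w)))%E.
Proof.
move=> phi0 mphi.
(* [integral_race] wants c nonnegative on all of R; shares are nonnegative, so the maximum is then
   removed. *)
have := @integral_race _ _ _ _ _ _ _ _ W r mr i k xpredT (fun t => Num.max t 0)
  phi (measurable_cst true) _ _ phi0 mphi.
under eq_integral do rewrite andbT.
under [X in _ -> _ -> (_ <= X)%E]eq_integral => w _.
  rewrite (max_idPl _); last by rewrite divr_ge0.
  over.
apply.
- move=> y lk; rewrite (max_idPl _) ?divr_ge0//.
  have := race_prob W i (lam0 y) lk.
  rewrite (_ : [set v | race k (lam y) (tnth (S i v)) && xpredT (S i v)] =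
    [set v | race k (lam y) (fun j => cS W i j v)])//.
  apply/seteqP; split => v /=; rewrite ?andbT => /forallP H; apply/forallP => j;
    by have := H j; rewrite !tnth_mktuple.
- by move=> t; rewrite le_max lexx orbT.
Qed.

Lemma integral_win2 i k j (phi : N.-tuple TY -> R -> R) : j != k ->
  (forall y u, 0 <= phi y u) ->
  measurable_fun setT (fun z : N.-tuple TY * R => phi z.1 z.2) ->
  (E (fun w => (wins k (Y i w) (S i w) && (tnth (S i w) j <= tnth (S i w) k))%:R
       * phi (Y i w) (U i w)) <=
   E (fun w => 2 * (lam (Y i w) k / Zsum (Y i w)) ^+ 2 * phi (Y i w) (U i w)))%E.
Proof.
move=> jk phi0 mphi.
apply: (@integral_race _ _ _ _ _ _ _ _ W r mr i k
  (fun s => tnth s j <= tnth s k) (fun t => 2 * t ^+ 2)) => //.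
- by apply: measurable_fun_ler; exact: measurable_tnth.
- move=> y lk; have := race2_prob W i (lam0 y) lk jk.
  rewrite (_ : [set v | race k (lam y) (tnth (S i v)) && _] =
    [set v | race k (lam y) (fun j => cS W i j v) &&
             (cS W i j v <= cS W i k v)%R])//.
  apply/seteqP; split => v /=; rewrite !tnth_mktuple => /andP[/forallP H ->];
    rewrite andbT; apply/forallP => j'; have := H j'; by rewrite !tnth_mktuple.
- by move=> t; rewrite mulr_ge0// sqr_ge0.
Qed.

(** Rejection and a condition b on U, at once for b always true with c = 1 and for b = (U <= u) with
    c = max (u, 0). Given the winner k, the probability is at most (1 - threshold) c. Averaged over
    the shares, 1 - threshold is one minus a function of mean D. *)
Lemma reject_bound i (b : R -> bool) (c : R) : 0 <= c ->
  measurable_fun setT b ->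
  (P [set w | b (U i w)] <= c%:E)%E ->
  (forall t, (0 <= t <= 1)%R ->
    P [set w | (t < U i w)%R && b (U i w)] <= ((1 - t) * c)%:E)%E ->
  (E (fun w => rejected (Y i w) (S i w) (U i w) * (b (U i w))%:R) <=
   ((1 - D) * c)%:E)%E.
Proof.
move=> c0 mb bc tbc.
pose a k y := lam y k / Zsum y * (1 - threshold k y).
have a0 k y : 0 <= a k y.
  by rewrite mulr_ge0 ?divr_ge0// subr_ge0; have /andP[] := threshold_01 k y.
have ma k : measurable_fun setT (a k).
  apply: measurable_funM.
    by apply: measurable_fun_div; [exact: measurable_lam|exact: measurable_Zsum].
  by apply: measurable_funB => //; exact: measurable_threshold.
have mZ0 : measurable_fun setT (fun y : N.-tuple TY => (Zsum y == 0)%:R : R).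
  apply: measurable_bool_natr; apply: measurable_fun_eqr => //.
  exact: measurable_Zsum.
have mbU : measurable_fun setT (fun w => b (U i w)).
  exact: (measurableT_comp mb (measurable_UT W i)).
have mwt k : measurable_fun setT (fun w =>
    wins k (Y i w) (S i w) && (threshold k (Y i w) < U i w)).
  apply: measurable_and; first exact: (measurableT_comp (measurable_wins mr k) (mYS i)).
  apply: measurable_fun_ltr; last exact: measurable_UT.
  exact: (measurableT_comp (measurable_threshold k) (mY i)).
under eq_integral do rewrite mulrDl mulr_suml.
rewrite ge0_integralD_EFin; last 4 first.
- by move=> w; rewrite mulr_ge0.
- apply: measurable_funM; last exact: measurable_bool_natr.
  exact: (measurableT_comp mZ0 (mY i)).
- by move=> w; apply: sumr_ge0 => k _; rewrite mulr_ge0.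
- apply: measurable_sum => k; apply: measurable_funM; exact: measurable_bool_natr.
rewrite ge0_integral_sum_EFin; last 2 first.
- by move=> k w; rewrite mulr_ge0.
- move=> k; apply: measurable_funM; exact: measurable_bool_natr.
have le1 : (E (fun w => (Zsum (Y i w) == 0)%:R * (b (U i w))%:R) <=
    E (fun w => (Zsum (Y i w) == 0)%:R * c))%E.
  apply: (@integral_U _ _ _ _ _ _ _ _ W i (fun y => (Zsum y == 0)%:R)
    (fun _ => b) (fun=> c)) => //.
  exact: (measurableT_comp mb measurable_snd).
have le2 k : (E (fun w => (wins k (Y i w) (S i w) && (threshold k (Y i w) < U i w))%:R
      * (b (U i w))%:R) <= E (fun w => a k (Y i w) * c))%E.
  have mph : measurable_fun setT (fun z : N.-tuple TY * R =>
      (threshold k z.1 < z.2) && b z.2).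
    apply: measurable_and; last exact: (measurableT_comp mb measurable_snd).
    apply: measurable_fun_ltr => //.
    exact: (measurableT_comp (measurable_threshold k) measurable_fst).
  apply: (@le_trans _ _ (E (fun w => (wins k (Y i w) (S i w))%:R *
      ((threshold k (Y i w) < U i w) && b (U i w))%:R))).
    apply: le_lower_integral => w; rewrite lee_fin ?mulr_ge0//.
    by rewrite -!natrM !mulnb andbA.
  apply: (le_trans (@integral_win i k (fun y u => ((threshold k y < u) && b u)%:R) _ _)) => //.
    exact: measurable_bool_natr.
  under [X in (_ <= X)%E]eq_integral do rewrite /a -mulrA.
  apply: (@integral_U _ _ _ _ _ _ _ _ W i (fun y => lam y k / Zsum y)
    (fun y u => (threshold k y < u) && b u) (fun y => (1 - threshold k y) * c)) => //.
  - by move=> y; rewrite divr_ge0.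
  - by apply: measurable_fun_div; [exact: measurable_lam|exact: measurable_Zsum].
  - by move=> y; apply: tbc; exact: threshold_01.
apply: (le_trans (leeD le1 (lee_sum _ (fun k _ => le2 k)))).
have mc k : measurable_fun setT (fun w => a k (Y i w) * c).
  by apply: measurable_funM => //; exact: (measurableT_comp (ma k) (mY i)).
have mZc : measurable_fun setT (fun w => (Zsum (Y i w) == 0)%:R * c).
  by apply: measurable_funM => //; exact: (measurableT_comp mZ0 (mY i)).
rewrite -ge0_integral_sum_EFin//; last by move=> k w; rewrite mulr_ge0.
rewrite -ge0_integralD_EFin//; last 3 first.
- by move=> w; rewrite mulr_ge0.
- by move=> w; apply: sumr_ge0 => k _; rewrite mulr_ge0.
- exact: measurable_sum.
pose e y := \sum_k lam y k * recip o (others k y) * rho.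
have [h10 _ mh1] := unit_valued_recip o1.
have gh1 := unit_valued_recip o1.
have me k : measurable_fun setT (fun y => lam y k * recip o (others k y) * rho).
  apply: measurable_funM => //; apply: measurable_funM; first exact: measurable_lam.
  exact: (measurableT_comp mh1 (measurable_others mr k)).
have e0 k y : 0 <= lam y k * recip o (others k y) * rho.
  by rewrite mulr_ge0 ?(ltW rho_gt0)// mulr_ge0.
have Ee : E (fun w => e (Y i w)) = D%:E.
  rewrite ge0_integral_sum_EFin//; last by move=> k; exact: (measurableT_comp (me k)).
  transitivity (\sum_(k < N) (rho * delta)%:E)%E.
    apply: eq_bigr => k _.
    under eq_integral do rewrite mulrC.
    rewrite ge0_integralM_EFin ?(ltW rho_gt0)//; last 2 first.
    - by move=> w; rewrite mulr_ge0.
    - apply: measurable_funM; first exact: (measurableT_comp (measurable_lam mr k)).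
      exact: (measurableT_comp mh1 (measurableT_comp (measurable_others mr k) (mY i))).
    by rewrite (integral_lam_others W mr r0 Er i k gh1) -EFinM.
  rewrite sumEFin sumr_const card_ord -mulr_natl; congr EFin.
  by rewrite /rho; field; rewrite gt_eqF ?d0//=; move: NR; lra.
(* The shares add up to 1 unless Z = 0, where they are all 0 and the first indicator takes over. *)
have key w : (Zsum (Y i w) == 0)%:R * c + \sum_k a k (Y i w) * c + c * e (Y i w) = c.
  rewrite -mulr_suml -mulrDl mulrC -mulrDr -[RHS]mulr1; congr (_ * _).
  rewrite /a /e; set y := Y i w.
  under [X in _ + X]eq_bigr do rewrite -win_threshold.
  rewrite -addrA -big_split/=; under eq_bigr do rewrite -mulrDr subrK mulr1.
  rewrite -mulr_suml -/(Zsum y); have [->|Z0] := eqVneq (Zsum y) 0.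
    by rewrite mul0r addr0.
  by rewrite add0r mulfV.
have cD : (0 <= c * D)%R by rewrite mulr_ge0// ltW// D_gt0.
(* The accepted mass is added rather than the rejected one subtracted, so that only integrals of
   nonnegative functions occur. *)
have tot : (E (fun w => (Zsum (Y i w) == 0)%:R * c + \sum_k a k (Y i w) * c)
    + (c * D)%:E = c%:E)%E.
  rewrite EFinM -Ee -ge0_integralM_EFin//; last 2 first.
  - by move=> w; exact: sumr_ge0.
  - by apply: measurable_sum => k; exact: (measurableT_comp (me k)).
  rewrite -ge0_integralD_EFin//.
  - under eq_integral do rewrite key.
    by rewrite integral_cst//= probability_setT mule1.
  - by move=> w; rewrite addr_ge0 ?mulr_ge0// sumr_ge0// => k _; rewrite mulr_ge0.
  - by apply: measurable_funD => //; exact: measurable_sum.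
  - by move=> w; rewrite mulr_ge0//; exact: sumr_ge0.
  - apply: measurable_funM => //; apply: measurable_sum => k.
    exact: (measurableT_comp (me k)).
have -> : ((1 - D) * c)%:E = (c%:E - (c * D)%:E)%E by rewrite -EFinB; congr EFin; ring.
by rewrite -tot addeK.
Qed.

Definition accepts k y s u : bool := wins k y s && (u <= threshold k y).

Let mlam k : measurable_fun setT (lam ^~ k). Proof. exact: measurable_lam. Qed.
Let mZ : measurable_fun setT Zsum. Proof. exact: measurable_Zsum. Qed.
Let moth k : measurable_fun setT (others k). Proof. exact: measurable_others. Qed.
Let mh1o k : measurable_fun setT (fun y => recip o (others k y)).
Proof. by have [_ _ mh1] := unit_valued_recip o1; exact: measurableT_comp. Qed.

Let h1o0 k y : 0 <= recip o (others k y).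
Proof. by have [h10 _ _] := unit_valued_recip o1. Qed.

Lemma measurable_accepts i k :
  measurable_fun setT (fun w => accepts k (Y i w) (S i w) (U i w)).
Proof.
apply: measurable_and; first exact: (measurableT_comp (measurable_wins mr k) (mYS i)).
apply: measurable_fun_ler; first exact: measurable_UT.
exact: (measurableT_comp (measurable_threshold k) (mY i)).
Qed.

Lemma uniform_threshold i k y : (P [set v | (U i v <= threshold k y)%R] <= (threshold k y)%:E)%E.
Proof.
rewrite (_ : [set v | _] = cU W i @^-1` `]-oo, threshold k y]%classic); last first.
  by apply/seteqP; split => v; rewrite /= in_itv.
rewrite -[P _]/(distribution P (cU W i) `]-oo, threshold k y]%classic) cU_law//.
exact: (uniform_prob_le (threshold_01 k y)).
Qed.

Lemma measurable_le_threshold k :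
  measurable_fun setT (fun z : N.-tuple TY * R => z.2 <= threshold k z.1).
Proof.
apply: measurable_fun_ler => //.
exact: (measurableT_comp (measurable_threshold k) measurable_fst).
Qed.

(** S is integrated out first and U next; the winning share and the threshold then combine by
    [win_threshold]. *)
Lemma integral_accept i k (a : N.-tuple TY -> R) :
  (forall y, 0 <= a y) -> measurable_fun setT a ->
  (E (fun w => (accepts k (Y i w) (S i w) (U i w))%:R * a (Y i w)) <=
   E (fun w => lam (Y i w) k * recip o (others k (Y i w)) * rho * a (Y i w)))%E.
Proof.
move=> a0 ma.
apply: (@le_trans _ _ (E (fun w => (wins k (Y i w) (S i w))%:R *
    ((U i w <= threshold k (Y i w))%R%:R * a (Y i w))))).
  apply: le_lower_integral => w; rewrite lee_fin ?mulr_ge0//.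
  by rewrite mulrA -natrM mulnb.
apply: (le_trans (@integral_win i k (fun y u => (u <= threshold k y)%R%:R * a y) _ _)).
- by move=> y u; rewrite mulr_ge0.
- apply: measurable_funM; last exact: (measurableT_comp ma measurable_fst).
  by apply: measurable_bool_natr; exact: measurable_le_threshold.
have -> : E (fun w => lam (Y i w) k * recip o (others k (Y i w)) * rho * a (Y i w)) =
    E (fun w => lam (Y i w) k / Zsum (Y i w) * a (Y i w) * threshold k (Y i w)).
  by apply: eq_integral => w _; rewrite -win_threshold mulrAC.
under eq_integral do rewrite [X in _ * X]mulrC mulrA.
apply: (@integral_U _ _ _ _ _ _ _ _ W i (fun y => lam y k / Zsum y * a y)
  (fun y u => u <= threshold k y) (threshold k)).
- by move=> y; rewrite mulr_ge0// divr_ge0.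
- by apply: measurable_funM => //; exact: measurable_fun_div.
- exact: measurable_le_threshold.
- by move=> y; exact: uniform_threshold.
Qed.

Lemma integral_accept2 i k j (a : N.-tuple TY -> R) : j != k ->
  (forall y, 0 <= a y) -> measurable_fun setT a ->
  (E (fun w => (accepts k (Y i w) (S i w) (U i w))%:R *
       (tnth (S i w) j <= tnth (S i w) k)%R%:R * a (Y i w)) <=
   E (fun w => 2 * (lam (Y i w) k / Zsum (Y i w)) *
       (lam (Y i w) k * recip o (others k (Y i w)) * rho) * a (Y i w)))%E.
Proof.
move=> jk a0 ma.
apply: (@le_trans _ _ (E (fun w =>
    (wins k (Y i w) (S i w) && (tnth (S i w) j <= tnth (S i w) k))%:R *
    ((U i w <= threshold k (Y i w))%R%:R * a (Y i w))))).
  apply: le_lower_integral => w; rewrite lee_fin ?mulr_ge0//.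
  by rewrite mulrA -!natrM !mulnb andbAC.
apply: (le_trans (@integral_win2 i k j (fun y u => (u <= threshold k y)%R%:R * a y) jk _ _)).
- by move=> y u; rewrite mulr_ge0.
- apply: measurable_funM; last exact: (measurableT_comp ma measurable_fst).
  by apply: measurable_bool_natr; exact: measurable_le_threshold.
have -> : E (fun w => 2 * (lam (Y i w) k / Zsum (Y i w)) *
       (lam (Y i w) k * recip o (others k (Y i w)) * rho) * a (Y i w)) =
    E (fun w => 2 * (lam (Y i w) k / Zsum (Y i w)) ^+ 2 * a (Y i w) * threshold k (Y i w)).
  by apply: eq_integral => w _; rewrite -win_threshold; congr EFin; ring.
under eq_integral do rewrite [X in _ * X]mulrC mulrA.
apply: (@integral_U _ _ _ _ _ _ _ _ W i (fun y => 2 * (lam y k / Zsum y) ^+ 2 * a y)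
  (fun y u => u <= threshold k y) (threshold k)).
- by move=> y; rewrite mulr_ge0// mulr_ge0// sqr_ge0.
- apply: measurable_funM => //; apply: measurable_funM => //.
  by apply: measurable_funX; exact: measurable_fun_div.
- exact: measurable_le_threshold.
- by move=> y; exact: uniform_threshold.
Qed.

Lemma N_delta_rho : N%:R * delta * rho = D.
Proof. by rewrite /rho mulrC divfK// mulf_neq0 ?gt_eqF//; move: NR; lra. Qed.

(** One half of the fact that the accepted sample has law P_x: each candidate contributes rho delta
    times the P_x-mean of f, and N rho delta = D. *)
Lemma accept_mean i (f : TY -> R) :
  (forall y, 0 <= f y) -> measurable_fun setT f ->
  (E (fun w => \sum_k (accepts k (Y i w) (S i w) (U i w))%:R * f (tnth (Y i w) k)) <=
   D%:E * \int[Q]_y (r y * f y)%:E)%E.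
Proof.
move=> f0 mf.
have mfk k : measurable_fun setT (fun y : N.-tuple TY => f (tnth y k)).
  exact: (measurableT_comp mf (measurable_tnth k)).
rewrite ge0_integral_sum_EFin; last 2 first.
- by move=> k w; rewrite mulr_ge0.
- move=> k; apply: measurable_funM; last exact: (measurableT_comp (mfk k) (mY i)).
  by apply: measurable_bool_natr; exact: measurable_accepts.
have I0 : (0 <= \int[Q]_y (r y * f y)%:E)%E.
  by apply: integral_ge0 => y _; rewrite lee_fin mulr_ge0.
apply: (@le_trans _ _ (\sum_(k < N) (rho * delta)%:E * \int[Q]_y (r y * f y)%:E)%E).
  apply: lee_sum => k _.
  apply: (le_trans (@integral_accept i k (fun y => f (tnth y k)) _ _)) => //.
  have -> : E (fun w => lam (Y i w) k * recip o (others k (Y i w)) * rho *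
      f (tnth (Y i w) k)) =
    E (fun w => rho * ((r (tnth (Y i w) k) * f (tnth (Y i w) k)) *
      recip o (others k (Y i w)))).
    by apply: eq_integral => w _; congr EFin; rewrite /lam; ring.
  rewrite ge0_integralM_EFin ?(ltW rho_gt0)//; last 2 first.
  - by move=> w; rewrite mulr_ge0// mulr_ge0.
  - apply: measurable_funM; last exact: (measurableT_comp (mh1o k) (mY i)).
    apply: measurable_funM; last exact: (measurableT_comp (mfk k) (mY i)).
    exact: (measurableT_comp (mlam k) (mY i)).
  rewrite (@integral_f_others _ _ _ _ _ _ _ _ W _ mr i k
    (fun y => r y * f y) _ (unit_valued_recip o1)); last 2 first.
  - by move=> y; rewrite mulr_ge0.
  - exact: measurable_funM.
  by rewrite muleCA muleC -EFinM.
rewrite -ge0_sume_distrl; last first.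
  by move=> k _; rewrite lee_fin mulr_ge0 ?(ltW rho_gt0)// ltW.
rewrite sumEFin sumr_const card_ord -mulr_natl.
by have -> : N%:R * (rho * delta) = D by rewrite -N_delta_rho; ring.
Qed.

Definition local_rank k (s : N.-tuple R) : R :=
  1 + \sum_(j < N | j != k) (tnth s j <= tnth s k)%R%:R.

(** With c other batches in the group, 1 + c U bounds the mean rank of U. The constant is 15 = 1 +
    (4 + 2 * 3) + 4, from [delta], [mean_ratio_sq_le4], [mean_recip_sq_le] and the race shares. *)
Lemma accept_ranks i (c : R) : 0 <= c -> c * D <= 1 ->
  (E (fun w => (1 + c * Num.max (U i w) 0) *
       \sum_k (accepts k (Y i w) (S i w) (U i w))%:R *
         local_rank k (S i w) / (1 + lam (Y i w) k)) <= (15 * D)%:E)%E.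
Proof.
move=> c0 cD.
pose Dx := N%:R * delta.
have Dx0 : 0 < Dx by rewrite mulr_gt0//; move: NR; lra.
pose M : R := N%:R - 1.
have M0 : 0 <= M by rewrite /M subr_ge0.
(* On acceptance U is at most the threshold and c <= 1 / D; the quotient in the numerator is
   threshold / D. *)
pose a k y := (1 + Zsum y / ((others k y + o) * Dx)) / (1 + lam y k).
have a0 k y : 0 <= a k y.
  rewrite divr_ge0 ?addr_ge0// divr_ge0// mulr_ge0 ?(ltW Dx0)//.
  exact: ltW.
have ma k : measurable_fun setT (a k).
  apply: measurable_fun_div; last exact: measurable_funD.
  apply: measurable_funD => //; apply: measurable_fun_div => //.
  by apply: measurable_funM => //; exact: measurable_funD.
have maY i' k : measurable_fun setT (fun w => a k (Y i' w)).
  exact: (measurableT_comp (ma k) (mY i')).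
have mA k : measurable_fun setT (fun w =>
    (accepts k (Y i w) (S i w) (U i w))%:R : R).
  by apply: measurable_bool_natr; exact: measurable_accepts.
have mS j : measurable_fun setT (fun w => tnth (S i w) j).
  exact: (measurableT_comp (measurable_tnth j) (measurable_StT W i)).
pose B k w := (accepts k (Y i w) (S i w) (U i w))%:R * a k (Y i w).
pose C k j w := (accepts k (Y i w) (S i w) (U i w))%:R *
  (tnth (S i w) j <= tnth (S i w) k)%R%:R * a k (Y i w).
have B0 k w : 0 <= B k w by rewrite mulr_ge0.
have C0 k j w : 0 <= C k j w by rewrite mulr_ge0// mulr_ge0.
have mB k : measurable_fun setT (B k) by exact: measurable_funM.
have mC k j : measurable_fun setT (C k j).
  apply: measurable_funM => //; apply: measurable_funM => //.
  by apply: measurable_bool_natr; exact: measurable_fun_ler.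
apply: (@le_trans _ _ (E (fun w => \sum_k (B k w + \sum_(j < N | j != k) C k j w)))).
  apply: le_lower_integral => w; rewrite lee_fin.
    by apply: sumr_ge0 => k _; rewrite addr_ge0// sumr_ge0.
  rewrite mulr_sumr; apply: ler_sum => k _.
  have -> : B k w + \sum_(j < N | j != k) C k j w =
      (accepts k (Y i w) (S i w) (U i w))%:R * (local_rank k (S i w) * a k (Y i w)).
    by rewrite /B /C /local_rank -mulr_suml -mulr_sumr; ring.
  have -> : (1 + c * Num.max (U i w) 0) * ((accepts k (Y i w) (S i w) (U i w))%:R *
        local_rank k (S i w) / (1 + lam (Y i w) k)) =
      (accepts k (Y i w) (S i w) (U i w))%:R * (local_rank k (S i w) *
        ((1 + c * Num.max (U i w) 0) / (1 + lam (Y i w) k))) by ring.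
  have [acc|] := boolP (accepts k (Y i w) (S i w) (U i w)); last by rewrite !mul0r.
  have rk0 : 0 <= local_rank k (S i w) by rewrite addr_ge0// sumr_ge0.
  rewrite !mul1r ler_wpM2l// /a ler_wpM2r ?invr_ge0 ?addr_ge0// lerD2l.
  have Uthr : Num.max (U i w) 0 <= threshold k (Y i w).
    have /andP[t0 _] := threshold_01 k (Y i w).
    by rewrite ge_max t0 andbT; move: acc => /andP[].
  apply: (@le_trans _ _ (c * threshold k (Y i w))); first exact: ler_wpM2l.
  have -> : Zsum (Y i w) / ((others k (Y i w) + o) * Dx) = threshold k (Y i w) / D.
    rewrite /threshold /rho -/Dx; field.
    by rewrite !gt_eqF ?D_gt0//.
  rewrite mulrC ler_wpM2l ?(andP (threshold_01 _ _)).1//.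
  by rewrite -[D^-1]mul1r ler_pdivlMr// D_gt0.
rewrite ge0_integral_sum_EFin; last 2 first.
- by move=> k w; rewrite addr_ge0// sumr_ge0.
- by move=> k; apply: measurable_funD => //; exact: measurable_sum_cond.
have [h10 _ mh1] := unit_valued_recip o1; have [h20 _ mh2] := unit_valued_recip_sq o1.
have [h30 _ mh3] := unit_valued_ratio_sq o1.
pose L k y := lam y k * recip o (others k y) * rho.
have L0 k y : 0 <= L k y by rewrite mulr_ge0 ?(ltW rho_gt0)// mulr_ge0.
have mL k : measurable_fun setT (L k).
  by apply: measurable_funM => //; exact: measurable_funM.
have step1 k : (E (fun w => B k w + \sum_(j < N | j != k) C k j w) <=
    E (fun w => L k (Y i w) * a k (Y i w) +
      M * (2 * (lam (Y i w) k / Zsum (Y i w)) * L k (Y i w) * a k (Y i w))))%E.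
  pose e2 y := 2 * (lam y k / Zsum y) * L k y * a k y.
  have e20 y : 0 <= e2 y by rewrite mulr_ge0// mulr_ge0// mulr_ge0// divr_ge0.
  have me2' : measurable_fun setT e2.
    apply: measurable_funM => //; apply: measurable_funM => //.
    by apply: measurable_funM => //; exact: measurable_fun_div.
  have me2 : measurable_fun setT (fun w => e2 (Y i w)).
    exact: (measurableT_comp me2' (mY i)).
  have mLa : measurable_fun setT (fun w => L k (Y i w) * a k (Y i w)).
    exact: (measurableT_comp (measurable_funM (mL k) (ma k)) (mY i)).
  rewrite ge0_integralD_EFin//; last 2 first.
  - by move=> w; exact: sumr_ge0.
  - exact: measurable_sum_cond.
  rewrite ge0_integralD_EFin//; last 3 first.
  - by move=> w; rewrite mulr_ge0.
  - by move=> w; rewrite mulr_ge0//; exact: e20.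
  - exact: measurable_funM.
  apply: leeD; first exact: integral_accept.
  rewrite ge0_integral_sum_EFin//.
  apply: (@le_trans _ _ (\sum_(j < N | j != k) E (fun w => e2 (Y i w)))%E).
    by apply: lee_sum => j jk; exact: integral_accept2.
  rewrite -ge0_integral_sum_EFin//.
  apply: le_lower_integral => w; rewrite lee_fin.
    by apply: mulr_ge0 => //; exact: (e20 (Y i w)).
  rewrite (eq_bigl [in predC1 k])// sumr_const cardC1 card_ord -[leLHS]mulr_natl.
  by rewrite -subn1 natrB.
(* The terms of [expand_batch_weight], all integrable by [integral_lam_others] except the last; that
   one still involves Z and is replaced by [race_share], which turns 2 M into 4 M. *)
pose F k y := lam y k * recip o (others k y) + Dx^-1 * (lam y k * ratio_sq o (others k y) +
    (1 + 2 * M) * (lam y k * recip_sq o (others k y))) + (4 * M) * race_share r o k y.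
have M21 : 0 <= 1 + 2 * M by rewrite addr_ge0// mulr_ge0.
have M4 : 0 <= 4 * M by rewrite mulr_ge0.
have tr0 (k : 'I_N) y : 0 <= race_share r o k y by exact: race_share_ge0.
have Dx1 : 0 <= Dx^-1 by rewrite invr_ge0 ltW.
have l1 k y : 0 <= lam y k * recip o (others k y) by exact: mulr_ge0.
have l2 k y : 0 <= lam y k * recip_sq o (others k y) by exact: mulr_ge0.
have l3 k y : 0 <= lam y k * ratio_sq o (others k y) by exact: mulr_ge0.
have l2' k y : 0 <= (1 + 2 * M) * (lam y k * recip_sq o (others k y)) by exact: mulr_ge0.
have l32 k y : 0 <= lam y k * ratio_sq o (others k y) +
    (1 + 2 * M) * (lam y k * recip_sq o (others k y)) by exact: addr_ge0.
have l32' k y : 0 <= Dx^-1 * (lam y k * ratio_sq o (others k y) +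
    (1 + 2 * M) * (lam y k * recip_sq o (others k y))) by exact: mulr_ge0.
have l132 k y : 0 <= lam y k * recip o (others k y) + Dx^-1 * (lam y k * ratio_sq o (others k y) +
    (1 + 2 * M) * (lam y k * recip_sq o (others k y))) by exact: addr_ge0.
have l4 (k : 'I_N) y : 0 <= 4 * M * race_share r o k y by exact: mulr_ge0.
have F0 k y : 0 <= F k y by exact: addr_ge0.
have step2 k y : L k y * a k y + M * (2 * (lam y k / Zsum y) * L k y * a k y) <=
    rho * F k y.
  have := expand_batch_weight (lam0 y k) (oth0 k y) o1 Dx0 M0.
  rewrite -(Zsum_others r k y) => H.
  have -> : L k y * a k y + M * (2 * (lam y k / Zsum y) * L k y * a k y) =
      rho * (lam y k / (others k y + o) * a k y * (1 + 2 * M * (lam y k / Zsum y))).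
    by rewrite /L /recip ger0_norm//; ring.
  rewrite ler_wpM2l ?(ltW rho_gt0)//; apply: (le_trans H).
  have := race_share_ub r0 o1 ro k y => tub.
  rewrite /F /recip /recip_sq /ratio_sq ger0_norm// lerD//.
    by rewrite lerD2l mulrC.
  have -> : 4 * M * race_share r o k y = 2 * M * (2 * race_share r o k y) by ring.
  by rewrite ler_wpM2l// mulr_ge0.
have mlh k (h : R -> R) : measurable_fun setT h ->
    measurable_fun setT (fun w => lam (Y i w) k * h (others k (Y i w))).
  move=> mh; apply: measurable_funM; first exact: (measurableT_comp (mlam k) (mY i)).
  exact: (measurableT_comp mh (measurableT_comp (moth k) (mY i))).
have mtr k : measurable_fun setT (fun w => race_share r o k (Y i w)).
  exact: (measurableT_comp (measurable_race_share mr o k) (mY i)).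
have tr_le := E_sum_race_share W N_gt0 mr r0 o1 i.
have tr_int0 k : (0 <= E (fun w => race_share r o k (Y i w)))%E.
  by apply: integral_ge0 => w _; rewrite lee_fin.
pose t k := fine (E (fun w => race_share r o k (Y i w))).
have tE k : E (fun w => race_share r o k (Y i w)) = (t k)%:E.
  rewrite fineK// ge0_fin_numE//; apply: (@le_lt_trans _ _ delta%:E); last exact: ltry.
  by apply: le_trans tr_le; rewrite (bigD1 k)//= leeDl// sume_ge0.
have t_le : \sum_k t k <= delta.
  by rewrite -lee_fin -sumEFin; under eq_bigr do rewrite -tE.
have step3 k : E (fun w => rho * F k (Y i w)) = (rho * (delta +
    Dx^-1 * (mean_ratio_sq Q N r o + (1 + 2 * M) * mean_recip_sq Q N r o) + 4 * M * t k))%:E.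
  have m2 : measurable_fun setT (fun w => (1 + 2 * M) *
      (lam (Y i w) k * recip_sq o (others k (Y i w)))).
    by apply: measurable_funM => //; exact: mlh.
  have m32 := measurable_funD (mlh k _ mh3) m2.
  have m32' := measurable_funM (@measurable_cst _ _ T R setT Dx^-1) m32.
  have m132 := measurable_funD (mlh k _ mh1) m32'.
  have m4 := measurable_funM (@measurable_cst _ _ T R setT (4 * M)) (mtr k).
  have i3 := integral_lam_others W mr r0 Er i k (unit_valued_ratio_sq o1).
  have i2 := integral_lam_others W mr r0 Er i k (unit_valued_recip_sq o1).
  have i1 := integral_lam_others W mr r0 Er i k (unit_valued_recip o1).
  have i2' := ge0_integralM_EFin P M21 (fun w => l2 k (Y i w)) (mlh k _ mh2).
  have i32 := ge0_integralD_EFin P (fun w => l3 k (Y i w)) (mlh k _ mh3)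
    (fun w => l2' k (Y i w)) m2.
  have i32' := ge0_integralM_EFin P Dx1 (fun w => l32 k (Y i w)) m32.
  have i132 := ge0_integralD_EFin P (fun w => l1 k (Y i w)) (mlh k _ mh1)
    (fun w => l32' k (Y i w)) m32'.
  have i4 := ge0_integralM_EFin P M4 (fun w => tr0 k (Y i w)) (mtr k).
  have iF := ge0_integralD_EFin P (fun w => l132 k (Y i w)) m132
    (fun w => l4 k (Y i w)) m4.
  have iR := ge0_integralM_EFin P (ltW rho_gt0) (fun w => F0 k (Y i w))
    (measurable_funD m132 m4).
  by rewrite iR iF i132 i32' i32 i2' i4 i1 i2 i3 tE.
apply: (@le_trans _ _ (\sum_(k < N) (rho * (delta +
    Dx^-1 * (mean_ratio_sq Q N r o + (1 + 2 * M) * mean_recip_sq Q N r o) + 4 * M * t k))%:E)%E).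
  apply: lee_sum => k _; apply: (le_trans (step1 k)); rewrite -step3.
  apply: le_lower_integral => w; rewrite lee_fin; last exact: step2.
  by rewrite mulr_ge0// ltW// rho_gt0.
rewrite sumEFin lee_fin -mulr_sumr big_split/= sumr_const card_ord -mulr_sumr.
rewrite -[X in X + _]mulr_natl -N_delta_rho.
have q3 := mean_recip_sq_le W N_gt0 mr r0 Er o1 ro.
have p4 := mean_ratio_sq_le4 W N_gt0 mr r0 Er o1.
have -> : 15 * (N%:R * delta * rho) = rho * (15 * (N%:R * delta)) by ring.
rewrite ler_wpM2l ?(ltW rho_gt0)//.
have -> : N%:R * (delta + Dx^-1 * (mean_ratio_sq Q N r o + (1 + 2 * M) * mean_recip_sq Q N r o)) =
    N%:R * delta + (mean_ratio_sq Q N r o + (1 + 2 * M) * mean_recip_sq Q N r o) / delta.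
  by rewrite /Dx; field; rewrite !gt_eqF//; move: NR; lra.
have : (mean_ratio_sq Q N r o + (1 + 2 * M) * mean_recip_sq Q N r o) / delta <= 10 * (N%:R * delta).
  rewrite ler_pdivrMr//; have -> : 10 * (N%:R * delta) * delta =
    4 * N%:R * delta ^+ 2 + 2 * N%:R * (3 * delta ^+ 2) by ring.
  apply: lerD => //; apply: ler_pM => //; first exact: (mean_recip_sq_ge0 W N_gt0 mr o1).
  by rewrite /M; lra.
have : 4 * M * \sum_k t k <= 4 * (N%:R * delta).
  rewrite -mulrA; apply: ler_wpM2l => //; apply: ler_pM => //.
    by apply: sumr_ge0 => k _; rewrite fine_ge0.
  by rewrite /M; lra.
lra.
Qed.

End batch_bounds.

(** * Sequences of batches *)

Section batches.
Context d d' (T : measurableType d) (TY : measurableType d') (R : realType).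
Variables (P : probability T R) (Q : probability TY R) (N : nat).
Variable W : common_randomness P Q N.

Notation space J := (sub_space (Fsys W) J).
Notation index := ((nat * 'I_N) + (nat * 'I_N) + nat)%type.
Notation Bty := (N.-tuple TY * N.-tuple R * R)%type.
Local Notation E f := (\int[P]_w (f w)%:E)%E.

Definition Bt i (w : T) : Bty := (Yt W i w, St W i w, cU W i w).

Definition batch_of (x : index) : nat :=
  match x with inl (inl p) => p.1 | inl (inr p) => p.1 | inr i => i end.

Lemma measurable_Bt (J : set index) i : (forall x, batch_of x = i -> J x) ->
  measurable_fun setT (Bt i : space J -> Bty).
Proof.
move=> Ji; apply: measurable_fun_pair; last by apply: measurable_U; exact: Ji.
apply: measurable_fun_pair.
  by apply: measurable_Yt => j; exact: Ji.
by apply: measurable_St => j; exact: Ji.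
Qed.

Lemma measurable_BtT i : measurable_fun setT (Bt i).
Proof.
by apply: (@space_measurable_fun _ _ _ _ _ _ _ _ W setT); exact: measurable_Bt.
Qed.

Lemma integral_prod_batches n (F : nat -> Bty -> R) :
  (forall l b, 0 <= F l b) -> (forall l, measurable_fun setT (F l)) ->
  (E (fun w => (\prod_(l < n) F l (Bt l w))%R) = \prod_(l < n) E (fun w => F l (Bt l w)))%E.
Proof.
move=> F0 mF; elim: n => [|n IH].
  under eq_integral do rewrite big_ord0.
  by rewrite big_ord0 integral_cst//= probability_setT mule1.
under eq_integral do rewrite big_ord_recr/=.
rewrite big_ord_recr/= -IH.
pose J1 : set index := [set x | (batch_of x < n)%N].
pose J2 : set index := [set x | batch_of x = n].
pose A w := \prod_(l < n) F l (Bt l w).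
have A0 w : 0 <= A w by exact: prodr_ge0.
have mA J : J1 `<=` J -> measurable_fun setT (A : space J -> R).
  move=> J1J; apply: measurable_prod => l _.
  by apply: (measurableT_comp (mF l)); apply: measurable_Bt => x xl; apply: J1J; rewrite /J1/= xl.
have mAT : measurable_fun setT A.
  by apply: (@space_measurable_fun _ _ _ _ _ _ _ _ W setT); exact: mA.
(* [freeze_rv] wants a function that is nonnegative on all of R; A is nonnegative, so the absolute
   value changes nothing. *)
transitivity (\int[P]_w (`|A w| * F n (Bt n w))%:E)%E.
  by apply: eq_integral => w _; rewrite ger0_norm.
rewrite (@freeze_rv _ _ _ _ _ _ _ _ W J1 J2 _ _ _ _ A (Bt n)
  (fun a b => (`|a| * F n b)%:E)); last 5 first.
- by apply/seteqP; split => // x; rewrite /J1 /J2 /= => -[] /[swap] ->; rewrite ltnn.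
- exact: mA.
- exact: measurable_Bt.
- by move=> a b; rewrite lee_fin mulr_ge0.
- apply/measurable_EFinP; apply: measurable_funM.
    exact: (measurableT_comp (@normr_measurable R setT) measurable_fst).
  exact: (measurableT_comp (mF n) measurable_snd).
have mFn : measurable_fun setT (fun w => F n (Bt n w)).
  exact: (measurableT_comp (mF n) (measurable_BtT n)).
have I0 : (0 <= E (fun w => F n (Bt n w)))%E.
  by apply: integral_ge0 => w _; rewrite lee_fin.
transitivity (\int[P]_w ((A w)%:E * E (fun w => F n (Bt n w))))%E.
  by apply: eq_integral => w _; rewrite ger0_norm// ge0_integralM_EFin.
rewrite ge0_integralZr//; first exact/measurable_EFinP.
by move=> w _; rewrite lee_fin.
Qed.

(** Batch i is frozen, and the other batches, which may be compared with its U, are integrated out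
    independently. The factor l = i is set to 1 because H already accounts for that batch. *)
Lemma frozen_batches n i (H : Bty -> R) (G : nat -> Bty -> R -> R) (C : R -> R) :
  (forall b, 0 <= H b) -> measurable_fun setT H ->
  (forall l b u, 0 <= G l b u) ->
  (forall l, measurable_fun setT (fun z : Bty * R => G l z.1 z.2)) ->
  (forall u, \prod_(l < n) E (fun w => if (l == i :> nat) then 1%R else G l (Bt l w) u)
     <= (C u)%:E)%E ->
  (E (fun w => H (Bt i w) *
     \prod_(l < n) (if (l == i :> nat) then 1 else G l (Bt l w) (cU W i w))) <=
   E (fun w => H (Bt i w) * C (cU W i w)))%E.
Proof.
move=> H0 mH G0 mG GC.
pose J1 : set index := [set x | batch_of x = i].
pose J2 : set index := [set x | batch_of x != i].
pose G' l b u := if (l == i) then 1 else G l b u.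
have G'0 l b u : 0 <= G' l b u by rewrite /G'; case: (eqVneq l i).
have mG' l : measurable_fun setT (fun z : Bty * R => G' l z.1 z.2).
  by rewrite /G'; have [_|_] := eqVneq l i; [exact: measurable_cst|exact: mG].
have mGu l u : measurable_fun setT (fun b => G' l b u).
  exact: (measurableT_comp (mG' l) (measurable_pair2 u)).
rewrite (@freeze _ _ _ _ _ _ _ _ W J1 J2
  (fun w v => (H (Bt i w) * \prod_(l < n) G' l (Bt l v) (cU W i w))%:E)); last 3 first.
- by apply/seteqP; split => // x; rewrite /J1 /J2 /= => -[-> /eqP].
- by move=> w v; rewrite lee_fin mulr_ge0// prodr_ge0.
- apply/measurable_EFinP; apply: measurable_funM.
    apply: (measurableT_comp mH).
    have mB : measurable_fun setT (Bt i : space J1 -> Bty) by exact: measurable_Bt.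
    exact: (measurableT_comp mB measurable_fst).
  apply: measurable_prod => l _; rewrite /G'.
  have [_|li] := eqVneq (l : nat) i; first exact: measurable_cst.
  have mB : measurable_fun setT (Bt l : space J2 -> Bty).
    by apply: measurable_Bt => x xl; rewrite /J2/= xl.
  have mU : measurable_fun setT (cU W i : space J1 -> R) by exact: measurable_U.
  exact: (measurableT_comp (mG l) (measurable_fun_pair
    (measurableT_comp mB measurable_snd) (measurableT_comp mU measurable_fst))).
apply: le_lower_integral => w.
  rewrite lee_fin mulr_ge0// -lee_fin; apply: le_trans (GC (cU W i w)).
  apply: prode_ge0 => l _; apply: integral_ge0 => v _; rewrite lee_fin.
  by case: (eqVneq (l : nat) i).
rewrite ge0_integralM_EFin//; last 2 first.
- by move=> v; exact: prodr_ge0.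
- apply: measurable_prod => l _.
  exact: (measurableT_comp (mGu l _) (measurable_BtT l)).
rewrite EFinM; apply: lee_wpmul2l; first by rewrite lee_fin.
rewrite (@integral_prod_batches n (fun l b => G' l b (cU W i w)))//.
exact: GC.
Qed.

End batches.

(** * The batch at which the search stops *)

Section stopping.
Context d d' (T : measurableType d) (TY : measurableType d') (R : realType).
Variables (P : probability T R) (Q : probability TY R) (N : nat).
Variable W : common_randomness P Q N.
Hypothesis N_gt0 : (0 < N)%N.
Variables (r : TY -> R) (mr : measurable_fun setT r) (r0 : forall y, 0 <= r y).
Hypothesis Er : (\int[Q]_y (r y)%:E = 1)%E.
Variables (o om : R) (o1 : 1 <= o) (ro : forall y, r y <= o) (oom : o <= om).

Notation Bty := (N.-tuple TY * N.-tuple R * R)%type.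
Local Notation E f := (\int[P]_w (f w)%:E)%E.
Local Notation D := (@accept_rate R N om).
Local Notation accepts := (@accepts _ TY R Q N r o om).

Definition rej (b : Bty) : R := @rejected _ TY R Q N r o om b.1.1 b.1.2 b.2.

Let D0 : 0 < D. Proof. exact: (D_gt0 N_gt0 o1 oom). Qed.

Lemma D_le1 : D <= 1.
Proof.
have N1 : (1 : R) <= N%:R by rewrite ler1n.
by rewrite ler_pdivrMr ?mul1r; move: o1 oom; lra.
Qed.

Lemma rej_ge0 b : 0 <= rej b. Proof. exact: rejected_ge0. Qed.

Lemma measurable_rej : measurable_fun setT rej.
Proof.
apply: measurable_funD.
  apply: measurable_bool_natr; apply: measurable_fun_eqr => //.
  exact: (measurableT_comp (measurable_Zsum mr)
    (measurableT_comp measurable_fst measurable_fst)).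
apply: measurable_sum => k; apply: measurable_bool_natr; apply: measurable_and.
  exact: (measurableT_comp (measurable_wins mr k) measurable_fst).
apply: measurable_fun_ltr => //.
exact: (measurableT_comp (measurable_threshold Q mr o om k)
  (measurableT_comp measurable_fst measurable_fst)).
Qed.

Let mU i : measurable_fun setT (cU W i). Proof. exact: measurable_UT. Qed.

Lemma E_rej i : (E (fun w => rej (Bt W i w)) <= (1 - D)%:E)%E.
Proof.
have := @reject_bound _ _ _ _ _ _ _ _ W N_gt0 r mr r0 Er o om o1 ro oom i xpredT 1
  ler01 (measurable_cst true).
under eq_integral do rewrite mulr1.
rewrite mulr1; apply.
  by rewrite (_ : [set _ | _] = setT) ?probability_setT//; apply/seteqP; split.
move=> t t01; rewrite mulr1.
rewrite (_ : [set v | _] = cU W i @^-1` `]t, +oo[%classic); last first.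
  by apply/seteqP; split => v; rewrite /= in_itv/= !andbT.
rewrite -[P _]/(distribution P (cU W i) `]t, +oo[%classic) cU_law//.
exact: uniform_prob_gt.
Qed.

Lemma prob_U_le i u : (P [set w | (cU W i w <= u)%R] <= (Num.max u 0)%:E)%E.
Proof.
rewrite (_ : [set v | _] = cU W i @^-1` `]-oo, u]%classic); last first.
  by apply/seteqP; split => v; rewrite /= in_itv.
have [u1|u1] := leP u 1; last first.
  apply: (@le_trans _ _ 1%E); last by rewrite lee_fin le_max ltW.
  by apply: probability_le1; rewrite -[X in measurable X]setTI; exact: mU.
rewrite -[P _]/(distribution P (cU W i) `]-oo, u]%classic) cU_law//.
have m01 : 0 <= Num.max u 0 <= 1 by rewrite le_max lexx orbT ge_max u1 ler01.
apply: le_trans (uniform_prob_le m01).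
rewrite -!(cU_law W i)//; apply: le_measure; rewrite ?inE//.
by move=> x /=; rewrite !in_itv/= => /le_trans; apply; rewrite le_max lexx.
Qed.

Lemma E_rej_below i u :
  (E (fun w => rej (Bt W i w) * (cU W i w <= u)%R%:R) <= ((1 - D) * Num.max u 0)%:E)%E.
Proof.
apply: (@reject_bound _ _ _ _ _ _ _ _ W N_gt0 r mr r0 Er o om o1 ro oom i
  (fun v => v <= u) (Num.max u 0)).
- by rewrite le_max lexx orbT.
- exact: measurable_fun_ler.
- exact: prob_U_le.
- move=> t t01; rewrite (_ : [set v | _] = cU W i @^-1` `]t, u]%classic); last first.
    by apply/seteqP; split => v; rewrite /= in_itv.
  rewrite -[P _]/(distribution P (cU W i) `]t, u]%classic) cU_law//.
  exact: uniform_prob_oc.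
Qed.

Lemma prod_rej n : (E (fun w => \prod_(l < n) rej (Bt W l w)) <= ((1 - D) ^+ n)%:E)%E.
Proof.
rewrite (@integral_prod_batches _ _ _ _ _ _ _ _ W n (fun=> rej)).
- have -> : ((1 - D) ^+ n)%:E = (\prod_(l < n) (1 - D)%:E)%E.
    by rewrite prodEFin prodr_const card_ord.
  apply: lee_prod_nneg => l _; last exact: E_rej.
  by apply: integral_ge0 => w _; rewrite lee_fin rej_ge0.
- by move=> _; exact: rej_ge0.
- by move=> _; exact: measurable_rej.
Qed.

Lemma prod_rej_then i (H : Bty -> R) :
  (forall b, 0 <= H b) -> measurable_fun setT H ->
  (E (fun w => H (Bt W i w) * \prod_(l < i) rej (Bt W l w)) <=
   E (fun w => H (Bt W i w) * (1 - D) ^+ i))%E.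
Proof.
move=> H0 mH.
have -> : E (fun w => H (Bt W i w) * \prod_(l < i) rej (Bt W l w)) =
  E (fun w => H (Bt W i w) * \prod_(l < i)
      (if (l == i :> nat) then 1 else rej (Bt W l w))).
  apply: eq_integral => w _; congr (_ * _)%:E; apply: eq_bigr => l _.
  by rewrite ltn_eqF.
apply: (@frozen_batches _ _ _ _ _ _ _ _ W i i H (fun _ b _ => rej b)
  (fun=> (1 - D) ^+ i)) => //.
- by move=> *; exact: rej_ge0.
- by move=> l; exact: (measurableT_comp measurable_rej measurable_fst).
- move=> u; apply: le_trans (prod_rej i).
  rewrite (@integral_prod_batches _ _ _ _ _ _ _ _ W i (fun=> rej))//.
    apply: lee_prod_nneg => l _; rewrite ltn_eqF//.
    by apply: integral_ge0 => w _; rewrite lee_fin rej_ge0.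
  + by move=> _; exact: rej_ge0.
  + by move=> _; exact: measurable_rej.
Qed.

(** If l' comes before i, its factor is a rejection with U below a given value, bounded by
    [E_rej_below]; if it comes after i, it is unconstrained. Either way the comparison costs a
    factor U_i. *)
Lemma prod_rej_below i l' (H : Bty -> R) : l' != i ->
  (forall b, 0 <= H b) -> measurable_fun setT H ->
  (E (fun w => H (Bt W i w) * ((\prod_(l < i) rej (Bt W l w)) *
      (cU W l' w <= cU W i w)%R%:R)) <=
   E (fun w => H (Bt W i w) * ((1 - D) ^+ i * Num.max (cU W i w) 0)))%E.
Proof.
move=> l'i H0 mH.
(* Large enough to contain both i and l', in whichever order they come. *)
pose n := (maxn i l').+1.
pose G (l : nat) (b : Bty) (u : R) :=
  (if (l < i)%N then rej b else 1) * (if l == l' then (b.2 <= u)%R%:R else 1).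
have iln : (i <= n)%N by rewrite /n ltnW// ltnS leq_maxl.
have l'n : (l' < n)%N by rewrite /n ltnS leq_maxr.
have prodi (a : R) (f : nat -> R) :
    \prod_(l < n) (if (l == i :> nat) then 1 else
      (if (l < i)%N then f l else 1) * (if l == l' :> nat then a else 1)) =
    (\prod_(l < i) f l) * a.
  transitivity (\prod_(l < n) ((if (l < i)%N then f l else 1) *
      (if l == l' :> nat then a else 1))).
    apply: eq_bigr => l _; have [->|//] := eqVneq (l : nat) i.
    by rewrite ltnn (negbTE (_ : i != l'))// ?mulr1// eq_sym.
  rewrite big_split/=; congr (_ * _).
    by rewrite -big_mkcond/= (big_ord_widen n f iln).
  rewrite -big_mkcond/= (big_pred1 (Ordinal l'n))//.
have -> : E (fun w => H (Bt W i w) * ((\prod_(l < i) rej (Bt W l w)) *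
      (cU W l' w <= cU W i w)%R%:R)) =
  E (fun w => H (Bt W i w) * \prod_(l < n)
      (if (l == i :> nat) then 1 else G l (Bt W l w) (cU W i w))).
  apply: eq_integral => w _; congr (_ * _)%:E.
  rewrite -(prodi ((cU W l' w <= cU W i w)%R%:R) (fun l => rej (Bt W l w))).
  apply: eq_bigr => l _; rewrite /G; case: (eqVneq (l : nat) i) => // _.
  by case: (eqVneq (l : nat) l') => // ->.
apply: (@frozen_batches _ _ _ _ _ _ _ _ W n i H G
  (fun u => (1 - D) ^+ i * Num.max u 0)) => //.
- move=> l b u; rewrite /G mulr_ge0//; first by case: ifP => // _; exact: rej_ge0.
  by case: ifP.
- move=> l; apply: measurable_funM.
    case: (l < i)%N; last exact: measurable_cst.
    exact: (measurableT_comp measurable_rej measurable_fst).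
  case: (l == l'); last exact: measurable_cst.
  apply: measurable_bool_natr; apply: measurable_fun_ler => //.
  exact: (measurableT_comp measurable_snd measurable_fst).
- move=> u; have u0 : 0 <= Num.max u 0 by rewrite le_max lexx orbT.
  have D1 : 0 <= 1 - D by rewrite subr_ge0 D_le1.
  have -> : (1 - D) ^+ i = \prod_(l < i) (1 - D) by rewrite prodr_const card_ord.
  rewrite -(prodi (Num.max u 0) (fun=> 1 - D)) -prodEFin.
  apply: lee_prod_nneg => l _.
    apply: integral_ge0 => w _; rewrite lee_fin; case: ifP => // _.
    rewrite /G mulr_ge0//; first by case: ifP => // _; exact: rej_ge0.
    by case: ifP.
  have [_|_] := eqVneq (l : nat) i.
    by rewrite integral_cst//= probability_setT mule1.
  rewrite /G; case: ifP => _; case: ifP => _.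
  + exact: E_rej_below.
  + by under eq_integral do rewrite mulr1; rewrite mulr1; exact: E_rej.
  + under eq_integral do rewrite mul1r.
    rewrite mul1r integral_bool//; first exact: prob_U_le.
    exact: measurable_fun_ler.
  + under eq_integral do rewrite mul1r.
    by rewrite mul1r integral_cst//= probability_setT mule1.
Qed.

(** A sum over candidates because ties are possible; when a regular outcome accepts, the chosen
    candidate is one of its terms. *)
Definition accept_sum (f : TY -> R) (b : Bty) : R :=
  \sum_k (accepts k b.1.1 b.1.2 b.2)%:R * f (tnth b.1.1 k).

Definition accept_rank (b : Bty) : R :=
  \sum_k (accepts k b.1.1 b.1.2 b.2)%:R * local_rank k b.1.2 / (1 + lam r b.1.1 k).

Lemma local_rank_ge0 k (s : N.-tuple R) : 0 <= local_rank k s.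
Proof. by rewrite addr_ge0// sumr_ge0. Qed.

Lemma accept_sum_ge0 f b : (forall y, 0 <= f y) -> 0 <= accept_sum f b.
Proof. by move=> f0; apply: sumr_ge0 => k _; rewrite mulr_ge0. Qed.

Lemma accept_rank_ge0 b : 0 <= accept_rank b.
Proof.
apply: sumr_ge0 => k _; rewrite divr_ge0// ?mulr_ge0// ?local_rank_ge0//.
by rewrite addr_ge0// lam_ge0.
Qed.

Lemma measurable_accepts_b k : measurable_fun setT
  (fun b : Bty => (accepts k b.1.1 b.1.2 b.2)%:R : R).
Proof.
apply: measurable_bool_natr; apply: measurable_and.
  exact: (measurableT_comp (measurable_wins mr k) measurable_fst).
apply: measurable_fun_ler => //.
exact: (measurableT_comp (measurable_threshold Q mr o om k)
  (measurableT_comp measurable_fst measurable_fst)).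
Qed.

Lemma measurable_accept_sum f : measurable_fun setT f ->
  measurable_fun setT (accept_sum f).
Proof.
move=> mf; apply: measurable_sum => k; apply: measurable_funM.
  exact: measurable_accepts_b.
exact: (measurableT_comp mf (measurableT_comp (measurable_tnth k)
  (measurableT_comp measurable_fst measurable_fst))).
Qed.

Lemma measurable_accept_rank : measurable_fun setT accept_rank.
Proof.
apply: measurable_sum => k; apply: measurable_fun_div.
  apply: measurable_funM; first exact: measurable_accepts_b.
  apply: measurable_funD => //; apply: measurable_sum_cond => j.
  apply: measurable_bool_natr; apply: measurable_fun_ler.
    exact: (measurableT_comp (measurable_tnth j)
      (measurableT_comp measurable_snd measurable_fst)).
  exact: (measurableT_comp (measurable_tnth k)
      (measurableT_comp measurable_snd measurable_fst)).
apply: measurable_funD => //.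
exact: (measurableT_comp (measurable_lam mr k)
  (measurableT_comp measurable_fst measurable_fst)).
Qed.

Variable s : nat -> seq nat.

(** [s i] will be the group of batch i; the leading 1 counts batch i itself. *)
Definition group_rank i w : R :=
  1 + \sum_(l <- s i | l != i) (cU W l w <= cU W i w)%R%:R.

Lemma group_rank_ge0 i w : 0 <= group_rank i w.
Proof. by rewrite addr_ge0// sumr_ge0. Qed.

(** The first i rejections weigh (1 - D)^i and acceptance at i weighs D. Each other batch of the
    group has its U below U_i with conditional probability at most U_i, which produces the factor 1
    + c U_i of [accept_ranks]; its 15 is divided by 8. *)
Lemma stop_at i (f : TY -> R) (lf : R) :
  (count (fun l => l != i) (s i))%:R * D <= 1 ->
  (forall y, 0 <= f y) -> measurable_fun setT f ->
  (\int[Q]_y (r y * f y)%:E <= lf%:E)%E ->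
  (E (fun w => (\prod_(l < i) rej (Bt W l w)) *
      (accept_sum f (Bt W i w) + group_rank i w * accept_rank (Bt W i w) / 8)) <=
   ((1 - D) ^+ i * (D * (lf + 15 / 8)))%:E)%E.
Proof.
move=> sD f0 mf lfE.
pose pr w := \prod_(l < i) rej (Bt W l w).
have pr0 w : 0 <= pr w by apply: prodr_ge0 => l _; exact: rej_ge0.
have mBt l : measurable_fun setT (Bt W l) by exact: measurable_BtT.
have mpr : measurable_fun setT pr.
  by apply: measurable_prod => l _; exact: (measurableT_comp measurable_rej (mBt l)).
pose q := (1 - D) ^+ i.
have q0 : 0 <= q by rewrite exprn_ge0// subr_ge0 D_le1.
have mas : measurable_fun setT (fun w => accept_sum f (Bt W i w)).
  exact: (measurableT_comp (measurable_accept_sum mf) (mBt i)).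
have mar : measurable_fun setT (fun w => accept_rank (Bt W i w)).
  exact: (measurableT_comp measurable_accept_rank (mBt i)).
have mgl l : measurable_fun setT (fun w => (cU W l w <= cU W i w)%R%:R : R).
  by apply: measurable_bool_natr; exact: measurable_fun_ler.
have AS := accept_sum_ge0 _ f0; have AR := accept_rank_ge0.
have sp w : pr w * (accept_sum f (Bt W i w) + group_rank i w * accept_rank (Bt W i w) / 8) =
    accept_sum f (Bt W i w) * pr w + 8^-1 * (accept_rank (Bt W i w) * pr w +
    \sum_(l <- s i | l != i) accept_rank (Bt W i w) * (pr w * (cU W l w <= cU W i w)%R%:R)).
  rewrite -!mulr_sumr /group_rank; ring.
under eq_integral do rewrite sp.
have t10 w : 0 <= accept_sum f (Bt W i w) * pr w by rewrite mulr_ge0.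
have t20 w : 0 <= accept_rank (Bt W i w) * pr w by rewrite mulr_ge0.
have t3l0 l w : 0 <= accept_rank (Bt W i w) * (pr w * (cU W l w <= cU W i w)%R%:R).
  by rewrite mulr_ge0// mulr_ge0.
have t30 w : 0 <= \sum_(l <- s i | l != i)
    accept_rank (Bt W i w) * (pr w * (cU W l w <= cU W i w)%R%:R).
  by apply: sumr_ge0.
have m1 := measurable_funM mas mpr; have m2 := measurable_funM mar mpr.
have m3l l := measurable_funM mar (measurable_funM mpr (mgl l)).
have m3 : measurable_fun setT (fun w => \sum_(l <- s i | l != i)
    accept_rank (Bt W i w) * (pr w * (cU W l w <= cU W i w)%R%:R)).
  exact: measurable_sum_cond.
rewrite ge0_integralD_EFin//; last 2 first.
- by move=> w; rewrite mulr_ge0// addr_ge0.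
- by apply: measurable_funM => //; exact: measurable_funD.
rewrite (ge0_integralM_EFin P (c := 8^-1))//; last 2 first.
- by move=> w; rewrite addr_ge0.
- exact: measurable_funD.
rewrite ge0_integralD_EFin// ge0_integral_sum_EFin//.
have b1 : (E (fun w => accept_sum f (Bt W i w) * pr w) <= (q * (D * lf))%:E)%E.
  apply: le_trans (prod_rej_then i AS (measurable_accept_sum mf)) _.
  under eq_integral do rewrite mulrC.
  rewrite ge0_integralM_EFin// EFinM; apply: lee_wpmul2l; first by rewrite lee_fin.
  apply: le_trans (accept_mean W N_gt0 mr r0 Er o1 ro oom i f0 mf) _.
  by rewrite [leRHS]EFinM; apply: lee_wpmul2l => //; rewrite lee_fin ltW.
pose c : R := (count (fun l => l != i) (s i))%:R.
pose mx w : R := Num.max (cU W i w) 0.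
have mx0 w : 0 <= mx w by rewrite /mx le_max lexx orbT.
have mmx : measurable_fun setT mx by apply: measurable_maxr => //; exact: mU.
have b2 : (E (fun w => accept_rank (Bt W i w) * pr w) +
    \sum_(l <- s i | l != i) E (fun w =>
      accept_rank (Bt W i w) * (pr w * (cU W l w <= cU W i w)%R%:R)) <=
    (q * (15 * D))%:E)%E.
  apply: (@le_trans _ _ (E (fun w => q * accept_rank (Bt W i w)) +
      \sum_(l <- s i | l != i) E (fun w => q * (accept_rank (Bt W i w) * mx w)))%E).
    apply: leeD.
      apply: le_trans (prod_rej_then i AR measurable_accept_rank) _.
      by under eq_integral do rewrite mulrC.
    apply: lee_sum => l li.
    apply: le_trans (prod_rej_below li AR measurable_accept_rank) _.
    by under eq_integral do rewrite mulrCA.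
  rewrite -ge0_integral_sum_EFin//; last 2 first.
  - by move=> l w; rewrite mulr_ge0// mulr_ge0.
  - by move=> l; apply: measurable_funM => //; exact: measurable_funM.
  rewrite -ge0_integralD_EFin//; last 4 first.
  - by move=> w; rewrite mulr_ge0.
  - exact: measurable_funM.
  - by move=> w; apply: sumr_ge0 => l _; rewrite mulr_ge0// mulr_ge0.
  - apply: measurable_sum_cond => l; apply: measurable_funM => //.
    exact: measurable_funM.
  have -> : E (fun w => q * accept_rank (Bt W i w) +
      \sum_(l <- s i | l != i) q * (accept_rank (Bt W i w) * mx w)) =
    E (fun w => q * ((1 + c * mx w) * accept_rank (Bt W i w))).
    apply: eq_integral => w _; congr EFin.
    rewrite big_const_seq iter_addr addr0 -mulr_natl -/c; ring.
  have c0 : 0 <= c by [].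
  have g0 w : 0 <= (1 + c * mx w) * accept_rank (Bt W i w).
    by rewrite mulr_ge0// addr_ge0// mulr_ge0.
  rewrite ge0_integralM_EFin//; last first.
    by apply: measurable_funM => //; apply: measurable_funD => //; exact: measurable_funM.
  rewrite EFinM; apply: lee_wpmul2l; first by rewrite lee_fin.
  exact: (accept_ranks W N_gt0 mr r0 Er o1 ro oom).
have -> : q * (D * (lf + 15 / 8)) = q * (D * lf) + 8^-1 * (q * (15 * D)) by ring.
rewrite EFinD; apply: leeD => //; rewrite EFinM; apply: lee_wpmul2l => //.
Qed.

End stopping.

(** * Ensemble rejection sampling *)

Section channel_facts.
Context d d' (TX : measurableType d) (TY : measurableType d') (R : realType).
Variables (C : channel TX TY R) (omega : R).
Hypothesis bounding : extended_bounding C omega.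

Lemma ratio_divE x y : ratio C x y = pYX C x y / pY C y.
Proof.
rewrite /ratio /eratio; have [->|p0] := eqVneq (pY C y) 0; last first.
  by rewrite inver (negbTE p0).
rewrite inver eqxx invr0 mulr0; have [->|q0] := eqVneq (pYX C x y) 0.
  by rewrite mul0e.
by rewrite gt0_muley// lte_fin lt_neqAle eq_sym q0 pYX_ge0.
Qed.

Lemma eratio_le x y : (eratio C x y <= omega%:E)%E.
Proof.
apply: le_trans bounding; apply: ereal_sup_ubound; exists (x, y) => //.
Qed.

(** The bounding condition excludes the value +oo, so [pYX C x] vanishes wherever [pY C] does. *)
Lemma eratioE x y : eratio C x y = (ratio C x y)%:E.
Proof.
have := eratio_le x y; rewrite ratio_divE /eratio.
have [->|p0] := eqVneq (pY C y) 0; last by rewrite inver (negbTE p0).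
rewrite inver eqxx invr0 mulr0; have [->|q0] := eqVneq (pYX C x y) 0.
  by rewrite mul0e.
by rewrite gt0_muley// lte_fin lt_neqAle eq_sym q0 pYX_ge0.
Qed.

Lemma ratio_ge0 x y : 0 <= ratio C x y.
Proof. by rewrite ratio_divE divr_ge0 ?pYX_ge0 ?pY_ge0. Qed.

Lemma ratio_pY x y : ratio C x y * pY C y = pYX C x y.
Proof.
have := eratioE x y; rewrite ratio_divE /eratio.
have [->|p0] := eqVneq (pY C y) 0; last by rewrite divfK.
rewrite inver eqxx invr0 mulr0 mul0r; have [->//|q0] := eqVneq (pYX C x y) 0.
by rewrite gt0_muley// lte_fin lt_neqAle eq_sym q0 pYX_ge0.
Qed.

Lemma measurable_ratio : measurable_fun setT (fun z : TX * TY => ratio C z.1 z.2).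
Proof.
under eq_fun do rewrite ratio_divE.
apply: measurable_fun_div; first exact: pYX_measurable.
exact: (measurableT_comp (pY_measurable C) measurable_snd).
Qed.

Lemma measurable_ratio_x x : measurable_fun setT (ratio C x).
Proof. exact: (measurableT_comp measurable_ratio (measurable_pair1 x)). Qed.

(** Boundedness makes P_x absolutely continuous with respect to P_Y, with density [ratio C x]. *)
Lemma integral_ratio x (f : TY -> R) : (forall y, 0 <= f y) ->
  measurable_fun setT f ->
  (\int[PY C]_y (ratio C x y * f y)%:E = \int[ref C]_y (pYX C x y * f y)%:E)%E.
Proof.
move=> f0 mf.
rewrite (@ge0_integral_density _ _ _ (ref C) (PY C) (pY C)).
- by apply: eq_integral => y _; rewrite -EFinM -ratio_pY mulrAC.
- exact: pY_ge0.
- exact: pY_measurable.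
- exact: pY_density.
- by move=> y; rewrite lee_fin mulr_ge0// ratio_ge0.
- by apply/measurable_EFinP; apply: measurable_funM => //; exact: measurable_ratio_x.
Qed.

Lemma integral_ratio1 x : (\int[PY C]_y (ratio C x y)%:E = 1)%E.
Proof.
have := @integral_ratio x (fun=> 1) (fun=> ler01) (measurable_cst _).
under eq_integral do rewrite mulr1; under [in RHS]eq_integral do rewrite mulr1.
by move=> ->; exact: pYX_prob.
Qed.

Lemma omega_ofE x : ereal_sup (range (eratio C x)) = (omega_of C x)%:E.
Proof.
rewrite /omega_of fineK//.
(* A space that carries a probability is not empty, so the supremum is not -oo. *)
have [y0 _] : exists y : TY, True.
  apply: contrapT => H; have := probability_setT (PY C).
  rewrite (_ : setT = set0) ?measure0; last first.
    by apply/seteqP; split => // y _; apply: H; exists y.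
  by move/eqP; rewrite eqe eq_sym oner_eq0.
rewrite fin_numElt; apply/andP; split.
  apply: (@lt_le_trans _ _ (eratio C x y0)).
    by rewrite eratioE ltNyr.
  by apply: ereal_sup_ubound; exists y0.
apply: (@le_lt_trans _ _ omega%:E); last exact: ltry.
by apply: ge_ereal_sup => _ [y _ <-]; exact: eratio_le.
Qed.

Lemma ratio_le x y : ratio C x y <= omega_of C x.
Proof.
by rewrite -lee_fin -eratioE -omega_ofE; apply: ereal_sup_ubound; exists y.
Qed.

Lemma omega_of_le x : omega_of C x <= omega.
Proof.
rewrite -lee_fin -omega_ofE; apply: ge_ereal_sup => _ [y _ <-].
exact: eratio_le.
Qed.

Lemma omega_of_ge1 x : 1 <= omega_of C x.
Proof.
rewrite -lee_fin -(integral_ratio1 x).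
apply: (@le_trans _ _ (\int[PY C]_y (omega_of C x)%:E)%E).
  apply: le_lower_integral => y; rewrite lee_fin ?ratio_le//.
  exact: le_trans (ratio_ge0 x y) (ratio_le x y).
by rewrite integral_cst//= probability_setT mule1.
Qed.

End channel_facts.

Section ers.
Context d d' d'' (TX : measurableType d) (TY : measurableType d')
  (T : measurableType d'') (R : realType).
Variables (C : channel TX TY R) (omega : R) (P : probability T R).
Variables (N : nat) (N_gt0 : (0 < N)%N) (W : common_randomness P (PY C) N).
Hypothesis bounding : extended_bounding C omega.
Variable x : TX.

Local Notation r := (ratio C x).
Local Notation o := (omega_of C x).
Local Notation D := (@accept_rate R N omega).
Local Notation rejx := (@rej _ TY R (PY C) N r o omega).
Local Notation accx := (@accepts _ TY R (PY C) N r o omega).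
Local Notation cand := (candidate N_gt0 W x).

Let mr : measurable_fun setT r. Proof. exact: measurable_ratio_x. Qed.
Let r0 y : 0 <= r y. Proof. exact: ratio_ge0. Qed.
Let Er : (\int[PY C]_y (r y)%:E = 1)%E. Proof. exact: (integral_ratio1 bounding). Qed.
Let o1 : 1 <= o. Proof. exact: (omega_of_ge1 bounding). Qed.
Let ro y : r y <= o. Proof. exact: (ratio_le bounding). Qed.
Let oom : o <= omega. Proof. exact: (omega_of_le bounding). Qed.

Lemma tnth_Yt i j w : tnth (Yt W i w) j = batch W w i j.
Proof. by rewrite tnth_mktuple. Qed.

Lemma ZhatE i w : Zhat C x (batch W w i) = Zsum r (Yt W i w).
Proof. by apply: eq_bigr => j _; rewrite /lam tnth_Yt. Qed.

Lemma ZbarE i w k : Zbar C x (batch W w i) k = others r k (Yt W i w) + o.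
Proof.
rewrite /Zbar ZhatE (Zsum_others r k) /lam tnth_Yt.
by rewrite [X in X - _ + _]addrC addrK.
Qed.

Lemma Delta_ofE : Delta_of N_gt0 W x = N%:R * delta (PY C) N r o.
Proof.
rewrite /Delta_of unlock.
have -> : (\int[P]_w (N%:R / Zbar C x (batch W w 0) (Ordinal N_gt0))%:E =
    \int[P]_w (N%:R * recip o (others r (Ordinal N_gt0) (Yt W 0 w)))%:E)%E.
  apply: eq_integral => w _; rewrite ZbarE /recip ger0_norm//.
  exact: others_ge0.
have [h10 _ mh1] := unit_valued_recip o1.
rewrite ge0_integralM_EFin//; last first.
  exact: (measurableT_comp mh1 (measurableT_comp (measurable_others mr _) (measurable_YtT W 0))).
by rewrite (mean_othersE W mr 0 _ (unit_valued_recip o1)) -EFinM.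
Qed.

Lemma accepted_thr i w : accepted omega N_gt0 W x w i =
  (cU W i w <= threshold (PY C) r o omega (cand w i) (Yt W i w)).
Proof. by rewrite /accepted ZhatE ZbarE Delta_ofE. Qed.

(** Positive S makes S / 0 equal to +oo; positive U prevents acceptance at threshold 0. *)
Definition regular w := (forall i j, 0 < cS W i j w) /\ (forall i, 0 < cU W i w).

Lemma candidate_min i w j :
  ((cS W i (cand w i) w)%:E / (r (batch W w i (cand w i)))%:E <=
   (cS W i j w)%:E / (r (batch W w i j))%:E)%E.
Proof.
rewrite -!(eratioE bounding) /candidate.
by case: Order.TotalTheory.arg_minP => // k _; apply.
Qed.

(** If the candidate has ratio 0, its quotient +oo is minimal, so every quotient is +oo and every
    ratio is 0. *)
Lemma candidate_race i w : regular w ->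
  if 0 < lam r (Yt W i w) (cand w i)
  then wins r (cand w i) (Yt W i w) (St W i w)
  else Zsum r (Yt W i w) == 0.
Proof.
move=> [S0 _]; have cm := candidate_min i w.
case: ifPn => [lk|lk].
  rewrite /wins lk/=; apply/forallP => j; rewrite /lam !tnth_mktuple.
  move: lk; rewrite /lam tnth_Yt => lk.
  have [lj|lj] := eqVneq (r (batch W w i j)) 0.
    by rewrite -/(batch W w i j) lj mulr0 mulr_ge0// ltW.
  have {}lj : 0 < r (batch W w i j) by rewrite lt_neqAle eq_sym lj r0.
  have := cm j; rewrite !inver !gt_eqF// lee_fin.
  by rewrite ler_pdivrMr// mulrAC ler_pdivlMr.
have lk0 : r (batch W w i (cand w i)) = 0.
  by apply/eqP; rewrite eq_le r0 andbT leNgt -tnth_Yt.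
apply/eqP; apply: big1 => j _; rewrite /lam tnth_Yt; apply/eqP; apply: contraT => lj.
have {}lj : 0 < r (batch W w i j) by rewrite lt_neqAle eq_sym lj r0.
have := cm j; rewrite lk0 !inver eqxx gt_eqF// gt0_muley ?lte_fin//.
Qed.

Lemma accepted_accepts i w : regular w -> accepted omega N_gt0 W x w i ->
  accx (cand w i) (Yt W i w) (St W i w) (cU W i w).
Proof.
move=> rw; have := candidate_race i rw; rewrite accepted_thr.
case: ifPn => [lk win uthr|lk /eqP Z0]; first by rewrite /accepts win.
(* Z = 0 makes the threshold 0, which a positive U cannot meet. *)
rewrite /threshold Z0 !mul0r => U0; case: rw => _ /(_ i).
by rewrite ltNge U0.
Qed.

Lemma rejected_rej i w : regular w -> ~~ accepted omega N_gt0 W x w i ->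
  1 <= rejx (Bt W i w).
Proof.
move=> rw; have := candidate_race i rw; rewrite accepted_thr -ltNge.
rewrite /rej /rejected/=; case: ifPn => [lk win uthr|lk -> _]; last first.
  by rewrite lerDl sumr_ge0.
rewrite (bigD1 (cand w i))//= win uthr/= addrCA lerDl addr_ge0//.
by rewrite sumr_ge0.
Qed.

End ers.

(** * The group message *)

Section log2_facts.
Context {R : realType}.
Implicit Types x y t : R.

Lemma ln_le_sub1 x : 0 < x -> ln x <= x - 1.
Proof.
move=> x0; have := @le_ln1Dx R (x - 1); rewrite [1 + _]addrC subrK; apply.
by lra.
Qed.

Lemma ln2_ge : (2^-1 : R) <= ln 2.
Proof.
have h : (0 : R) < 2^-1 by rewrite invr_gt0.
by have := ln_le_sub1 h; rewrite lnV ?posrE//; lra.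
Qed.

Lemma ln2_le1 : ln 2 <= (1 : R).
Proof. by have := @ln_le_sub1 2 (ltr0n _ 2); lra. Qed.

Lemma ln2_gt0 : 0 < ln (2 : R).
Proof. by apply: lt_le_trans ln2_ge; rewrite invr_gt0. Qed.

Lemma log2M x y : 0 < x -> 0 < y -> log2 (x * y) = log2 x + log2 y.
Proof. by move=> x0 y0; rewrite /log2 lnM ?posrE// mulrDl. Qed.

Lemma ler_log2 x y : 0 < x -> x <= y -> log2 x <= log2 y.
Proof.
move=> x0 xy; rewrite /log2 ler_wpM2r ?invr_ge0 ?(ltW ln2_gt0)//.
by rewrite ler_ln ?posrE// (lt_le_trans x0).
Qed.

Lemma log2_2 : log2 2 = 1 :> R.
Proof. by rewrite /log2 divff// gt_eqF// ln2_gt0. Qed.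

Lemma log2_X2 n : log2 (2 ^+ n) = n%:R :> R.
Proof. by rewrite /log2 lnXn// mulrnAl divff// gt_eqF// ln2_gt0. Qed.

(** This is log2 s <= s at s = t / 8. The slope 1/8 turns a mean of 15 into 15/8, which together
    with 3 stays below 5. *)
Lemma log2_le t : 0 < t -> log2 t <= 3 + t / 8.
Proof.
move=> t0; have s0 : 0 < t / 8 by rewrite divr_gt0.
have tE : t = 2 ^+ 3 * (t / 8) by field.
rewrite {1}tE log2M ?exprn_gt0// log2_X2 lerD2l.
set s := t / 8 in s0 *.
rewrite /log2 ler_pdivrMr ?ln2_gt0//.
have sE : s = 2 * (s / 2) by field.
have s20 : 0 < s / 2 by rewrite divr_gt0.
rewrite {1}sE lnM ?posrE//.
have := ln_le_sub1 s20; have := ln2_ge; have := ln2_le1.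
nra.
Qed.

Lemma log2_ge0 x : 1 <= x -> 0 <= log2 x.
Proof. by move=> x1; apply: divr_ge0; [exact: ln_ge0|exact: (ltW ln2_gt0)]. Qed.

Lemma log2_nat_ge0 (n : nat) : 0 <= log2 (n%:R : R).
Proof.
case: n => [|n]; first by rewrite /log2 ln0// mul0r.
by apply: log2_ge0; rewrite ler1n.
Qed.

Lemma log2_nat_le (n : nat) : log2 (n.+1%:R : R) <= n%:R.
Proof.
rewrite -[leRHS]log2_X2; apply: ler_log2 => //.
by rewrite -natrX ler_nat; exact: ltn_expl.
Qed.

Lemma measurable_log2 : measurable_fun setT (@log2 R).
Proof. by apply: measurable_funM => //; exact: measurable_ln. Qed.

End log2_facts.

Section messages.
Context d d' d'' (TX : measurableType d) (TY : measurableType d')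
  (T : measurableType d'') (R : realType).
Variables (C : channel TX TY R) (omega : R) (P : probability T R).
Variables (N : nat) (N_gt0 : (0 < N)%N) (W : common_randomness P (PY C) N).
Hypothesis bounding : extended_bounding C omega.
Variable x : TX.

Local Notation r := (ratio C x).
Local Notation o := (omega_of C x).
Local Notation D := (@accept_rate R N omega).
Local Notation rejx := (@rej _ TY R (PY C) N r o omega).
Local Notation acc := (accepted omega N_gt0 W x).
Local Notation K := (K1 omega N_gt0 W x).
Local Notation g := (group_size omega N).
Local Notation E f := (\int[P]_w (f w)%:E)%E.

Let mr : measurable_fun setT r. Proof. exact: measurable_ratio_x. Qed.
Let r0 y : 0 <= r y. Proof. exact: ratio_ge0. Qed.
Let Er : (\int[PY C]_y (r y)%:E = 1)%E. Proof. exact: (integral_ratio1 bounding). Qed.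
Let o1 : 1 <= o. Proof. exact: (omega_of_ge1 bounding). Qed.
Let ro y : r y <= o. Proof. exact: (ratio_le bounding). Qed.
Let oom : o <= omega. Proof. exact: (omega_of_le bounding). Qed.
Let D0 : 0 < D. Proof. exact: (D_gt0 N_gt0 o1 oom). Qed.
Let D1 : D <= 1. Proof. exact: (D_le1 N_gt0 o1 oom). Qed.

Lemma K1_accepted w : (exists i, acc w i) ->
  acc w (K w) /\ forall l, (l < K w)%N -> ~~ acc w l.
Proof.
move=> h; rewrite /K1; case: pselect => // h'; case: ex_minnP => m am mmin.
by split => // l lm; apply/negP => /mmin; rewrite leqNgt lm.
Qed.

Lemma K1_none w : ~ (exists i, acc w i) -> K w = 0%N.
Proof. by move=> h; rewrite /K1; case: pselect. Qed.

Lemma prod_rej_ge1 n w : regular W w -> (forall l, (l < n)%N -> ~~ acc w l) ->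
  1 <= \prod_(l < n) rejx (Bt W l w).
Proof.
move=> rw H; elim: n H => [_|n IH H]; first by rewrite big_ord0.
rewrite big_ord_recr/= -[X in X <= _]mulr1; apply: ler_pM => //.
  by apply: IH => l ln; apply: H; rewrite ltnW.
exact: (rejected_rej bounding rw (H n (ltnSn n))).
Qed.

Lemma group_sizeP : g%:R * D <= 1 < g.+1%:R * D.
Proof.
have := @truncn_itv R D^-1; rewrite invr_ge0 (ltW D0) => /(_ isT)/andP[g1 g2].
by rewrite -ler_pdivlMr// -ltr_pdivrMr// div1r; apply/andP; split.
Qed.

Lemma group_size_gt0 : (0 < g)%N.
Proof.
have /andP[_] := group_sizeP; rewrite lt0n; apply: contraTneq => ->.
by rewrite mul1r -leNgt.
Qed.

(** A Bernoulli inequality gives (1 - D)^g (1 - D + g D) <= 1 - D, and g D > 1 - D by the choice of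
    g; dividing by 1 - D needs D < 1. *)
Lemma group_reject : (1 - D) ^+ g <= 2^-1.
Proof.
have /andP[_ gD] := group_sizeP; have g0 := group_size_gt0.
have key n : (1 - D) ^+ n * (1 - D + n%:R * D) <= 1 - D.
  elim: n => [|n IH]; first by rewrite expr0 mul0r addr0 mul1r.
  apply: le_trans IH; rewrite exprSr -mulrA ler_wpM2l ?exprn_ge0 ?subr_ge0//.
  rewrite -natr1; have n0 : (0 : R) <= n%:R by [].
  have : 0 <= n%:R * D ^+ 2 by rewrite mulr_ge0// sqr_ge0.
  rewrite expr2; lra.
have [->|Dn1] := eqVneq D 1.
  by rewrite subrr expr0n -leqn0 leqNgt g0/= invr_ge0.
have a0 : 0 < 1 - D by rewrite subr_gt0 lt_neqAle Dn1.
have := key g; rewrite -natr1 in gD.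
have q0 : 0 <= (1 - D) ^+ g by rewrite exprn_ge0// ltW.
set q := (1 - D) ^+ g in q0 *; set G := g%:R in gD * => H.
have : q * (2 * (1 - D)) <= 1 - D.
  by apply: le_trans H; rewrite ler_wpM2l//; lra.
rewrite mulrA -[leRHS]mul1r ler_pM2r//; lra.
Qed.

(** log2 (n + 1) <= n, and n counts the m for which the first m + 1 groups are entirely rejected;
    each such m contributes a product at least 1. *)
Lemma msgL_le w : regular W w ->
  ((log2 (msgL omega N_gt0 W x w)%:R : R)%:E <=
   \sum_(0 <= m <oo) (\prod_(l < m.+1 * g) rejx (Bt W l w))%:E)%E.
Proof.
move=> rw; have rp n : 0 <= \prod_(l < n) rejx (Bt W l w).
  by apply: prodr_ge0 => l _; exact: rej_ge0.
apply: (@le_trans _ _ ((K w %/ g)%:R : R)%:E).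
  by rewrite lee_fin; exact: log2_nat_le.
(* If no batch is accepted, the default [K1] = 0 makes the left-hand side 0. *)
have [h|/K1_none ->] := pselect (exists i, acc w i); last first.
  by rewrite div0n; apply: nneseries_ge0 => m _ _; rewrite lee_fin.
have [_ hr] := K1_accepted h.
apply: (@le_trans _ _ (\sum_(0 <= m < K w %/ g) (\prod_(l < m.+1 * g) rejx (Bt W l w))%:E)%E).
  have -> : ((K w %/ g)%:R : R)%:E = (\sum_(0 <= m < K w %/ g) 1%:E)%E.
    by rewrite sumEFin big_const_nat subn0 iter_addr addr0.
  rewrite [leLHS]big_mkord [leRHS]big_mkord.
  apply: lee_sum => m _; rewrite lee_fin; have mK := ltn_ord m.
  apply: prod_rej_ge1 => // l lm; apply: hr; apply: (leq_trans lm).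
  by apply: leq_trans (leq_divM _ g); rewrite leq_mul2r mK orbT.
by apply: nneseries_lim_ge => m _ _; rewrite lee_fin.
Qed.

Lemma ae_regular : {ae P, forall w, regular W w}.
Proof.
have aeU : {ae P, forall w, forall i, 0 < cU W i w}.
  apply: ae_foralln => i; exists [set w | (cU W i w <= 0)%R]; split.
  - have m : measurable_fun setT (fun w => cU W i w <= 0).
      by apply: measurable_fun_ler => //; exact: measurable_UT.
    by rewrite -[X in measurable X]setTI; exact: (m measurableT [set true]).
  - apply/eqP; rewrite eq_le measure_ge0 andbT.
    by have := prob_U_le W i 0; rewrite maxxx.
  - by move=> w /= /negP; rewrite -leNgt.
have aeS : {ae P, forall w, forall n, forall j, 0 < cS W n j w}.
  apply: ae_foralln => i.
  have aej (j : 'I_N) : {ae P, forall w, 0 < cS W i j w}.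
    exists (cS W i j @^-1` `]-oo, 0%R]%classic); split.
    - by rewrite -[X in measurable X]setTI; exact: measurable_funPT.
    - rewrite -[LHS]/(distribution P (cS W i j) `]-oo, 0%R]%classic) cS_law//.
      rewrite /exponential_prob -integral_itv_bndo_bndc; last first.
        by apply/measurable_funTS/measurable_EFinP; exact: measurable_exponential_pdf.
      apply: integral0_eq => t /=; rewrite in_itv/= => t0.
      by rewrite lt0_exponential_pdf.
    - by move=> w /= /negP; rewrite -leNgt in_itv.
  (* The finite range of j is extended to all naturals, to use the countable intersection once
     more. *)
  have aen : {ae P, forall w, forall n, if insub n is Some j then 0 < cS W i j w else true}.
    by apply: ae_foralln => n; case: insubP => [j _ _|_]; [exact: aej|exact: aeW].
  by apply: filterS aen => w H j; have := H j; rewrite valK.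
by apply: filterS2 aeS aeU => w H1 H2; split.
Qed.

Lemma E_log_msgL :
  (E (fun w => log2 (msgL omega N_gt0 W x w)%:R) <= 1)%E.
Proof.
have rp n w : 0 <= \prod_(l < n) rejx (Bt W l w).
  by apply: prodr_ge0 => l _; exact: rej_ge0.
have mp n : measurable_fun setT (fun w => (\prod_(l < n) rejx (Bt W l w))%:E).
  apply/measurable_EFinP; apply: measurable_prod => l _.
  exact: (measurableT_comp (measurable_rej _ mr _ _) (measurable_BtT W l)).
apply: (@le_trans _ _ (\int[P]_w
    \sum_(0 <= m <oo) (\prod_(l < m.+1 * g) rejx (Bt W l w))%:E)%E).
  apply: ae_le_lower_integral.
  - by move=> w; apply: nneseries_ge0 => m _ _; rewrite lee_fin.
  - by apply: ge0_emeasurable_sum => // m w _ _; rewrite lee_fin.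
  - by apply: filterS ae_regular => w; exact: msgL_le.
rewrite integral_nneseries//; last by move=> m w _; rewrite lee_fin.
(* The means decay at least like 1/2, 1/4, 1/8, ..., whose sum is 1. *)
apply: le_trans (@epsilon_trick0 R 1 xpredT ler01).
apply: lee_nneseries => [m _ _|m _].
  by apply: integral_ge0 => w _; rewrite lee_fin.
apply: (le_trans (prod_rej W N_gt0 mr r0 Er o1 ro oom _)).
rewrite lee_fin mulnC exprM div1r natrX -exprVn lerXn2r ?nnegrE ?invr_ge0//.
- by rewrite exprn_ge0// subr_ge0.
- exact: group_reject.
Qed.

End messages.

(** * The rank messages *)

Section rank_messages.
Context d d' d'' (TX : measurableType d) (TY : measurableType d')
  (T : measurableType d'') (R : realType).
Variables (C : channel TX TY R) (omega : R) (P : probability T R).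
Variables (N : nat) (N_gt0 : (0 < N)%N) (W : common_randomness P (PY C) N).
Hypothesis bounding : extended_bounding C omega.
Variable x : TX.

Local Notation r := (ratio C x).
Local Notation o := (omega_of C x).
Local Notation D := (@accept_rate R N omega).
Local Notation rejx := (@rej _ TY R (PY C) N r o omega).
Local Notation acc := (accepted omega N_gt0 W x).
Local Notation K := (K1 omega N_gt0 W x).
Local Notation g := (group_size omega N).
Local Notation E f := (\int[P]_w (f w)%:E)%E.
Local Notation rank1 w := ((msgK1 omega N_gt0 W x w)%:R : R).
Local Notation rank2 w := ((msgK2 omega N_gt0 W x w)%:R : R).
Local Notation asum := (@accept_sum _ TY R (PY C) N r o omega).
Local Notation arank := (@accept_rank _ TY R (PY C) N r o omega).

Let mr : measurable_fun setT r. Proof. exact: measurable_ratio_x. Qed.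
Let r0 y : 0 <= r y. Proof. exact: ratio_ge0. Qed.
Let Er : (\int[PY C]_y (r y)%:E = 1)%E. Proof. exact: (integral_ratio1 bounding). Qed.
Let o1 : 1 <= o. Proof. exact: (omega_of_ge1 bounding). Qed.
Let ro y : r y <= o. Proof. exact: (ratio_le bounding). Qed.
Let oom : o <= omega. Proof. exact: (omega_of_le bounding). Qed.
Let D0 : 0 < D. Proof. exact: (D_gt0 N_gt0 o1 oom). Qed.
Let D1 : D <= 1. Proof. exact: (D_le1 N_gt0 o1 oom). Qed.
Let g0 : (0 < g)%N. Proof. exact: (group_size_gt0 N_gt0 bounding x). Qed.

Definition group_of (i : nat) : seq nat :=
  index_iota (i %/ g * g) ((i %/ g).+1 * g).

Lemma mem_group_of i : i \in group_of i.
Proof. by rewrite mem_index_iota leq_divM ltn_ceil. Qed.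

Lemma count_group_of i : count (fun l => l != i) (group_of i) = g.-1.
Proof.
have := count_predC (pred1 i) (group_of i).
rewrite (count_uniq_mem _ (iota_uniq _ _)) mem_group_of size_iota.
by rewrite mulSn addnK => <-; rewrite add1n.
Qed.

Lemma rank1E w : rank1 w = group_rank W group_of (K w) w.
Proof.
rewrite /msgK1 /msgL/= natr_sum /group_rank (bigD1_seq (K w))/=.
- by rewrite lexx.
- exact: mem_group_of.
- exact: iota_uniq.
Qed.

Lemma rank1_le w : (msgK1 omega N_gt0 W x w <= g)%N.
Proof.
rewrite /msgK1 /msgL/=; apply: (@leq_trans (\sum_(K w %/ g * g <= i < (K w %/ g).+1 * g) 1)).
  by apply: leq_sum => i _; case: (_ <= _)%R.
by rewrite sum_nat_const_nat muln1 mulSn addnK.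
Qed.

Lemma rank2E w : rank2 w = local_rank (K2 omega N_gt0 W x w) (St W (K w) w).
Proof.
rewrite /msgK2 natr_sum /local_rank (bigD1 (K2 omega N_gt0 W x w))//= lexx.
by congr (_ + _); apply: eq_bigr => j _; rewrite !tnth_mktuple.
Qed.

Lemma rank2_le w : (msgK2 omega N_gt0 W x w <= N)%N.
Proof.
rewrite /msgK2; apply: (@leq_trans (\sum_(j < N) 1)).
  by apply: leq_sum => i _; case: (_ <= _)%R.
by rewrite sum_nat_const card_ord muln1.
Qed.

Definition log_weight (y : TY) : R := log2 (1 + r y) + 3.

Lemma log_weight_ge0 y : 0 <= log_weight y.
Proof. by rewrite addr_ge0// log2_ge0// lerDl. Qed.

Lemma measurable_log_weight : measurable_fun setT log_weight.
Proof.
apply: measurable_funD => //; apply: (measurableT_comp measurable_log2).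
exact: measurable_funD.
Qed.

(* log2 (K1 K2) = log2 (1 + r) + log2 t with t = K1 K2 / (1 + r), and log2 t <= 3 + t / 8. *)
Definition stop_bound i w : R := asum log_weight (Bt W i w) +
  group_rank W group_of i w * arank (Bt W i w) / 8.

Lemma stop_bound_ge0 i w : 0 <= stop_bound i w.
Proof.
apply: addr_ge0; first by apply: accept_sum_ge0; exact: log_weight_ge0.
by rewrite divr_ge0// mulr_ge0 ?group_rank_ge0// accept_rank_ge0.
Qed.

Lemma log_ranks_accepted w : regular W w -> acc w (K w) ->
  log2 (rank1 w) + log2 (rank2 w) <= stop_bound (K w) w.
Proof.
move=> rw aK; set i := K w in aK *; set k := candidate N_gt0 W x w i.
have ak := accepted_accepts bounding rw aK; rewrite -/k in ak.
have l0 : 0 <= lam r (Yt W i w) k by exact: lam_ge0.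
have L0 : 0 < 1 + lam r (Yt W i w) k by rewrite ltr_pwDl.
have G1 : 1 <= group_rank W group_of i w by rewrite lerDl sumr_ge0.
have K1 : 1 <= local_rank k (St W i w) by rewrite lerDl sumr_ge0.
have G0 : 0 < group_rank W group_of i w by exact: lt_le_trans G1.
have K0 : 0 < local_rank k (St W i w) by exact: lt_le_trans K1.
have -> : log2 (rank1 w) + log2 (rank2 w) =
    log2 (1 + lam r (Yt W i w) k) + log2 (group_rank W group_of i w *
      (local_rank k (St W i w) / (1 + lam r (Yt W i w) k))).
  rewrite rank1E rank2E -(log2M G0 K0) -(log2M L0 (mulr_gt0 G0 (divr_gt0 K0 L0))).
  congr log2; by rewrite -/i -/k mulrCA [X in _ = _ * X]mulrC divfK// gt_eqF.
have HA : log_weight (tnth (Yt W i w) k) <= asum log_weight (Bt W i w).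
  rewrite /accept_sum (bigD1 k)//= ak mul1r lerDl.
  by apply: sumr_ge0 => j _; rewrite mulr_ge0// log_weight_ge0.
pose t := local_rank k (St W i w) / (1 + lam r (Yt W i w) k).
have HB : t <= arank (Bt W i w).
  rewrite /accept_rank (bigD1 k)//= ak mul1r lerDl.
  apply: sumr_ge0 => j _; rewrite divr_ge0 ?mulr_ge0 ?local_rank_ge0//.
  by rewrite addr_ge0// lam_ge0.
have t0 : 0 < t by rewrite divr_gt0.
have := log2_le (mulr_gt0 G0 t0); rewrite -/t /stop_bound.
have : group_rank W group_of i w * t <= group_rank W group_of i w * arank (Bt W i w).
  by rewrite ler_wpM2l// ltW.
by move: HA; rewrite /log_weight -/(lam r (Yt W i w) k); lra.
Qed.

Lemma log2_nat_mono (m n : nat) : (m <= n)%N -> log2 (m%:R : R) <= log2 n%:R.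
Proof.
case: m => [_|m mn]; first by rewrite {1}/log2 ln0// mul0r log2_nat_ge0.
by apply: ler_log2; rewrite ?ltr0n ?ler_nat.
Qed.

(* When none of the first n batches is accepted, the ranks are still at most g and N, so
   that almost sure termination is not needed. *)
Lemma log_ranks_le n w : regular W w ->
  log2 (rank1 w) + log2 (rank2 w) <=
  \sum_(i < n) (\prod_(l < i) rejx (Bt W l w)) * stop_bound i w +
  (log2 g%:R + log2 N%:R) * \prod_(l < n) rejx (Bt W l w).
Proof.
move=> rw; have rp m : 0 <= \prod_(l < m) rejx (Bt W l w).
  by apply: prodr_ge0 => l _; exact: rej_ge0.
have C0 : 0 <= log2 g%:R + log2 N%:R :> R by rewrite addr_ge0// log2_nat_ge0.
have S0 (p : pred 'I_n) :
    0 <= \sum_(i < n | p i) (\prod_(l < i) rejx (Bt W l w)) * stop_bound i w.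
  by apply: sumr_ge0 => i _; rewrite mulr_ge0// stop_bound_ge0.
have [[i [ni ai]]|H] := pselect (exists i, (i < n)%N /\ acc w i).
  have [aK rK] := K1_accepted (ex_intro (acc w) i ai).
  have Kn : (K w < n)%N.
    by apply: leq_ltn_trans ni; rewrite leqNgt; apply/negP => /rK; rewrite ai.
  rewrite (bigD1 (Ordinal Kn))//= -addrA.
  apply: (le_trans (log_ranks_accepted rw aK)).
  rewrite -[leLHS]addr0 lerD ?addr_ge0 ?S0 ?mulr_ge0 ?rp//.
  rewrite -[leLHS]mul1r ler_wpM2r ?stop_bound_ge0//.
  exact: (prod_rej_ge1 bounding rw rK).
have HS := S0 xpredT; suff HC : log2 (rank1 w) + log2 (rank2 w) <=
    (log2 g%:R + log2 N%:R) * \prod_(l < n) rejx (Bt W l w).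
  by apply: (le_trans HC); rewrite lerDr.
apply: (@le_trans _ _ (log2 g%:R + log2 N%:R)).
  by apply: lerD; apply: log2_nat_mono; [exact: rank1_le|exact: rank2_le].
rewrite -[leLHS]mulr1; apply: ler_wpM2l => //.
apply: (prod_rej_ge1 bounding rw) => l ln; apply/negP => al; apply: H.
by exists l.
Qed.

Lemma measurable_stop_bound i : measurable_fun setT (stop_bound i).
Proof.
apply: measurable_funD.
  exact: (measurableT_comp (measurable_accept_sum _ mr _ _ measurable_log_weight)
    (measurable_BtT W i)).
apply: measurable_funM => //; apply: measurable_funM.
  apply: measurable_funD => //; apply: measurable_sum_cond => l.
  by apply: measurable_bool_natr; apply: measurable_fun_ler; exact: measurable_UT.
exact: (measurableT_comp (measurable_accept_rank _ mr _ _) (measurable_BtT W i)).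
Qed.

(** Either the search stops among the first n batches, where the weights D (1 - D)^i of [stop_at]
    have sum at most 1, or all n are rejected and the crude bound by the sizes is paid with
    probability at most (1 - D)^n. *)
Lemma E_log_ranks_trunc n (lf : R) :
  (\int[PY C]_y (r y * log_weight y)%:E <= lf%:E)%E -> 0 <= lf ->
  (E (fun w => (log2 (rank1 w) + log2 (rank2 w))%R) <=
   (lf + 15 / 8 + (log2 g%:R + log2 N%:R) * (1 - D) ^+ n)%:E)%E.
Proof.
move=> lfE lf0.
have rp m w : 0 <= \prod_(l < m) rejx (Bt W l w).
  by apply: prodr_ge0 => l _; exact: rej_ge0.
have mp m : measurable_fun setT (fun w => \prod_(l < m) rejx (Bt W l w)).
  apply: measurable_prod => l _.
  exact: (measurableT_comp (measurable_rej _ mr _ _) (measurable_BtT W l)).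
have C0 : 0 <= log2 g%:R + log2 N%:R :> R by rewrite addr_ge0// log2_nat_ge0.
have t0 i w : 0 <= (\prod_(l < i) rejx (Bt W l w)) * stop_bound i w.
  by rewrite mulr_ge0// stop_bound_ge0.
have mt i : measurable_fun setT (fun w =>
    (\prod_(l < i) rejx (Bt W l w)) * stop_bound i w).
  by apply: measurable_funM => //; exact: measurable_stop_bound.
pose F w := \sum_(i < n) (\prod_(l < i) rejx (Bt W l w)) * stop_bound i w.
have F0 w : 0 <= F w by exact: sumr_ge0.
have mF : measurable_fun setT F by exact: measurable_sum.
have mC : measurable_fun setT (fun w =>
    (log2 g%:R + log2 N%:R) * \prod_(l < n) rejx (Bt W l w)).
  exact: measurable_funM.
apply: (@le_trans _ _ (E (fun w => F w +
    (log2 g%:R + log2 N%:R) * \prod_(l < n) rejx (Bt W l w)))).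
  apply: ae_le_lower_integral.
  - by move=> w; rewrite lee_fin addr_ge0// mulr_ge0.
  - by apply/measurable_EFinP; exact: measurable_funD.
  - have := ae_regular W.
    by apply: filterS => w rw; rewrite lee_fin; exact: log_ranks_le.
rewrite ge0_integralD_EFin//; last by move=> w; rewrite mulr_ge0.
rewrite EFinD; apply: leeD; last first.
  rewrite ge0_integralM_EFin// EFinM; apply: lee_wpmul2l; first by rewrite lee_fin.
  exact: (prod_rej W N_gt0 mr r0 Er o1 ro oom).
rewrite ge0_integral_sum_EFin//.
have B0 : 0 <= lf + 15 / 8 by rewrite addr_ge0.
apply: (@le_trans _ _ (\sum_(i < n) ((1 - D) ^+ i * (D * (lf + 15 / 8)))%:E)%E).
  apply: lee_sum => i _.
  apply: (stop_at W N_gt0 mr r0 Er o1 ro oom _ log_weight_ge0 measurable_log_weight lfE).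
  have /andP[gD _] := group_sizeP N_gt0 bounding x.
  rewrite count_group_of; apply: le_trans gD.
  by rewrite ler_wpM2r ?(ltW D0)// ler_nat leq_pred.
rewrite sumEFin lee_fin -mulr_suml mulrA ler_piMl//.
have := subrX1 (1 - D) n.
have -> : 1 - D - 1 = - D by ring.
have q0 : 0 <= (1 - D) ^+ n by rewrite exprn_ge0// subr_ge0.
set S := \sum_(_ < _) _ => h; lra.
Qed.

Lemma E_log_ranks :
  (E (fun w => (log2 (rank1 w) + log2 (rank2 w))%R) <=
   \int[PY C]_y (r y * log2 (1 + r y))%:E + 5%:E)%E.
Proof.
have l0 y : 0 <= r y * log2 (1 + r y) by rewrite mulr_ge0// log2_ge0// lerDl.
have ml : measurable_fun setT (fun y => r y * log2 (1 + r y)).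
  apply: measurable_funM => //; apply: (measurableT_comp measurable_log2).
  exact: measurable_funD.
set l := (\int[PY C]_y (r y * log2 (1 + r y))%:E)%E.
have lge0 : (0 <= l)%E by apply: integral_ge0 => y _; rewrite lee_fin.
(* The ratio is bounded by o, so the integrand is bounded as well. *)
have lfin : l \is a fin_num.
  rewrite ge0_fin_numE//; apply: (@le_lt_trans _ _ (\int[PY C]_y (o * log2 (1 + o))%:E)%E).
    apply: le_lower_integral => y; rewrite lee_fin.
      by rewrite mulr_ge0 ?(le_trans ler01 o1)// log2_ge0// lerDl (le_trans ler01 o1).
    apply: ler_pM => //; first by rewrite log2_ge0// lerDl.
    by apply: ler_log2; rewrite ?ltr_pwDl// lerD2l.
  by rewrite integral_cst//= probability_setT mule1 ltry.
have lfE : (\int[PY C]_y (r y * log_weight y)%:E <= (fine l + 3)%:E)%E.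
  have -> : (fine l + 3)%:E = (l + 3%:E)%E by rewrite EFinD fineK.
  under eq_integral do rewrite /log_weight mulrDr [X in _ + X]mulrC.
  rewrite ge0_integralD_EFin//; last 2 first.
  - by move=> y; rewrite mulr_ge0.
  - exact: measurable_funM.
  by rewrite ge0_integralM_EFin// Er mule1.
have lf0 : 0 <= fine l + 3 by rewrite addr_ge0// fine_ge0.
rewrite -(fineK lfin) -EFinD; apply/lee_addgt0Pr => e e0.
have C0 : 0 <= log2 g%:R + log2 N%:R :> R by rewrite addr_ge0// log2_nat_ge0.
(* 5 = 3 + 15/8 + 1/8: the truncation error has to fit into the last term. *)
have [n hn] : exists n, (log2 g%:R + log2 N%:R) * (1 - D) ^+ n <= 1 / 8 + e.
  have q1 : `|1 - D| < 1 by rewrite ger0_norm ?subr_ge0// ltrBlDr ltrDl.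
  have cv : (log2 g%:R + log2 N%:R) * (1 - D) ^+ n @[n --> \oo] --> (0 : R).
    by rewrite -[X in _ --> X](mulr0 (log2 g%:R + log2 N%:R)); apply: cvgMr; exact: cvg_expr.
  have /cvgrPdist_le/(_ e e0)[n _ /(_ n (leqnn n))/=] := cv.
  rewrite sub0r normrN ger0_norm ?mulr_ge0 ?exprn_ge0 ?subr_ge0// => h.
  by exists n; apply: (le_trans h); rewrite lerDr.
apply: (le_trans (E_log_ranks_trunc n lfE lf0)); rewrite -EFinD lee_fin.
by move: hn; lra.
Qed.

End rank_messages.

(** * Zipf codes *)

Section zipf_bounds.
Context {R : realType}.
Implicit Types s : R.

Local Notation zeta s := (\sum_(1 <= n <oo) (n%:R `^ (- s) : R)%:E)%E.

(** The comparison of the series with the integral of t^(-1-s), term by term and in telescoping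
    form. It follows from exp u >= 1 + u and ln ((m + 1) / m) >= 1 / (m + 1). *)
Lemma zeta_term_le s (m : nat) : 0 < s -> (0 < m)%N ->
  s * m.+1%:R `^ (- (1 + s)) <= m%:R `^ (- s) - m.+1%:R `^ (- s).
Proof.
move=> s0 m0; have m0' : 0 < (m%:R : R) by rewrite ltr0n.
have M0 : 0 < (m.+1%:R : R) by rewrite ltr0n.
have hl : m.+1%:R^-1 <= ln (m.+1%:R : R) - ln m%:R.
  have := ln_le_sub1 (divr_gt0 m0' M0); rewrite ln_div ?posrE//.
  have -> : m%:R / m.+1%:R - 1 = - (m.+1%:R : R)^-1.
    by rewrite -[in m%:R](addrK (1 : R) m%:R) -natr1 mulrBl divff ?natr1 ?gt_eqF// mul1r; ring.
  set i := m.+1%:R^-1; set p := ln _; set q := ln _.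
  by lra.
have -> : (m.+1%:R : R) `^ (- (1 + s)) = m.+1%:R `^ (- s) / m.+1%:R.
  by rewrite opprD powRD ?(gt_eqF M0) ?implybT// mulrC powR_inv1// ltW.
have -> : (m%:R : R) `^ (- s) =
    m.+1%:R `^ (- s) * expR (s * (ln m.+1%:R - ln m%:R)).
  by rewrite /powR !gt_eqF// -expRD; congr expR; ring.
have p0 : 0 < (m.+1%:R : R) `^ (- s) by exact: powR_gt0.
rewrite mulrCA -{3}(mulr1 (_ `^ _)) -mulrBr ler_pM2l//.
have := expR_ge1Dx (s * (ln m.+1%:R - ln (m%:R : R))).
have : s * m.+1%:R^-1 <= s * (ln m.+1%:R - ln (m%:R : R)) by rewrite ler_pM2l.
set X := s * _^-1; set Y := s * (_ - _); set Z := expR _.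
by lra.
Qed.

Lemma zeta_partial_le s n : 0 < s ->
  \sum_(1 <= m < n.+2) (m%:R `^ (- (1 + s)) : R) <=
  1 + (1 - n.+1%:R `^ (- s)) / s.
Proof.
move=> s0; elim: n => [|n IH].
  by rewrite big_nat1 !powR1 subrr mul0r addr0.
rewrite big_nat_recr//=; apply: le_trans (lerD IH (lexx _)) _.
have h : n.+2%:R `^ (- (1 + s)) <= (n.+1%:R `^ (- s) - n.+2%:R `^ (- s)) / s.
  by rewrite ler_pdivlMr// mulrC; exact: zeta_term_le.
apply: le_trans (lerD (lexx _) h) _.
by rewrite -addrA -mulrDl lerD2l ler_wpM2r ?invr_ge0 ?(ltW s0)// addrA subrK.
Qed.

Lemma zeta_le s : 0 < s -> (zeta (1 + s) <= (1 + s^-1)%:E)%E.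
Proof.
move=> s0; apply: lime_le.
  by apply: is_cvg_nneseries => n _ _; rewrite lee_fin powR_ge0.
apply: nearW => -[|[|n]]/=.
- by rewrite big_geq// lee_fin addr_ge0// invr_ge0 ltW.
- by rewrite big_geq// lee_fin addr_ge0// invr_ge0 ltW.
rewrite sumEFin lee_fin; apply: (le_trans (zeta_partial_le n s0)).
by rewrite lerD2l ler_piMl ?invr_ge0 ?(ltW s0)// gerBl powR_ge0.
Qed.

Lemma zeta_ge1 s : (1%:E <= zeta s)%E.
Proof.
apply: le_trans (@nneseries_lim_ge R _ xpredT 1 2 _).
  by rewrite big_nat1 powR1.
by move=> n _ _; rewrite lee_fin powR_ge0.
Qed.

(* The harmonic series diverges and fine +oo = 0. *)
Lemma zeta1 : fine (zeta 1) = 0 :> R.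
Proof.
have [->//|zoo] := eqVneq (zeta 1) +oo%E.
have zfin : zeta 1 \is a fin_num.
  by rewrite ge0_fin_numE ?ltey// (le_trans _ (zeta_ge1 1))// lee_fin.
exfalso; apply: (@dvg_harmonic R); apply: nondecreasing_is_cvgn.
  by apply/nondecreasing_seqP => n; rewrite /series/= big_nat_recr//= lerDl.
exists (fine (zeta 1)) => _ [n _ <-]; rewrite /series/= -lee_fin fineK//.
apply: le_trans (@nneseries_lim_ge R _ xpredT 1 n.+1 _); last first.
  by move=> m _ _; rewrite lee_fin powR_ge0.
rewrite sumEFin lee_fin big_add1/=.
by apply: ler_sum => i _; rewrite powR_inv1.
Qed.

(* For e = 0 the exponent 1 + 0^-1 is 1, so that zipf vanishes and all lengths are 0. *)
Lemma codeword_length_le (e : R) m : 0 <= e ->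
  ((codeword_length (1 + e^-1) m)%:~R : R) <=
  (if e == 0 then 0 else 1 + e^-1) * log2 m%:R + (log2 (1 + e) + 1).
Proof.
move=> e0; rewrite /codeword_length.
have C0 : 0 <= log2 (1 + e) + 1 by rewrite addr_ge0// log2_ge0// lerDl.
have L0 : 0 <= (if e == 0 then 0 else 1 + e^-1) * log2 (m%:R : R).
  by rewrite mulr_ge0 ?log2_nat_ge0//; case: ifP => // _; rewrite addr_ge0 ?invr_ge0.
have z0 : zipf (1 + e^-1) m = 0 ->
    ((Num.ceil (- log2 (zipf (1 + e^-1) m)))%:~R : R) <=
    (if e == 0 then 0 else 1 + e^-1) * log2 m%:R + (log2 (1 + e) + 1).
  by move=> ->; rewrite /log2 ln0// mul0r oppr0 ceil0; exact: addr_ge0.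
have [e_0|en0] := eqVneq e 0.
  move: z0; rewrite e_0 eqxx; apply; rewrite /zipf invr0 addr0 zeta1.
  by rewrite invr0 mulr0.
have ep : 0 < e by rewrite lt_def en0.
have i0 : 0 < e^-1 by rewrite invr_gt0.
(* For m = 0 the power 0 ^ (- lambda) is 0, and so is the length. *)
case: m => [|m] in C0 L0 z0 *.
  move: z0; rewrite (negbTE en0); apply.
  by rewrite /zipf powR0 ?mul0r// oppr_eq0 gt_eqF// addr_gt0.
rewrite /zipf; set Z := fine _.
have Zle := zeta_le i0; rewrite invrK in Zle.
have Zge := zeta_ge1 (1 + e^-1).
have Zfin : zeta (1 + e^-1) \is a fin_num.
  rewrite ge0_fin_numE; first exact: le_lt_trans Zle (ltry _).
  by rewrite (le_trans _ Zge)// lee_fin.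
have {Zle} Zle : Z <= 1 + e by rewrite -lee_fin fineK.
have {Zge} Zge : 1 <= Z by rewrite -lee_fin fineK.
have Z0 : 0 < Z by exact: lt_le_trans Zge.
have -> : - log2 (m.+1%:R `^ (- (1 + e^-1)) / Z) =
    (1 + e^-1) * log2 m.+1%:R + log2 Z.
  rewrite log2M ?powR_gt0 ?invr_gt0//.
  by rewrite /log2 ln_powR lnV ?posrE//; ring.
set t := _ + log2 Z.
(* The ceiling accounts for the additional bit. *)
have := ceilB1_lt t; rewrite intrB ltrBlDr => /ltW h; apply: (le_trans h).
rewrite /t addrA lerD2r lerD2l; exact: ler_log2.
Qed.

End zipf_bounds.

Section expected_length_bound.
Context d d' (TX : measurableType d) (T : measurableType d') (R : realType).
Variables (Q : probability TX R) (P : probability T R) (M : TX -> T -> nat).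

Let elog x := (\int[P]_w (log2 (M x w)%:R)%:E)%E.

(** At exponent 1 + 1/e the term (1 + 1/e) log2 M has mean e + 1, normalisation costs log2 (1 + e)
    and rounding 1. Since M may fail to be measurable, the bound passes through
    [lower_integral_affine] twice. *)
Lemma expected_length_le (e : R) :
  (\int[Q]_x elog x = e%:E)%E ->
  (expected_length Q P M <= (e + log2 (1 + e) + 2)%:E)%E.
Proof.
move=> eE.
have l0 x : (0 <= elog x)%E.
  by apply: integral_ge0 => w _; rewrite lee_fin log2_nat_ge0.
have e0 : 0 <= e by rewrite -lee_fin -eE integral_ge0.
have B0 : 0 <= log2 (1 + e) by rewrite log2_ge0// lerDl.
rewrite /expected_length; case: ifP => _; first by rewrite lee_fin !addr_ge0.
rewrite /expectation_XW.
have -> : zipf_exponent Q P M = 1 + e^-1.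
  by rewrite /zipf_exponent /expectation_XW; rewrite -/elog eE.
set a : R := if e == 0 then 0 else 1 + e^-1.
have a0 : 0 <= a by rewrite /a; case: ifP => // _; rewrite addr_ge0 ?invr_ge0.
set c : R := log2 (1 + e) + 1.
have c0 : 0 <= c by rewrite addr_ge0.
apply: (@le_trans _ _ (\int[Q]_x (a%:E * elog x + c%:E))%E).
  apply: le_lower_integral => x; first by rewrite adde_ge0// mule_ge0.
  apply: (@le_trans _ _ (\int[P]_w (a%:E * (log2 (M x w)%:R)%:E + c%:E))%E).
    apply: le_lower_integral => w.
      by rewrite -EFinM -EFinD lee_fin addr_ge0// mulr_ge0// log2_nat_ge0.
    rewrite -EFinM -EFinD lee_fin; exact: codeword_length_le.
  have L0 w : (0 <= (log2 (M x w)%:R)%:E :> \bar R)%E.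
    by rewrite lee_fin log2_nat_ge0.
  apply: (le_trans (lower_integral_affine P a0 c0 L0)).
  by rewrite /= probability_setT mule1.
apply: (le_trans (lower_integral_affine Q a0 c0 l0)).
rewrite /= probability_setT mule1 eE -EFinM -EFinD lee_fin /c /a.
have [->|en0] := eqVneq e 0; first by rewrite mul0r; lra.
by rewrite mulrDl mulVf// mul1r; lra.
Qed.

End expected_length_bound.

(** * Mutual information and the rate *)

Section joint_density.
Context d d' (TX : measurableType d) (TY : measurableType d') (R : realType).
Variables (C : channel TX TY R) (omega : R).
Hypothesis bounding : extended_bounding C omega.

Local Notation r z := (ratio C z.1 z.2).
Local Notation PXY := (PX C \x PY C)%E.

Let r0 (z : TX * TY) : 0 <= r z. Proof. exact: ratio_ge0. Qed.
Let mr : measurable_fun setT (fun z : TX * TY => r z).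
Proof. exact: measurable_ratio. Qed.
Let mer : measurable_fun setT (fun z : TX * TY => (r z)%:E).
Proof. exact/measurable_EFinP. Qed.
Let er0 (z : TX * TY) : (0 <= (r z)%:E :> \bar R)%E.
Proof. by rewrite lee_fin. Qed.

Let nu (A : set (TX * TY)) : \bar R := (\int[PXY]_(z in A) (r z)%:E)%E.
Let nu0 : nu set0 = 0%E. Proof. by rewrite /nu integral_set0. Qed.
Let nu_ge0 A : (0 <= nu A)%E. Proof. by apply: integral_ge0 => z _. Qed.
Let nu_sigma_additive : semi_sigma_additive nu.
Proof. exact: (semi_sigma_additive_nng_induced mer er0). Qed.

(** Both sides are finite measures that agree on rectangles, by [pYX_conditional] and Tonelli. *)
Lemma joint_density A : measurable A ->
  joint C A = (\int[PXY]_(z in A) (ratio C z.1 z.2)%:E)%E.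
Proof.
pose nu' : {measure set (TX * TY) -> \bar R} :=
  HB.pack nu (isMeasure.Build _ _ _ nu nu0 nu_ge0 nu_sigma_additive).
move=> mA; rewrite -/(nu A) -[RHS]/(nu' A).
apply: (measure_unique [set A `*` B | A in measurable & B in measurable]
  (fun=> setT)) => //.
- exact: measurable_prod_measurableType.
- move=> _ _ [A1 mA1 [B1 mB1 <-]] [A2 mA2 [B2 mB2 <-]]; rewrite -setXI.
  exists (A1 `&` A2); first exact: measurableI.
  by exists (B1 `&` B2) => //; exact: measurableI.
- by move=> _; exists setT => //; exists setT => //; rewrite setXTT.
- exact: bigcup_const.
- move=> _ [A1 mA1 [B1 mB1 <-]]; apply: (etrans (pYX_conditional C mA1 mB1)).
  rewrite [RHS]/= /nu [RHS]integral_mkcond fubini_tonelli1; last 2 first.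
  - by apply/(measurable_restrictT _ _).1 => //; [exact: measurableX|exact: measurable_funTS].
  - by move=> z; rewrite patchE; case: ifP.
  rewrite [LHS]integral_mkcond; apply: eq_integral => x _; rewrite patchE /fubini_F.
  have [xA|xA] := boolP (x \in A1).
    transitivity (\int[PY C]_y (ratio C x y * \1_B1 y)%:E)%E.
      have mB : measurable_fun setT (\1_B1 : TY -> R) by exact: measurable_indic.
      have B0 y : 0 <= \1_B1 y :> R by [].
      rewrite (integral_ratio bounding x B0 mB) integral_mkcond; apply: eq_integral => y _.
      by rewrite patchE indicE; case: ifP => _; rewrite (mulr1, mulr0).
    apply: eq_integral => y _; rewrite patchE in_setX/= xA indicE/=.
    by case: ifP => _; rewrite (mulr1, mulr0).
  rewrite integral0_eq// => y _; rewrite patchE in_setX/=.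
  by rewrite (negbTE xA).
- by move=> _; rewrite /= probability_setT ltry.
Qed.

Lemma integral_joint (f : TX * TY -> R) : (forall z, 0 <= f z) ->
  measurable_fun setT f ->
  (\int[joint C]_z (f z)%:E =
   \int[PX C]_x \int[PY C]_y (ratio C x y * f (x, y))%:E)%E.
Proof.
move=> f0 mf; have ef0 z : (0 <= (f z)%:E :> \bar R)%E by rewrite lee_fin.
have mef : measurable_fun setT (fun z => (f z)%:E) by exact/measurable_EFinP.
rewrite (ge0_integral_density r0 mr joint_density ef0 mef).
rewrite fubini_tonelli1; last 2 first.
- by apply: emeasurable_funM => //; exact/measurable_EFinP.
- by move=> z; rewrite mule_ge0// lee_fin.
by apply: eq_integral => x _; apply: eq_integral => y _; rewrite mulrC.
Qed.

Lemma measurable_integral_ratio (f : TX * TY -> R) : (forall z, 0 <= f z) ->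
  measurable_fun setT f ->
  measurable_fun setT (fun x => \int[PY C]_y (ratio C x y * f (x, y))%:E)%E.
Proof.
move=> f0 mf; apply: (measurable_fun_fubini_tonelli_F
    (fun z : TX * TY => (ratio C z.1 z.2 * f z)%:E)).
  by apply/measurable_EFinP; exact: measurable_funM.
by move=> z; rewrite lee_fin mulr_ge0.
Qed.

(** Against the product law the integrand is r / r, which is 1 where r > 0 and 0 elsewhere. *)
Lemma integral_joint_inv_ratio :
  (\int[joint C]_z (ratio C z.1 z.2)^-1%:E <= 1)%E.
Proof.
rewrite (@integral_joint (fun z => (r z)^-1)); last 2 first.
- by move=> z; rewrite invr_ge0.
- exact: (measurable_fun_inv mr).
apply: (@le_trans _ _ (\int[PX C]_x 1%:E)%E); last first.
  by rewrite integral_cst//= probability_setT mule1.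
apply: le_lower_integral => x; first by rewrite lee_fin.
apply: (@le_trans _ _ (\int[PY C]_y 1%:E)%E); last first.
  by rewrite integral_cst//= probability_setT mule1.
apply: le_lower_integral => y; rewrite lee_fin//=.
have [->|n0] := eqVneq (ratio C x y) 0; first by rewrite mul0r.
by rewrite mulfV.
Qed.

(* Tangent of ln at 1, for (1 + t^-1) / 2. At t = 0 the junk values log2 0 = 0 and 0^-1 = 0
   leave 0 <= 1 - 1 / (2 ln 2). *)
Lemma log2_1D_le (t : R) : 0 <= t ->
  log2 (1 + t) <= log2 t + (1 - (2 * ln 2)^-1 + (2 * ln 2)^-1 * t^-1).
Proof.
have l2 := @ln2_gt0 R; have l2' : 0 < 2 * ln (2 : R) by rewrite mulr_gt0.
have c1 : (2 * ln (2 : R))^-1 <= 1.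
  by rewrite invf_le1//; have := @ln2_ge R; lra.
rewrite le_eqVlt => /predU1P[<-|t0].
  have -> : log2 0 = 0 :> R by rewrite /log2 ln0// mul0r.
  by rewrite invr0 mulr0 !addr0 /log2 ln1 mul0r add0r subr_ge0.
have u0 : 0 < t^-1 by rewrite invr_gt0.
have -> : 1 + t = t * (2 * ((1 + t^-1) / 2)).
  by field; rewrite gt_eqF.
have v0 : 0 < (1 + t^-1) / 2 by rewrite divr_gt0// addr_gt0.
have p2 : 0 < 2 :> R by [].
rewrite (log2M t0 (mulr_gt0 p2 v0)) (log2M p2 v0) log2_2 -!addrA lerD2l lerD2l.
have -> : - (2 * ln 2)^-1 + (2 * ln 2)^-1 * t^-1 = ((1 + t^-1) / 2 - 1) / ln 2.
  by rewrite invfM//; field; rewrite gt_eqF//= gt_eqF.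
by rewrite ler_wpM2r ?invr_ge0 ?(ltW l2)// ln_le_sub1.
Qed.

(** Gives integrability of log2 r under the joint law: r is bounded and 1 / r has mean at most 1. *)
Lemma abs_log2_le (t : R) : 0 <= t -> `|log2 t| <= (t + t^-1) * (ln 2)^-1.
Proof.
have l2 := @ln2_gt0 R.
rewrite le_eqVlt => /predU1P[<-|t0].
  have -> : log2 0 = 0 :> R by rewrite /log2 ln0// mul0r.
  by rewrite normr0 invr0 addr0 mul0r.
have u0 : 0 < t^-1 by rewrite invr_gt0.
rewrite /log2 normrM [X in _ * X]ger0_norm ?invr_ge0 ?(ltW l2)//.
rewrite ler_wpM2r ?invr_ge0 ?(ltW l2)// ler_norml.
have := ln_le_sub1 t0; have := ln_le_sub1 u0; rewrite lnV ?posrE//.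
by move=> h1 h2; apply/andP; split; move: h1 h2 u0 t0; set i := t^-1; lra.
Qed.

Local Notation ell x := (\int[PY C]_y (ratio C x y * log2 (1 + ratio C x y))%:E)%E.

Lemma integral_affine_inv_ratio (a b : R) : 0 <= a -> 0 <= b ->
  (\int[joint C]_z (a + b * (ratio C z.1 z.2)^-1)%:E <= (a + b)%:E)%E.
Proof.
move=> a0 b0; have i0 (z : TX * TY) : 0 <= (r z)^-1 by rewrite invr_ge0.
have mi : measurable_fun setT (fun z : TX * TY => (r z)^-1).
  exact: (measurable_fun_inv mr).
have bi0 (z : TX * TY) : 0 <= b * (r z)^-1 by rewrite mulr_ge0.
have mbi : measurable_fun setT (fun z : TX * TY => b * (r z)^-1).
  exact: measurable_funM.
rewrite (ge0_integralD_EFin _ (fun=> a0) (measurable_cst _) bi0 mbi).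
rewrite integral_cst//= probability_setT mule1 (ge0_integralM_EFin _ b0 i0 mi).
rewrite EFinD; apply: leeD => //; rewrite -[leRHS]mule1.
by apply: lee_wpmul2l; [rewrite lee_fin|exact: integral_joint_inv_ratio].
Qed.

(** Jensen for log2 (1 + r) - log2 r = log2 (1 + 1 / r): as 1 / r has mean at most 1, the excess
    over the mutual information is at most log2 2 = 1. *)
Lemma integral_log_ratio : 1 <= omega ->
  exists2 I : R, mutual_information C = I%:E &
    (\int[PX C]_x ell x <= (I + 1)%:E)%E.
Proof.
move=> om1; have om0 : 0 <= omega by exact: le_trans om1.
have l2 := @ln2_gt0 R; have l2' : 0 < 2 * ln (2 : R) by rewrite mulr_gt0.
have li : 0 <= (ln (2 : R))^-1 by rewrite invr_ge0 ltW.
pose c : R := (2 * ln 2)^-1; have c0 : 0 <= c by rewrite invr_ge0 ltW.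
have c1 : 0 <= 1 - c by rewrite subr_ge0 invf_le1//; have := @ln2_ge R; lra.
have i0 (z : TX * TY) : 0 <= (r z)^-1 by rewrite invr_ge0.
have mi : measurable_fun setT (fun z : TX * TY => (r z)^-1).
  exact: (measurable_fun_inv mr).
have ml : measurable_fun setT (fun z : TX * TY => log2 (r z)).
  exact: (measurableT_comp measurable_log2).
have il : (joint C).-integrable setT (fun z => (log2 (r z))%:E).
  apply/integrableP; split; first exact/measurable_EFinP.
  apply: (@le_lt_trans _ _ (\int[joint C]_z ((ln 2)^-1 * omega + (ln 2)^-1 * (r z)^-1)%:E)%E).
    apply: le_lower_integral => z; rewrite lee_fin.
      by rewrite addr_ge0// mulr_ge0.
    apply: (le_trans (abs_log2_le (r0 z))); rewrite -mulrDr mulrC ler_wpM2l//.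
    by rewrite lerD2r (le_trans (ratio_le bounding _ _))// omega_of_le.
  by apply: (le_lt_trans (integral_affine_inv_ratio (mulr_ge0 li om0) li)); exact: ltry.
have ik : (joint C).-integrable setT (fun z => (1 - c + c * (r z)^-1)%:E).
  apply/integrableP; split.
    by apply/measurable_EFinP; apply: measurable_funD => //; exact: measurable_funM.
  under eq_integral => z _ do
    rewrite /= ger0_norm ?(addr_ge0 c1 (mulr_ge0 c0 (i0 z)))//.
  by apply: (le_lt_trans (integral_affine_inv_ratio c1 c0)); exact: ltry.
pose I := fine (mutual_information C).
have IE : mutual_information C = I%:E.
  by rewrite fineK//; exact: integrable_fin_num.
exists I => //.
have -> : (\int[PX C]_x ell x = \int[joint C]_z (log2 (1 + r z))%:E)%E.
  rewrite (@integral_joint (fun z => log2 (1 + r z)))//.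
    by move=> z; rewrite log2_ge0// lerDl.
  by apply: (measurableT_comp measurable_log2); exact: measurable_funD.
apply: (@le_trans _ _ (\int[joint C]_z
    ((log2 (r z))%:E + (1 - c + c * (r z)^-1)%:E))%E).
  apply: le_lower_integral => z; rewrite -EFinD lee_fin; last exact: log2_1D_le.
  by apply: le_trans (log2_1D_le (r0 z)); rewrite log2_ge0// lerDl.
rewrite integralD// -/(mutual_information C) IE EFinD leeD2l//.
by apply: le_trans (integral_affine_inv_ratio c1 c0) _; rewrite subrK.
Qed.

End joint_density.

Section rate_bound.
Context d d' d'' (TX : measurableType d) (TY : measurableType d')
  (T : measurableType d'') (R : realType).
Variables (C : channel TX TY R) (omega : R) (P : probability T R).
Variables (N : nat) (N_gt0 : (0 < N)%N) (W : common_randomness P (PY C) N).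
Hypothesis om1 : 1 <= omega.
Hypothesis bounding : extended_bounding C omega.

Lemma fin_expectation_log (M : TX -> T -> nat) (b : R) :
  (\int[PX C]_x \int[P]_w (log2 (M x w)%:R)%:E <= b%:E)%E ->
  exists2 e : R, 0 <= e &
    (\int[PX C]_x \int[P]_w (log2 (M x w)%:R)%:E = e%:E)%E.
Proof.
set E := (X in (X <= _)%E) => Eb.
have E0 : (0 <= E)%E.
  by do 2 (apply: integral_ge0 => ? _); rewrite lee_fin log2_nat_ge0.
have Efin : E \is a fin_num by rewrite ge0_fin_numE// (le_lt_trans Eb)// ltry.
by exists (fine E); rewrite ?fineK// fine_ge0.
Qed.

(** AM-GM in the form 4 (1 + a) (1 + b) <= (a + b + 2)^2; the factor 4 saves the two bits. *)
Lemma log2_1D2_le (a b S : R) : 0 <= a -> 0 <= b -> a + b + 2 <= S ->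
  log2 (1 + a) + log2 (1 + b) <= 2 * log2 S - 2.
Proof.
move=> a0 b0 abS; have p2 : 0 < 2 :> R by [].
have a1 : 0 < 1 + a by rewrite ltr_pwDl.
have b1 : 0 < 1 + b by rewrite ltr_pwDl.
have S0 : 0 < S by apply: lt_le_trans abS; rewrite addrC ltr_pwDl// addr_ge0.
suff : log2 ((2 * (1 + a)) * (2 * (1 + b))) <= log2 (S * S).
  rewrite (log2M (mulr_gt0 p2 a1) (mulr_gt0 p2 b1)) (log2M p2 a1) (log2M p2 b1).
  by rewrite (log2M S0 S0) log2_2; lra.
apply: ler_log2; first by rewrite !mulr_gt0.
apply: (@le_trans _ _ ((a + b + 2) * (a + b + 2))); last first.
  by apply: ler_pM; rewrite ?addr_ge0.
by have := sqr_ge0 (a - b); rewrite expr2; nra.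
Qed.

Lemma rate_le : (rate omega N_gt0 W <=
  mutual_information C + 2%:E * log2e (mutual_information C + 8%:E) + 12%:E)%E.
Proof.
have [I IE lI] := integral_log_ratio bounding om1.
have eL : (\int[PX C]_x \int[P]_w (log2 (msgL omega N_gt0 W x w)%:R)%:E <= 1%:E)%E.
  apply: (@le_trans _ _ (\int[PX C]_x 1%:E)%E); last first.
    by rewrite integral_cst//= probability_setT mule1.
  by apply: le_lower_integral => x; [rewrite lee_fin|exact: E_log_msgL].
pose l x := (\int[PY C]_y (ratio C x y * log2 (1 + ratio C x y))%:E)%E.
have l0 x : (0 <= l x)%E.
  apply: integral_ge0 => y _.
  have r0 := ratio_ge0 C x y.
  by rewrite lee_fin mulr_ge0// log2_ge0// lerDl.
have ml : measurable_fun setT l.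
  apply: (@measurable_integral_ratio _ _ _ _ _ C
      (fun z => log2 (1 + ratio C z.1 z.2))) => [z|].
    by rewrite log2_ge0// lerDl ratio_ge0.
  apply: (measurableT_comp measurable_log2).
  by apply: measurable_funD => //; exact: measurable_ratio.
pose l1 x := (\int[P]_w (log2 (msgK1 omega N_gt0 W x w)%:R)%:E)%E.
pose l2 x := (\int[P]_w (log2 (msgK2 omega N_gt0 W x w)%:R)%:E)%E.
have l10 x : (0 <= l1 x)%E by apply: integral_ge0 => w _; rewrite lee_fin log2_nat_ge0.
have l20 x : (0 <= l2 x)%E by apply: integral_ge0 => w _; rewrite lee_fin log2_nat_ge0.
have eK : (\int[PX C]_x l1 x + \int[PX C]_x l2 x <= (I + 6)%:E)%E.
  (* Only the sum of the two rank logarithms is controlled, so the separate lower integrals are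
     merged first. *)
  apply: (le_trans (ge0_lower_integralD _ l10 l20)).
  apply: (@le_trans _ _ (\int[PX C]_x (l x + 5%:E))%E).
    apply: le_lower_integral => x; first by rewrite adde_ge0// lee_fin.
    have e0 (M : TX -> T -> nat) w : (0 <= (log2 (M x w)%:R)%:E :> \bar R)%E.
      by rewrite lee_fin log2_nat_ge0.
    apply: (le_trans (ge0_lower_integralD _ (e0 (msgK1 omega N_gt0 W)) (e0 (msgK2 omega N_gt0 W)))).
    under eq_integral do rewrite -EFinD.
    exact: (E_log_ranks N_gt0 W bounding x).
  have f0 : (0 <= 5%:E :> \bar R)%E by rewrite lee_fin.
  rewrite ge0_integralD// integral_cst//= probability_setT mule1.
  apply: (le_trans (leeD lI (lexx _))).
  by rewrite -EFinD lee_fin; lra.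
have [e1 e10 E1] := fin_expectation_log eL.
have i1 : (0 <= \int[PX C]_x l1 x)%E by exact: integral_ge0.
have i2 : (0 <= \int[PX C]_x l2 x)%E by exact: integral_ge0.
have [e2 e20 E2] := fin_expectation_log (le_trans (leeDl _ i2) eK).
have [e3 e30 E3] := fin_expectation_log (le_trans (leeDr _ i1) eK).
rewrite /rate.
apply: le_trans (leeD (leeD (expected_length_le E1) (expected_length_le E2))
  (expected_length_le E3)) _.
move: eK; rewrite /l1 /l2 E2 E3 -EFinD lee_fin => eK.
move: eL; rewrite E1 lee_fin => eL.
have I8 : e2 + e3 + 2 <= I + 8 by lra.
have I80 : 0 < I + 8 by apply: lt_le_trans I8; rewrite addrC ltr_pwDl// addr_ge0.
(* [lne] branches on whether its argument is positive. *)
have I8F : (I + 8 <= 0) = false by rewrite leNgt I80.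
rewrite IE /log2e -EFinD /= I8F.
rewrite -!EFinM -!EFinD lee_fin -/(log2 (I + 8)).
have := log2_1D2_le e20 e30 I8.
have : log2 (1 + e1) <= 1.
  by rewrite -[leRHS]log2_2; apply: ler_log2; lra.
by lra.
Qed.

End rate_bound.

Theorem proposition5p2 (R : realType) (d d' d'' : measure_display)
    (TX : measurableType d) (TY : measurableType d') (T : measurableType d'')
    (C : channel TX TY R) (omega : R) (P : probability T R)
    (N : nat) (N_gt0 : (0 < N)%N) (W : common_randomness P (PY C) N) :
  1 <= omega ->
  extended_bounding C omega ->
  (rate omega N_gt0 W <=
     mutual_information C
     + 2%:E * log2e (mutual_information C + 8%:E) + 12%:E)%E.
Proof. by move=> om1 bounding; exact: rate_le. Qed.
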